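(* Let $\zeta$ denote the Riemann zeta function. If $T$ is sufficiently large then there exists $t\in[T,2T]$ such that $$|\zeta(\tfrac12+it)|\ \ge\ \exp\Big((1+o(1))\frac{\sqrt{\log T}}{\sqrt{\log\log T}}\Big).$$ Moreover, uniformly in the range $3\le V\le \frac15\sqrt{\log T/\log\log T}$, we have $$\operatorname{meas}\{t\in[T,2T]:\ |\zeta(\tfrac12+it)|\ge e^V\}\ \gg\ \frac{T}{(\log T)^4}\exp\Big(-10\,\frac{V^2}{\log\frac{\log T}{8V^2\log V}}\Big).$$
   Context: Here $o(1)$ denotes a quantity tending to $0$ as $T\to\infty$; $\operatorname{meas}$ is Lebesgue measure on $\mathbb R$; and $A\gg B$ means $A\ge cB$ for an absolute constant $c>0$ (here for all sufficiently large $T$ and uniformly in $V$ in the stated range). *)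

(* Defs.v *)
From HB Require Import structures.
From mathcomp Require Import all_boot all_order all_algebra.
From mathcomp Require Import complex ring lra.
From mathcomp Require Import all_classical all_reals all_analysis.
Set Implicit Arguments.
Unset Strict Implicit.
Unset Printing Implicit Defensive.
Import Order.TTheory GRing.Theory Num.Theory.
Import numFieldNormedType.Exports.
Local Open Scope classical_set_scope.
Local Open Scope ring_scope.
Local Open Scope complex_scope.

(* R[i] carries its topology and normed-module structure under the alias
   R[i]^o (a number field as a module over itself); complex differentiability
   of f at s is [derivable (f : R[i]^o -> R[i]^o) s 1]. *)

Section Zeta.
Variable R : realType.
Implicit Types (s z : R[i]) (x : R) (N : nat).

Definition expC z : R[i] :=
  (expR (complex.Re z))%:C * (cos (complex.Im z) +i* sin (complex.Im z)).

(* Principal value of x ^ z; meaningful for x > 0 only. *)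
Definition cpow x z : R[i] := expC (z * (ln x)%:C).

Definition zeta_approx s N : R[i] :=
  \sum_(1 <= n < N.+1) cpow n%:R (- s) - cpow N%:R (1 - s) / (1 - s).

(* The Riemann zeta function on the half-plane Re s > 0, s != 1 (elsewhere the
   value is unspecified).  The limit exists there (ZetaFacts.zeta_cvg), and it is
   the analytic continuation of the Dirichlet series: it equals
   sum_n n^(-s) when Re s > 1 (ZetaFacts.zeta_dirichlet) and is holomorphic on
   Re s > 0, s != 1 (ZetaFacts.zeta_holomorphic), a connected open set. *)
Definition zeta s : R[i] := limn (zeta_approx s : nat -> R[i]^o).

End Zeta.

Module ZetaFacts.

Section Helpers.
Variable R : realType.
Implicit Types (s z w : R[i]) (x y : R) (n N k : nat).
Local Notation Re := complex.Re.
Local Notation Im := complex.Im.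
Local Notation normc := ComplexField.Normc.normc.

Lemma cReM z w : Re (z * w) = Re z * Re w - Im z * Im w.
Proof. by case: z w => [a b] [c d]. Qed.
Lemma cImM z w : Im (z * w) = Re z * Im w + Im z * Re w.
Proof. by case: z w => [a b] [c d]. Qed.
Lemma cReD z w : Re (z + w) = Re z + Re w.
Proof. by case: z w => [a b] [c d]. Qed.
Lemma cImD z w : Im (z + w) = Im z + Im w.
Proof. by case: z w => [a b] [c d]. Qed.
Lemma cReN z : Re (- z) = - Re z.
Proof. by case: z. Qed.
Lemma cImN z : Im (- z) = - Im z.
Proof. by case: z. Qed.
Lemma complex_ext z w : Re z = Re w -> Im z = Im w -> z = w.
Proof. by case: z w => [a b] [c d] /= -> ->. Qed.

Lemma norm_normc z : `|z| = (normc z)%:C.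
Proof. by case: z. Qed.
Lemma normc_ge0 z : 0 <= normc z.
Proof. by case: z => a b; exact: sqrtr_ge0. Qed.
Lemma normc_le z : normc z <= `|Re z| + `|Im z|.
Proof.
case: z => a b /=.
rewrite -(@ler_pXn2r _ 2)// ?nnegrE ?sqrtr_ge0 ?addr_ge0//.
rewrite sqr_sqrtr ?addr_ge0 ?sqr_ge0// sqrrD !real_normK ?num_real//.
by rewrite lerD2r lerDl mulrn_wge0// mulr_ge0.
Qed.
Lemma Re_le_normc z : `|Re z| <= normc z.
Proof.
case: z => a b /=; rewrite -(@ler_pXn2r _ 2)// ?nnegrE ?sqrtr_ge0//.
by rewrite sqr_sqrtr ?addr_ge0 ?sqr_ge0// real_normK ?num_real// lerDl sqr_ge0.
Qed.
Lemma Im_le_normc z : `|Im z| <= normc z.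
Proof.
case: z => a b /=; rewrite -(@ler_pXn2r _ 2)// ?nnegrE ?sqrtr_ge0//.
by rewrite sqr_sqrtr ?addr_ge0 ?sqr_ge0// real_normK ?num_real// lerDr sqr_ge0.
Qed.
Lemma normcr x : normc x%:C = `|x|.
Proof. by rewrite /= expr0n/= addr0 sqrtr_sqr. Qed.
Lemma normc_add z w : normc (z + w) <= normc z + normc w.
Proof. exact: le_normcD. Qed.
Lemma normc_opp z : normc (- z) = normc z.
Proof. exact: normcN. Qed.
Lemma normc_mul z w : normc (z * w) = normc z * normc w.
Proof. exact: ComplexField.Normc.normcM. Qed.
Lemma normc_sum (F : nat -> R[i]) m n :
  normc (\sum_(m <= i < n) F i) <= \sum_(m <= i < n) normc (F i).
Proof.
elim/big_ind2 : _ => //; first by rewrite ComplexField.Normc.normc0.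
by move=> a b c d ab cd; apply: le_trans (normc_add _ _) _; exact: lerD.
Qed.

Lemma expCD z w : expC (z + w) = expC z * expC w.
Proof.
apply: complex_ext; rewrite /expC !(cReD, cImD, cReM, cImM)/= expRD cosD sinD; ring.
Qed.
Lemma expC0 : expC (0 : R[i]) = 1.
Proof. by apply: complex_ext; rewrite /expC /= expR0 cos0 sin0; ring. Qed.
Lemma normc_expC z : normc (expC z) = expR (Re z).
Proof.
rewrite normc_mul normcr ger0_norm ?expR_ge0//=.
by rewrite cos2Dsin2 sqrtr1 mulr1.
Qed.

Definition cder (f : R -> R[i]) x (d : R[i]) :=
  is_derive x 1 (fun y => Re (f y)) (Re d) /\
  is_derive x 1 (fun y => Im (f y)) (Im d).

Lemma cder_ext f g x d : f =1 g -> cder f x d -> cder g x d.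
Proof. by move=> /funext ->. Qed.
Lemma cder_eq f x d e : cder f x d -> d = e -> cder f x e.
Proof. by move=> ? <-. Qed.
Lemma cder_cst z x : cder (fun=> z) x 0.
Proof. by split; exact: is_derive_cst. Qed.
Lemma cderD f g x d e : cder f x d -> cder g x e ->
  cder (fun y => f y + g y) x (d + e).
Proof.
move=> [fr fi] [gr gi]; split.
  rewrite cReD (_ : (fun y => _) = (fun y => Re (f y)) + (fun y => Re (g y))).
    exact: is_deriveD.
  by apply/funext => y; rewrite cReD.
rewrite cImD (_ : (fun y => _) = (fun y => Im (f y)) + (fun y => Im (g y))).
  exact: is_deriveD.
by apply/funext => y; rewrite cImD.
Qed.
Lemma cderN f x d : cder f x d -> cder (fun y => - f y) x (- d).
Proof.
move=> [fr fi]; split.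
  rewrite cReN (_ : (fun y => _) = - (fun y => Re (f y))).
    exact: is_deriveN.
  by apply/funext => y; rewrite cReN.
rewrite cImN (_ : (fun y => _) = - (fun y => Im (f y))).
  exact: is_deriveN.
by apply/funext => y; rewrite cImN.
Qed.
Lemma cderM f g x d e : cder f x d -> cder g x e ->
  cder (fun y => f y * g y) x (d * g x + f x * e).
Proof.
move=> [fr fi] [gr gi]; split.
  rewrite (_ : (fun y => _) = (fun y => Re (f y)) * (fun y => Re (g y))
    - (fun y => Im (f y)) * (fun y => Im (g y))).
    apply: is_derive_eq; rewrite cReD !cReM /GRing.scale/=; ring.
  by apply/funext => y; rewrite cReM.
rewrite (_ : (fun y => _) = (fun y => Re (f y)) * (fun y => Im (g y))
    + (fun y => Im (f y)) * (fun y => Re (g y))).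
  apply: is_derive_eq; rewrite cImD !cImM /GRing.scale/=; ring.
by apply/funext => y; rewrite cImM.
Qed.
Lemma cder_real (f : R -> R) x (d : R) : is_derive x 1 f d ->
  cder (fun y => (f y)%:C) x d%:C.
Proof. by move=> fd; split => //=; exact: is_derive_cst. Qed.

Lemma cder_expC f x d : cder f x d ->
  cder (fun y => expC (f y)) x (d * expC (f x)).
Proof.
move=> [fr fi].
have fe : is_derive x 1 (fun y => expR (Re (f y))) (expR (Re (f x)) * Re d).
  by apply: (@is_derive1_comp _ expR (fun y => Re (f y))).
have fc : is_derive x 1 (fun y => cos (Im (f y))) (- sin (Im (f x)) * Im d).
  by apply: (@is_derive1_comp _ cos (fun y => Im (f y))).
have fs : is_derive x 1 (fun y => sin (Im (f y))) (cos (Im (f x)) * Im d).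
  by apply: (@is_derive1_comp _ sin (fun y => Im (f y))).
have fcs : cder (fun y => cos (Im (f y)) +i* sin (Im (f y))) x
    ((- sin (Im (f x)) * Im d) +i* (cos (Im (f x)) * Im d)) by [].
apply: cder_eq (cderM (cder_real fe) fcs) _.
by apply: complex_ext; rewrite /expC ?(cReD, cImD, cReM, cImM)/=; ring.
Qed.

Lemma real_mvt (f df : R -> R) (a b M : R) : a <= b ->
  (forall x, a <= x <= b -> is_derive x 1 f (df x)) ->
  (forall x, a <= x <= b -> `|df x| <= M) ->
  `|f b - f a| <= M * (b - a).
Proof.
move=> ab fd dM.
have [||c] := @MVT_segment R f df a b ab.
- by move=> x; rewrite in_itv/= => /andP[ax xb]; apply: fd; rewrite !ltW.
- apply: derivable_within_continuous => x; rewrite in_itv/= => xab.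
  by have [] := fd x xab.
rewrite in_itv/= => cab ->; rewrite normrM (ger0_norm (x := b - a)) ?subr_ge0//.
by rewrite ler_wpM2r ?subr_ge0// dM.
Qed.

Lemma complex_mvt (f df : R -> R[i]) (a b M : R) : a <= b ->
  (forall x, a <= x <= b -> cder f x (df x)) ->
  (forall x, a <= x <= b -> normc (df x) <= M) ->
  normc (f b - f a) <= 2 * M * (b - a).
Proof.
move=> ab fd dM; apply: le_trans (normc_le _) _.
rewrite cReD cReN cImD cImN -mulrA mulr_natl mulr2n lerD//.
- apply: (@real_mvt (fun y => Re (f y)) (fun y => Re (df y))) => // x xab.
    by have [] := fd x xab.
  exact: le_trans (Re_le_normc _) (dM x xab).
- apply: (@real_mvt (fun y => Im (f y)) (fun y => Im (df y))) => // x xab.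
    by have [] := fd x xab.
  exact: le_trans (Im_le_normc _) (dM x xab).
Qed.

Lemma expC_sub1 z : normc (expC z - 1) <= 2 * normc z * expR (normc z).
Proof.
have := @complex_mvt (fun t => expC (t%:C * z))
  (fun t => z * expC (t%:C * z)) 0 1 (normc z * expR (normc z)) ler01.
rewrite mul1r mul0r expC0 subr0 mulr1 mulrA; apply.
- move=> x _; apply: cder_eq.
    apply: cder_expC; apply: cderM; last exact: cder_cst.
    by apply: cder_real; exact: is_derive_id.
  by rewrite mulr0 addr0 mul1r.
- move=> x /andP[x0 x1]; rewrite normc_mul ler_wpM2l ?normc_ge0//.
  rewrite normc_expC ler_expR cReM/= mul0r subr0.
  apply: le_trans (ler_norm _) _; rewrite normrM (ger0_norm x0).
  by apply: le_trans (ler_piMl _ x1) (Re_le_normc _).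
Qed.

Lemma expC_sub2 z :
  normc (expC z - 1 - z) <= 4 * normc z ^+ 2 * expR (normc z).
Proof.
have := @complex_mvt (fun t => expC (t%:C * z) - t%:C * z)
  (fun t => z * (expC (t%:C * z) - 1)) 0 1
  (normc z * (2 * normc z * expR (normc z))) ler01.
rewrite !mul1r !mul0r expC0 !subr0 mulr1 (addrAC _ (- z)).
rewrite (_ : 2 * (_ * _) = 4 * normc z ^+ 2 * expR (normc z)); last by ring.
apply.
- move=> x _; apply: cder_eq.
    apply: cderD; last apply: cderN.
      apply: cder_expC; apply: cderM; last exact: cder_cst.
      by apply: cder_real; exact: is_derive_id.
    apply: cderM; last exact: cder_cst.
    by apply: cder_real; exact: is_derive_id.
  by rewrite mulr0 addr0 mul1r mulrBr mulr1.
- move=> x /andP[x0 x1]; rewrite normc_mul ler_wpM2l ?normc_ge0//.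
  have xz : normc (x%:C * z) <= normc z.
    by rewrite normc_mul normcr ger0_norm// ler_piMl ?normc_ge0.
  apply: le_trans (expC_sub1 _) _.
  by rewrite ler_pM ?expR_ge0 ?mulr_ge0 ?normc_ge0 ?ler_expR ?ler_wpM2l.
Qed.
End Helpers.

Section Remainder.
Variable R : realType.
Implicit Types (s z w h : R[i]) (x y : R) (n N k : nat).
Local Notation Re := complex.Re.
Local Notation Im := complex.Im.
Local Notation normc := ComplexField.Normc.normc.

Lemma rcD x y : (x + y)%:C = x%:C + y%:C :> R[i].
Proof. by apply: complex_ext => /=; rewrite ?addr0. Qed.
Lemma rcM x y : (x * y)%:C = x%:C * y%:C :> R[i].
Proof. by apply: complex_ext => /=; ring. Qed.

(* em f A k, for A a primitive of f, is f(k+2) minus the integral of f over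
   [k+1, k+2]; it is bounded through the derivative of f. *)
Definition em (f A : R -> R[i]) k : R[i] :=
  f k.+2%:R - (A k.+2%:R - A k.+1%:R).

Lemma em_bound (f A d : R -> R[i]) k (M : R) :
  (forall x, k.+1%:R <= x -> cder A x (f x)) ->
  (forall x, k.+1%:R <= x -> cder f x (d x)) ->
  (forall x, k.+1%:R <= x -> normc (d x) <= M) ->
  normc (em f A k) <= 4 * M.
Proof.
move=> Af fd dM; set a : R := k.+1%:R; set b : R := k.+2%:R.
have ba1 : b - a = 1 by rewrite /b /a -[k.+2]addn1 natrD addrC addKr.
have ab : a <= b by rewrite -subr_ge0 ba1.
have := @complex_mvt _ (fun x => A x - x%:C * f b) (fun x => f x - f b)
  a b (2 * M) ab.
rewrite ba1 mulr1 (_ : 2 * (2 * M) = 4 * M); last by ring.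
have hb : b%:C = 1 + a%:C :> R[i] by rewrite -[1]/(1%:C) -rcD -ba1 subrK.
have -> : A b - b%:C * f b - (A a - a%:C * f b) = - em f A k.
  by rewrite hb /em -/a -/b; ring.
rewrite normc_opp.
apply.
- move=> x /andP[ax _]; apply: cder_eq.
    apply: cderD; first exact: Af.
    apply: cderN; apply: cderM; last exact: cder_cst.
    by apply: cder_real; exact: is_derive_id.
  by rewrite mulr0 addr0 mul1r.
- move=> x /andP[ax xb]; rewrite -normc_opp opprB.
  have M0 : 0 <= M by exact: le_trans (normc_ge0 _) (dM _ ax).
  apply: le_trans (@complex_mvt _ f d x b M xb _ _) _.
  + by move=> y /andP[xy _]; apply: fd; apply: le_trans xy.
  + by move=> y /andP[xy _]; apply: dM; apply: le_trans xy.
  by rewrite ler_piMr ?mulr_ge0// -ba1 lerD2l lerN2.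
Qed.

Lemma normc_cpow x z : normc (cpow x z) = expR (Re z * ln x).
Proof. by rewrite normc_expC cReM/= mulr0 subr0. Qed.

Lemma cpow1 z : cpow 1 z = 1 :> R[i].
Proof. by rewrite /cpow ln1 mulr0 expC0. Qed.

Lemma cpow_1B x s : 0 < x -> cpow x (1 - s) = x%:C * cpow x (- s).
Proof.
move=> x0; rewrite /cpow mulrBl mul1r expCD mulNr; congr (_ * _).
by apply: complex_ext; rewrite /expC /= lnK ?posrE// cos0 sin0; ring.
Qed.

Lemma cder_cpow x z : 0 < x ->
  cder (fun y => cpow y z) x (z * (x^-1)%:C * cpow x z).
Proof.
move=> x0; apply: cder_expC; apply: cder_eq.
  by apply: cderM; [exact: cder_cst|apply: cder_real; exact: is_derive1_ln].
by rewrite mul0r add0r.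
Qed.

(* x^(-s) and its derivative in s, with their primitives in x. *)
Definition pw s x := cpow x (- s).
Definition pA s x := cpow x (1 - s) / (1 - s).
Definition pl s x := - ((ln x)%:C * cpow x (- s)).
Definition pB s x :=
  - ((ln x)%:C * cpow x (1 - s) / (1 - s) - cpow x (1 - s) / (1 - s) ^+ 2).

Lemma rcV x : 0 < x -> (x^-1)%:C * x%:C = 1 :> R[i].
Proof. by move=> x0; rewrite -rcM mulVf ?gt_eqF. Qed.

Lemma rc_neq0 x : 0 < x -> x%:C != 0 :> R[i].
Proof. by move=> x0; rewrite eq_complex /= eqxx andbT gt_eqF. Qed.

Lemma cder_pA s x : 1 - s != 0 -> 0 < x -> cder (pA s) x (pw s x).
Proof.
move=> s1 x0; apply: cder_eq.
  by apply: cderM; [exact: cder_cpow|exact: cder_cst].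
rewrite mulr0 addr0 cpow_1B// /pw.
transitivity ((x^-1)%:C * x%:C * cpow x (- s)); last by rewrite rcV// mul1r.
by field; rewrite s1 andbT; exact: rc_neq0.
Qed.

Lemma cder_pw s x : 0 < x ->
  cder (pw s) x (- s * (x^-1)%:C * cpow x (- s)).
Proof. by move=> x0; exact: cder_cpow. Qed.

Lemma cder_pl s x : 0 < x -> cder (pl s) x
  ((x^-1)%:C * cpow x (- s) * (s * (ln x)%:C - 1)).
Proof.
move=> x0; apply: cder_eq.
  apply: cderN; apply: cderM; last exact: cder_cpow.
  by apply: cder_real; exact: is_derive1_ln.
by cbv beta; move: (x^-1)%:C (ln x)%:C (cpow x (- s)) => u v w; ring.
Qed.

Lemma cder_pB s x : 1 - s != 0 -> 0 < x -> cder (pB s) x (pl s x).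
Proof.
move=> s1 x0; apply: cder_eq.
  apply: cderN; apply: cderD.
    apply: cderM; last exact: cder_cst.
    apply: cderM; last exact: cder_cpow.
    by apply: cder_real; exact: is_derive1_ln.
  apply: cderN; apply: cderM; last exact: cder_cst.
  exact: cder_cpow.
rewrite !mulr0 !addr0 cpow_1B// /pl.
transitivity (- ((ln x)%:C * ((x^-1)%:C * x%:C * cpow x (- s)))).
  by field; rewrite s1 andbT; exact: rc_neq0.
by rewrite rcV// mul1r.
Qed.

Lemma le_expR x : x <= expR x.
Proof. by apply: le_trans (expR_ge1Dx x); rewrite lerDr. Qed.

Lemma le_expRM (a x : R) : 0 < a -> x <= a^-1 * expR (a * x).
Proof. by move=> a0; rewrite mulrC ler_pdivlMr// mulrC le_expR. Qed.

Lemma ln_ge0n x k : k.+1%:R <= x -> 0 <= ln x.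
Proof. by move=> kx; apply: ln_ge0; apply: le_trans kx; rewrite ler1n. Qed.

Lemma gt0n x k : k.+1%:R <= x -> 0 < x.
Proof. by apply: lt_le_trans; rewrite ltr0n. Qed.

Lemma VexpR x : 0 < x -> x^-1 = expR (- ln x).
Proof. by move=> x0; rewrite expRN lnK. Qed.

Definition wt (t : R) k := expR (- (1 + t) * ln k.+1%:R).

Lemma wt_ge (t x : R) k : 0 <= t -> k.+1%:R <= x ->
  expR (- (1 + t) * ln x) <= wt t k.
Proof.
move=> t0 kx; rewrite /wt ler_expR !mulNr lerN2 ler_wpM2l ?addr_ge0//.
by rewrite ler_ln ?posrE ?ltr0n// (gt0n kx).
Qed.

Lemma em_pw s k : 1 - s != 0 -> 0 < Re s ->
  normc (em (pw s) (pA s) k) <= 4 * normc s * wt (Re s / 2) k.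
Proof.
move=> s1 s0; rewrite -mulrA.
apply: em_bound => [x kx|x kx|x kx]; have x0 := gt0n kx.
- exact: cder_pA.
- exact: cder_pw.
rewrite normc_mul normc_cpow normc_mul normc_opp normcr ger0_norm ?invr_ge0 ?(ltW x0)//.
rewrite -mulrA ler_wpM2l ?normc_ge0//.
apply: le_trans (@wt_ge (Re s / 2) x k _ kx); last by rewrite divr_ge0// ltW.
rewrite VexpR// -expRD ler_expR cReN.
have := mulr_ge0 (ltW s0) (ln_ge0n kx); lra.
Qed.

Lemma em_pl s k : 1 - s != 0 -> 0 < Re s ->
  normc (em (pl s) (pB s) k)
    <= 4 * ((normc s / (Re s / 8) + 1) * wt (Re s / 2) k).
Proof.
move=> s1 s0; have [d dE] : {d | d = Re s / 8} by exists (Re s / 8).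
rewrite -dE; have d0 : 0 < d by rewrite dE divr_gt0.
apply: em_bound => [x kx|x kx|x kx]; have x0 := gt0n kx.
- exact: cder_pB.
- exact: cder_pl.
have L0 := ln_ge0n kx.
apply: (@le_trans _ _ ((normc s / d + 1) * expR (- (1 + Re s / 2) * ln x)));
  last first.
  apply: ler_wpM2l; first by rewrite addr_ge0 ?divr_ge0 ?normc_ge0 ?(ltW d0).
  by apply: wt_ge => //; rewrite divr_ge0// ltW.
rewrite 2!normc_mul normc_cpow normcr ger0_norm ?invr_ge0 ?(ltW x0)//.
rewrite VexpR// -expRD.
have H : normc (s * (ln x)%:C - 1) <= (normc s / d + 1) * expR (d * ln x).
  apply: le_trans (normc_add _ _) _.
  rewrite normc_opp ComplexField.Normc.normc1 mulrDl mul1r lerD//.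
    rewrite normc_mul normcr ger0_norm// -mulrA ler_wpM2l ?normc_ge0//.
    exact: le_expRM.
  by rewrite -expR0 ler_expR mulr_ge0 ?(ltW d0).
apply: le_trans (ler_wpM2l (expR_ge0 _) H) _.
rewrite mulrCA -expRD ler_wpM2l ?addr_ge0 ?divr_ge0 ?normc_ge0 ?(ltW d0)//.
rewrite ler_expR cReN dE; have := mulr_ge0 (ltW s0) L0; lra.
Qed.

Definition em_diff s h k := em (pw (s + h)) (pA (s + h)) k - em (pw s) (pA s) k
    - h * em (pl s) (pB s) k.

Lemma em_pd s h k : 1 - s != 0 -> 1 - (s + h) != 0 -> 0 < Re s ->
  normc h <= Re s / 8 ->
  normc (em_diff s h k)
  <= 4 * ((4 * normc s / (Re s / 8) ^+ 2 + 2 / (Re s / 8)) * normc h ^+ 2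
      * wt (Re s / 2) k).
Proof.
move=> s1 sh1 s0; have [d dE] : {d | d = Re s / 8} by exists (Re s / 8).
rewrite -dE; have d0 : 0 < d by rewrite dE divr_gt0.
move=> hd.
have [K KE] : {K | K = 4 * normc s / d ^+ 2 + 2 / d} by eexists.
rewrite -KE.
have K0 : 0 <= K.
  by rewrite KE addr_ge0 ?divr_ge0 ?mulr_ge0 ?normc_ge0 ?exprn_ge0 ?(ltW d0).
rewrite /em_diff (_ : _ - _ = em (fun x => pw (s + h) x - pw s x - h * pl s x)
   (fun x => pA (s + h) x - pA s x - h * pB s x) k); last by rewrite /em; ring.
apply: (@em_bound _ _ (fun x => (x^-1)%:C * cpow x (- s) *
   (- s * (expC (- h * (ln x)%:C) - 1 - (- h * (ln x)%:C))
    - h * (expC (- h * (ln x)%:C) - 1)))) => [x kx|x kx|x kx];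
  have x0 := gt0n kx.
- apply: cderD; first apply: cderD; [exact: cder_pA|..].
    by apply: cderN; exact: cder_pA.
  apply: cderN; apply: cder_eq.
    by apply: cderM; [exact: cder_cst|exact: cder_pB].
  by rewrite mul0r add0r.
- apply: cder_eq.
    apply: cderD; first apply: cderD; [exact: cder_pw|..].
      by apply: cderN; exact: cder_pw.
    by apply: cderN; apply: cderM; [exact: cder_cst|exact: cder_pl].
  rewrite (_ : cpow x (- (s + h)) = cpow x (- s) * expC (- h * (ln x)%:C)).
    by ring.
  by rewrite /cpow -expCD -mulrDl opprD.
have L0 := ln_ge0n kx.
apply: (@le_trans _ _ (K * normc h ^+ 2 * expR (- (1 + Re s / 2) * ln x)));
  last first.
  apply: ler_wpM2l; first by rewrite mulr_ge0 ?exprn_ge0 ?normc_ge0.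
  by apply: wt_ge => //; rewrite divr_ge0// ltW.
rewrite 2!normc_mul normc_cpow normcr ger0_norm ?invr_ge0 ?(ltW x0)//.
rewrite VexpR// -expRD.
have [E EE] : {E | E = expR (d * ln x)} by eexists.
have E0 : 0 <= E by rewrite EE expR_ge0.
have LE : ln x <= d^-1 * E by rewrite EE; exact: le_expRM.
have nh : normc (- h * (ln x)%:C) = normc h * ln x.
  by rewrite normc_mul normc_opp normcr ger0_norm.
have eh : expR (normc h * ln x) <= E by rewrite EE ler_expR ler_wpM2r.
have E1 : 1 <= E by rewrite EE -expR0 ler_expR mulr_ge0// ltW.
have dV0 : 0 <= d^-1 by rewrite invr_ge0 ltW.
have H : normc (- s * (expC (- h * (ln x)%:C) - 1 - (- h * (ln x)%:C))
    - h * (expC (- h * (ln x)%:C) - 1)) <= K * normc h ^+ 2 * E ^+ 3.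
  apply: le_trans (normc_add _ _) _.
  rewrite normc_opp 2!normc_mul normc_opp.
  rewrite (_ : K * _ * _ = normc s * (4 * (normc h * (d^-1 * E)) ^+ 2 * E)
     + normc h * (2 * (normc h * (d^-1 * E)) * E ^+ 1 * E)); last first.
    by rewrite KE expr1; field; rewrite gt_eqF.
  apply: lerD; rewrite ler_wpM2l ?normc_ge0//.
    apply: le_trans (expC_sub2 _) _; rewrite nh.
    rewrite ler_pM ?expR_ge0 ?mulr_ge0 ?exprn_ge0 ?normc_ge0//.
    by rewrite ler_wpM2l// lerXn2r ?nnegrE ?mulr_ge0 ?normc_ge0// ler_wpM2l ?normc_ge0.
  apply: le_trans (expC_sub1 _) _; rewrite nh.
  rewrite ler_pM ?expR_ge0 ?mulr_ge0 ?normc_ge0// expr1.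
  apply: (@le_trans _ _ (2 * (normc h * (d^-1 * E)))).
    by rewrite ler_wpM2l// ler_wpM2l ?normc_ge0.
  by rewrite ler_peMr// !mulr_ge0 ?normc_ge0.
apply: le_trans (ler_wpM2l (expR_ge0 _) H) _.
rewrite mulrCA EE -expRM_natl -expRD ler_wpM2l ?mulr_ge0 ?exprn_ge0 ?normc_ge0//.
rewrite ler_expR cReN dE; have := mulr_ge0 (ltW s0) L0; lra.
Qed.

Lemma wt_telescope (t : R) k : 0 < t ->
  wt t k.+1 <= t^-1 * (expR (- t * ln k.+1%:R) - expR (- t * ln k.+2%:R)).
Proof.
move=> t0; rewrite mulrC ler_pdivlMr//.
have fd x : k.+1%:R <= x -> is_derive x 1 (fun y => - expR (- t * ln y))
    (t * expR (- (1 + t) * ln x)).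
  move=> kx; have x0 := gt0n kx.
  have l : is_derive x 1 (fun y : R => - t * ln y) (- t * x^-1).
    by have l := is_derive1_ln x0; exact: is_deriveZ.
  have e : is_derive x 1 (fun y : R => expR (- t * ln y))
      (expR (- t * ln x) * (- t * x^-1)).
    by apply: (@is_derive1_comp _ expR (fun y : R => - t * ln y)).
  have -> : t * expR (- (1 + t) * ln x) = - (expR (- t * ln x) * (- t * x^-1)).
    rewrite VexpR// (_ : - (1 + t) * ln x = - t * ln x + - ln x); last by ring.
    by rewrite expRD; ring.
  exact: is_deriveN.
have [|||c] := @MVT_segment R (fun y => - expR (- t * ln y))
    (fun x => t * expR (- (1 + t) * ln x)) k.+1%:R k.+2%:R.
- by rewrite ler_nat.
- by move=> x; rewrite in_itv/= => /andP[/ltW kx _]; exact: fd.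
- apply: derivable_within_continuous => x; rewrite in_itv/= => /andP[kx _].
  by have [] := fd x kx.
rewrite in_itv/= => /andP[kc ck].
rewrite opprK addrC => ->.
rewrite -[k.+2]addn1 natrD (addrC _ 1) addrK mulr1 mulrC ler_wpM2l ?(ltW t0)//.
rewrite /wt ler_expR !mulNr lerN2 ler_wpM2l ?addr_ge0 ?(ltW t0)//.
by rewrite ler_ln ?posrE ?ltr0n ?(gt0n kc)//.
Qed.

Lemma wt_cvg (t : R) : 0 < t -> cvgn (series (wt t)).
Proof.
move=> t0; have w0 k : 0 <= wt t k by exact: expR_ge0.
apply: nondecreasing_is_cvgn.
  by apply/nondecreasing_seqP => n; rewrite seriesSr lerDl.
exists (1 + t^-1) => _ [n _ <-].
have t1 : 0 <= t^-1 by rewrite invr_ge0 ltW.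
case: n => [|n]; first by rewrite seriesEnat/= big_geq// addr_ge0.
suff : series (wt t) n.+1 <= 1 + t^-1 * (1 - expR (- t * ln n.+1%:R)).
  move=> /le_trans; apply; rewrite lerD2l ler_piMr// lerBlDr lerDl expR_ge0.
elim: n => [|n IH].
  by rewrite seriesEnat/= big_nat1 /wt ln1 !mulr0 expR0 subrr mulr0 addr0.
rewrite seriesSr; apply: le_trans (lerD IH (wt_telescope n t0)) _.
by rewrite -addrA lerD2l -mulrDr addrA subrK.
Qed.
End Remainder.

Section ZetaTheory.
Variable R : realType.
Implicit Types (s z w h : R[i]) (x y : R) (n N k : nat).
Local Notation Re := complex.Re.
Local Notation Im := complex.Im.
Local Notation normc := ComplexField.Normc.normc.
Local Notation C := (R[i]^o).

Lemma cvgC_normP (T : Type) (F : set_system T) (FF : Filter F)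
    (u : T -> C) (l : C) :
  u @ F --> l <->
  forall e : R, 0 < e -> \forall t \near F, normc (l - u t) < e.
Proof.
split.
  move=> /cvgrPdist_lt H e e0; have e0' : (0 : R[i]) < e%:C by rewrite ltcR.
  move: (H _ e0'); apply: filterS => t; rewrite norm_normc ltcR; exact.
move=> H; apply/cvgrPdist_lt => -[e e']; rewrite ltcE/= => /andP[/eqP -> e0].
by move: (H _ e0); apply: filterS => t lt; rewrite norm_normc ltcE/= eqxx.
Qed.

Lemma cvgC_ReIm (u : nat -> C) (l : C) :
  (fun n => Re (u n)) @ \oo --> Re l -> (fun n => Im (u n)) @ \oo --> Im l ->
  u @ \oo --> l.
Proof.
move=> /cvgrPdist_lt ur /cvgrPdist_lt ui; apply/cvgC_normP => e e0.
near=> n; apply: le_lt_trans (normc_le _) _.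
rewrite [ltRHS]splitr ltrD// ?(cReD, cImD, cReN, cImN).
  by near: n; apply: ur; rewrite divr_gt0.
by near: n; apply: ui; rewrite divr_gt0.
Unshelve. all: by end_near. Qed.

Lemma cvgC_series (u : nat -> C) (v : nat -> R) :
  (forall k, normc (u k) <= v k) -> cvgn (series v) -> cvgn (series u).
Proof.
move=> uv cv.
have cr (f : R[i] -> R) : (forall z, `|f z| <= normc z) ->
    cvgn (series (fun k => f (u k))).
  move=> fz; apply: normed_cvg; apply: series_le_cvg cv => //.
  - by move=> n; exact: normr_ge0.
  - by move=> n; exact: le_trans (normc_ge0 _) (uv n).
  - by move=> n; exact: le_trans (fz _) (uv n).
have [a ra] := (cvg_ex _).1 (cr (fun z => Re z) (@Re_le_normc _)).
have [b ib] := (cvg_ex _).1 (cr (fun z => Im z) (@Im_le_normc _)).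
apply/cvg_ex; exists (a +i* b); apply: cvgC_ReIm => /=.
  apply: cvg_trans ra; apply: near_eq_cvg; near=> n.
  by rewrite !seriesEnat/=; elim/big_ind2 : _ => // ? ? ? ?; rewrite cReD => -> ->.
apply: cvg_trans ib; apply: near_eq_cvg; near=> n.
by rewrite !seriesEnat/=; elim/big_ind2 : _ => // ? ? ? ?; rewrite cImD => -> ->.
Unshelve. all: by end_near. Qed.

Lemma normc_lim_le (u : nat -> C) (l : C) (B : R) :
  u @ \oo --> l -> (forall n, normc (u n) <= B) -> normc l <= B.
Proof.
move=> /cvgC_normP ul uB; apply/ler_addgt0Pl => e e0.
have [n lun] := @filter_ex _ \oo _ _ (ul _ e0).
rewrite -(subrK (u n : R[i]) l); apply: le_trans (normc_add _ _) _.
by rewrite lerD// ltW.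
Qed.

Definition emz s : nat -> C := em (pw s) (pA s).
Definition eml s : nat -> C := em (pl s) (pB s).

Lemma wt_cvgM (a t : R) : 0 < t -> cvgn (series (fun k => a * wt t k)).
Proof. by move=> t0; exact: is_cvg_seriesZ (wt_cvg t0). Qed.

Lemma subr1_neq0 s : s != 1 -> 1 - s != 0.
Proof. by rewrite subr_eq0 eq_sym. Qed.

Lemma emz_cvg s : 0 < Re s -> s != 1 -> cvgn (series (emz s)).
Proof.
move=> s0 s1; have s2 : 0 < Re s / 2 by rewrite divr_gt0.
apply: (@cvgC_series _ (fun k => 4 * normc s * wt (Re s / 2) k)) => [k|].
  exact: (em_pw k (subr1_neq0 s1) s0).
exact: wt_cvgM.
Qed.

Lemma eml_cvg s : 0 < Re s -> s != 1 -> cvgn (series (eml s)).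
Proof.
move=> s0 s1; have s2 : 0 < Re s / 2 by rewrite divr_gt0.
apply: (@cvgC_series _ (fun k =>
  4 * (normc s / (Re s / 8) + 1) * wt (Re s / 2) k)) => [k|].
  by rewrite -mulrA; exact: (em_pl k (subr1_neq0 s1) s0).
exact: wt_cvgM.
Qed.

Lemma zeta_approxS s N :
  zeta_approx s N.+1 = (1 - (1 - s)^-1) + series (emz s) N.
Proof.
rewrite /zeta_approx; elim: N => [|N IH].
  by rewrite seriesEnat/= big_nat1 big_geq// !cpow1 mul1r addr0.
rewrite seriesSr big_nat_recr//= addrA -IH /emz /em /pw /pA.
by ring.
Qed.

Lemma zeta_series s : 0 < Re s -> s != 1 ->
  (zeta_approx s : nat -> C) @ \oo -->
    ((1 - (1 - s)^-1 + limn (series (emz s))) : C).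
Proof.
move=> s0 s1; rewrite -cvg_shiftS/=.
under eq_cvg do rewrite zeta_approxS.
by apply: cvgD; [exact: cvg_cst|exact: emz_cvg].
Qed.

Lemma zetaE s : 0 < Re s -> s != 1 ->
  zeta s = 1 - (1 - s)^-1 + limn (series (emz s)).
Proof.
move=> s0 s1; apply: (@cvg_lim C); first exact: norm_hausdorff.
exact: zeta_series.
Qed.

Lemma zeta_cvg s : 0 < Re s -> s != 1 ->
  (zeta_approx s : nat -> C) @ \oo --> (zeta s : C).
Proof. by move=> s0 s1; rewrite zetaE//; exact: zeta_series. Qed.

Lemma zeta_dirichlet s : 1 < Re s ->
  ((fun N => \sum_(1 <= n < N.+1) cpow n%:R (- s)) : nat -> C) @ \oo
    --> (zeta s : C).
Proof.
move=> s1.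
have sn1 : s != 1 by apply: contraTneq s1 => ->; rewrite ltxx.
have s0 : 0 < Re s by exact: lt_trans s1.
rewrite (_ : (fun N => _) = (zeta_approx s : nat -> C) \+
    ((fun N => cpow N%:R (1 - s) / (1 - s)) : nat -> C)); last first.
  by apply/funext => N /=; rewrite /zeta_approx subrK.
rewrite -[zeta s : C]addr0; apply: cvgD; first exact: zeta_cvg.
rewrite -[X in _ --> X](mul0r ((1 - s)^-1)); apply: cvgMl.
rewrite -cvg_shiftS/=; apply/cvgC_normP => e e0.
have t0 : 0 < Re s - 1 by rewrite subr_gt0.
near=> n; rewrite sub0r normc_opp normc_cpow -[ltRHS]lnK ?posrE// ltr_expR.
rewrite cReD cReN /= -opprB mulNr ltrNl mulrC -ltr_pdivrMr//.
rewrite -[ltLHS]expRK ltr_ln ?posrE ?expR_gt0 ?ltr0n//.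
apply: (@le_lt_trans _ _ n%:R); last by rewrite ltr_nat.
by near: n; exact: nbhs_infty_ger.
Unshelve. all: by end_near. Qed.
End ZetaTheory.

Section ZetaHolomorphic.
Variable R : realType.
Implicit Types (s z w h : R[i]) (x y : R) (n N k : nat).
Local Notation Re := complex.Re.
Local Notation Im := complex.Im.
Local Notation normc := ComplexField.Normc.normc.
Local Notation C := (R[i]^o).

Lemma series_emz_quadratic s : 0 < Re s -> s != 1 ->
  exists K : R, 0 <= K /\ forall h, normc h <= Re s / 8 -> s + h != 1 ->
  normc (limn (series (emz (s + h))) - limn (series (emz s))
         - h * limn (series (eml s))) <= K * normc h ^+ 2.
Proof.
move=> s0 s1; have s2 : 0 < Re s / 2 by rewrite divr_gt0.
pose c : R := 4 * (4 * normc s / (Re s / 8) ^+ 2 + 2 / (Re s / 8)).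
have c0 : 0 <= c.
  have d0 : 0 <= Re s / 8 by rewrite divr_ge0// ltW.
  apply: mulr_ge0 => //; apply: addr_ge0; apply: divr_ge0 => //.
    by apply: mulr_ge0 => //; exact: normc_ge0.
  exact: exprn_ge0.
have w0 k : 0 <= wt (Re s / 2) k by exact: expR_ge0.
have wl n : series (wt (Re s / 2)) n <= limn (series (wt (Re s / 2))).
  apply: nondecreasing_cvgn_le; last exact: wt_cvg.
  by apply/nondecreasing_seqP => m; rewrite seriesSr lerDl.
exists (c * limn (series (wt (Re s / 2)))); split.
  apply: mulr_ge0 => //; apply: le_trans (wl 0%N).
  by rewrite seriesEnat/= big_geq.
move=> h hs sh1.
have sh0 : 0 < Re (s + h).
  rewrite cReD; have := le_trans (Re_le_normc h) hs; rewrite ler_norml.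
  by move=> /andP[+ _]; move: s0; lra.
have cv : (fun n => series (emz (s + h)) n - series (emz s) n
      - (h : C) * series (eml s) n) @ \oo -->
    (limn (series (emz (s + h))) - limn (series (emz s))
      - (h : C) * limn (series (eml s))).
  apply: cvgB; first by apply: cvgB; exact: emz_cvg.
  by apply: cvgMr; exact: eml_cvg.
apply: (normc_lim_le cv) => n.
apply: (@le_trans _ _ (\sum_(0 <= k < n) normc (em_diff s h k))).
  rewrite (_ : _ - _ = \sum_(0 <= k < n) em_diff s h k); first exact: normc_sum.
  by rewrite !seriesEnat/= mulr_sumr -!sumrB.
apply: (@le_trans _ _ (c * normc h ^+ 2 * series (wt (Re s / 2)) n)).
  rewrite seriesEnat/= mulr_sumr; apply: ler_sum => k _.
  have := em_pd k (subr1_neq0 s1) (subr1_neq0 sh1) s0 hs.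
  by rewrite /c -!mulrA.
rewrite mulrAC; apply: ler_wpM2r; first exact: exprn_ge0 (normc_ge0 _).
exact: ler_wpM2l.
Qed.

Lemma near0_normc (e : R) : 0 < e -> \forall h \near (0 : C)^', normc h < e.
Proof.
move=> e0; have e0' : (0 : R[i]) < e%:C by rewrite ltcR.
by move: (@dnbhs0_lt _ C _ e0'); apply: filterS => h; rewrite norm_normc ltcR.
Qed.

Lemma series_emz_derivable s : 0 < Re s -> s != 1 ->
  derivable ((fun z => limn (series (emz z))) : C -> C) s 1.
Proof.
move=> s0 s1; have [K [K0 HK]] := series_emz_quadratic s0 s1.
apply: cvgP (limn (series (eml s)) : C) _.
apply/cvgC_normP => e e0.
have K1 : 0 < K + 1 by rewrite ltr_wpDl.
have s10 : 0 < normc (1 - s).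
  rewrite lt_neqAle normc_ge0 andbT eq_sym.
  by apply: contra (subr1_neq0 s1) => /eqP/ComplexField.Normc.eq0_normc ->.
near=> h.
have h0 : h != 0 by near: h; exact: nbhs_dnbhs_neq.
have hs : normc h <= Re s / 8.
  by apply: ltW; near: h; apply: near0_normc; rewrite divr_gt0.
have he : normc h < e / (K + 1).
  by near: h; apply: near0_normc; rewrite divr_gt0.
have nh0 : 0 < normc h.
  rewrite lt_neqAle normc_ge0 andbT eq_sym; apply: contra h0 => /eqP/ComplexField.Normc.eq0_normc ->.
  by [].
have sh1 : s + h != 1.
  have : normc h < normc (1 - s) by near: h; exact: near0_normc.
  apply: contraTneq => <-.
  by rewrite (addrC s) addrK ltxx.
have := HK h hs sh1.
set S1 := limn (series (emz (s + h))); set S0 := limn (series (emz s)).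
set D := limn (series (eml s)) => HK1.
have -> : D - h^-1 *: (limn (series (emz (h *: (1 : C) + s))) - S0)
    = - (h^-1 * (S1 - S0 - h * D)) :> R[i].
  have -> : h *: (1 : C) + s = s + h :> R[i].
    by rewrite addrC /GRing.scale /= mulr1.
  rewrite -/S1 /GRing.scale/= !mulrBr mulKf//.
  by rewrite !opprB.
rewrite normc_opp normc_mul ComplexField.Normc.normcV mulrC ltr_pdivrMr//.
apply: le_lt_trans HK1 _; rewrite expr2 mulrA ltr_pM2r//.
apply: (@le_lt_trans _ _ ((K + 1) * normc h)).
  by rewrite ler_wpM2r ?normc_ge0// lerDl.
by rewrite mulrC -ltr_pdivlMr.
Unshelve. all: by end_near. Qed.

Lemma zeta_holomorphic s : 0 < Re s -> s != 1 ->
  derivable (@zeta R : C -> C) s 1.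
Proof.
move=> s0 s1.
apply: (@near_eq_derivable _ C C
   (fun z : C => 1 - (1 - z)^-1 + limn (series (emz z)))).
  have r0 : 0 < Num.min (Re s) (normc (1 - s)).
    rewrite lt_min s0/= lt_neqAle normc_ge0 andbT eq_sym.
    by apply: contra (subr1_neq0 s1) => /eqP/ComplexField.Normc.eq0_normc ->.
  have : \forall z \near (s : C), normc (s - z) < Num.min (Re s) (normc (1 - s)).
    exact: (@cvgC_normP R C (nbhs (s : C)) _ id s).1 (@cvg_id _ _) _ r0.
  apply: filterS => z; rewrite lt_min => /andP[zs z1].
  rewrite zetaE//.
    have := le_lt_trans (Re_le_normc _) zs; rewrite cReD cReN ltr_norml.
    by move=> /andP[_]; rewrite ltrBlDr ltrDl.
  by apply: contraTneq z1 => ->; rewrite -normc_opp opprB ltxx.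
apply: derivableD; last exact: series_emz_derivable.
apply: derivableB; first exact: derivable_cst.
apply: derivableV; first exact: subr1_neq0.
by apply: derivableB; [exact: derivable_cst|exact: derivable_id].
Qed.
End ZetaHolomorphic.

End ZetaFacts.

(* Main.v *)
(* Both parts test zeta(1/2+it) against a smooth window on [T,2T] and a
   nonnegative resonator.  Up to O(1), zeta is the Dirichlet polynomial
   sum_(n <= M) n^(-1/2-it) with M about 128T; the window sin(pi t/T)^(2J) has
   rapidly decaying Fourier coefficients, so only diagonal terms matter as long
   as the resonator has length a bit below T.  For the first part the resonator
   is |sum_n f(n) n^(-it)|^2 over squarefree products of primes in
   (L^2, exp((ln L)^2)] with f(p) = L/(sqrt p ln p); Rankin's trick controls the
   truncation, and the ratio of the twisted to the plain second moment is an
   Euler product.  For the second part it is (Re P)^(2k) with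
   P = sum_(y < p <= z) p^(-1/2-it): zeta can supply 2j extra primes to the
   diagonal, which multiplies the moment by about e^(2j) when
   4j^2 <= (k-j) sum 1/p.  Taking 2j slightly larger than V makes the weighted
   mean of zeta exceed e^V; a two-step Young inequality against the second
   moment of zeta and the moment of |P|^(8k) turns this into a lower bound for
   the measure, of size T (ln T)^(-2) (2k+1)^(-4) 256^(-k), and
   k ~ 4j^2/((2/3) ln u) + j with u = ln T/(8 V^2 ln V) gives the exponent. *)
Require Import Defs.
From mathcomp Require Import all_boot all_order all_algebra.
From mathcomp Require Import perm complex ring lra zify.
From mathcomp Require Import all_classical all_reals all_analysis measurable_realfun.
Set Implicit Arguments.
Unset Strict Implicit.
Unset Printing Implicit Defensive.
Import Order.TTheory GRing.Theory Num.Theory.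
Import numFieldNormedType.Exports.
Local Open Scope classical_set_scope.
Local Open Scope ring_scope.
Local Open Scope complex_scope.

Import ZetaFacts.
Local Notation Re := complex.Re.
Local Notation Im := complex.Im.
Local Notation normc := ComplexField.Normc.normc.

(** * Zeta as a Dirichlet polynomial *)

Section ZetaApprox.
Variable R : realType.
Implicit Types (s z w : R[i]) (x y t T : R) (n M N k K : nat).

(** Uniformity in [V], from bounded values to the end of the range, shapes the second part. Write L
    = ln T and x = ln u. The factor 1/5 gives u >= 25/4, hence x >= 7/4, and the numerical estimates
    are nearly tight there. Since L = 8 V^2 (ln V) u is large, x or V is large: a large x leaves
    room for any constant, while for bounded x the constants have to be right and the lower-order
    terms vanish against V. The prime polynomial starts at y of order V^3, because repeated primes
    cost exp(O(k^2/y)) with k = O(V^2). It stops at T^(22/(100k)), so that products of 4k primes,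
    needed for the moment of order 8k, stay below T^(22/25). Two of the four lost powers of ln T
    come from the square of the second moment of zeta; the other two pay for the term of k that is
    linear in V. The length of the zeta polynomial does not compete with that of the resonator: in a
    diagonal equation l a = b the integer b is bounded by the resonator, and frequencies are
    separated on that scale whatever l is. *)

Lemma expR_le2 x : x <= 2^-1 -> expR x <= 2.
Proof.
move=> x2; rewrite -[x]opprK expRN -[leRHS]invrK lef_pV2 ?posrE ?expR_gt0 ?invr_gt0//.
apply: le_trans (expR_ge1Dx _); lra.
Qed.

Lemma sqrt_expR x : 0 < x -> Num.sqrt x = expR (2^-1 * ln x).
Proof.
move=> x0; apply: (@pexpIrn _ 2) => //; rewrite ?nnegrE ?sqrtr_ge0 ?expR_ge0//.
rewrite sqr_sqrtr ?(ltW x0)// -expRM_natr mulrAC mulVf// mul1r lnK//.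
Qed.

Lemma eq_ler x y : x = y -> x <= y.
Proof. by move=> ->. Qed.

Lemma ln_succ_ge n : (0 < n)%N -> n.+1%:R^-1 <= ln n.+1%:R - ln n%:R :> R.
Proof.
move=> n0; have n0' : (0 : R) < n%:R by rewrite ltr0n.
rewrite -[leRHS]opprB lerNr -ln_div ?posrE ?ltr0n//.
rewrite (_ : n%:R / n.+1%:R = 1 + - n.+1%:R^-1 :> R).
  apply: le_ln1Dx; rewrite ltrN2 invf_lt1 ?ltr0n// ltr1n//.
rewrite -natr1; field; rewrite natr1 pnatr_eq0//.
Qed.

Lemma ln_succ_le n : (0 < n)%N -> ln n.+1%:R - ln n%:R <= n%:R^-1 :> R.
Proof.
move=> n0; have n0' : (0 : R) < n%:R by rewrite ltr0n.
rewrite -ln_div ?posrE ?ltr0n//.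
rewrite (_ : n.+1%:R / n%:R = 1 + n%:R^-1 :> R).
  by apply: le_ln1Dx; rewrite (lt_trans (ltrN10 _))// invr_gt0.
by rewrite -natr1; field; rewrite gt_eqF.
Qed.

Let lam n : R := ln n.+1%:R - ln n%:R.

(** The second difference of ln is minus the logarithm of (n+1)^2/(n(n+2)) = 1 + 1/(n(n+2)). It
    controls how slowly [q], hence [c], varies. *)
Lemma lam_diff n : (0 < n)%N ->
  0 <= lam n - lam n.+1 <= (n%:R * n.+2%:R)^-1.
Proof.
move=> n0; have n0' : (0 : R) < n%:R by rewrite ltr0n.
have -> : lam n - lam n.+1 = ln (1 + (n%:R * n.+2%:R)^-1).
  rewrite (_ : 1 + _ = (n.+1%:R * n.+1%:R) / (n%:R * n.+2%:R)).
    rewrite ln_div ?posrE ?mulr_gt0 ?ltr0n// !lnM ?posrE ?ltr0n// /lam; ring.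
  have -> : n.+2%:R = n%:R + 2 :> R by rewrite -addn2 natrD.
  rewrite -natr1; field; rewrite gt_eqF//=; apply/negP => /eqP; lra.
have p0 : 0 <= (n%:R * n.+2%:R)^-1 :> R by rewrite invr_ge0 mulr_ge0.
rewrite ln_ge0 ?lerDl//=; apply: le_ln1Dx; exact: lt_le_trans (ltrN10 _) p0.
Qed.

Section Critical.
Variable t : R.
Hypothesis t1 : 1 <= t.
Let s : R[i] := 2^-1 +i* t.
Let a n := cpow n%:R (- s).
Let q n := expC (- s * (lam n)%:C).
(* a n = c n * (a n - a n.+1), with c slowly varying: summation by parts then
   bounds the tail of the Dirichlet polynomial without any exponential sums. *)
Let c n := (1 - q n)^-1.

Let t0 : 0 < t. Proof. exact: lt_le_trans ltr01 t1. Qed.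

Lemma norm_s_le : normc s <= 2 * t.
Proof.
apply: le_trans (normc_le _) _; rewrite /= ger0_norm ?invr_ge0// ger0_norm ?(ltW t0)//.
have := t1; lra.
Qed.

Lemma norm_s_ge : t <= normc s.
Proof. by apply: le_trans (Im_le_normc _); rewrite /= ler_norm. Qed.

Lemma norm_a n : (0 < n)%N -> normc (a n) = (Num.sqrt n%:R)^-1.
Proof.
move=> n0; rewrite normc_cpow/= mulNr expRN sqrt_expR// ltr0n//.
Qed.

Lemma aS n : (0 < n)%N -> a n.+1 = a n * q n.
Proof.
move=> n0; rewrite /a /q /cpow -expCD -mulrDr -rcD; congr (expC (_ * _%:C)).
by rewrite /lam addrC subrK.
Qed.

Lemma lam_bounds n : (0 < n)%N -> (2 * n%:R)^-1 <= lam n <= n%:R^-1.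
Proof.
move=> n0; have n0' : (0 : R) < n%:R by rewrite ltr0n.
rewrite ln_succ_le// andbT; apply: le_trans (ln_succ_ge n0).
rewrite lef_pV2 ?posrE ?mulr_gt0 ?ltr0n// -natrM ler_nat; lia.
Qed.

Lemma norm_q_le1 n : (0 < n)%N -> normc (q n) <= 1.
Proof.
move=> n0; rewrite normc_expC -expR0 ler_expR cReM/= mulr0 subr0.
have /andP[l _] := lam_bounds n0.
rewrite mulNr oppr_le0 mulr_ge0 ?invr_ge0//.
by apply: le_trans l; rewrite invr_ge0 mulr_ge0.
Qed.

(** With z = -s [lam n], the condition n >= 32t forces |z| <= 1/16, so the quadratic remainder of
    exp z - 1 is at most 8|z|^2 <= |z|/2, and |1 - [q n]| >= |z|/2. *)
Lemma norm_1q_ge n : 32 * t <= n%:R -> t / (4 * n%:R) <= normc (1 - q n).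
Proof.
move=> tn; have n0' : 0 < n%:R :> R by apply: lt_le_trans tn; rewrite mulr_gt0.
have n0 : (0 < n)%N by rewrite -(ltr0n R).
have /andP[l1 l2] := lam_bounds n0.
have l0 : 0 <= lam n by apply: le_trans l1; rewrite invr_ge0 mulr_ge0.
have [z zE] : {z | z = - s * (lam n)%:C} by eexists.
have nz : normc z = normc s * lam n.
  by rewrite zE normc_mul normc_opp normcr ger0_norm.
have zl : t / (2 * n%:R) <= normc z.
  by rewrite nz; apply: ler_pM; rewrite ?invr_ge0 ?mulr_ge0 ?(ltW t0)//; exact: norm_s_ge.
have zu : normc z <= 16^-1.
  rewrite nz; apply: le_trans (ler_pM (normc_ge0 _) l0 norm_s_le l2) _.
  rewrite ler_pdivrMr//; lra.
have e2 : expR (normc z) <= 2 by apply: expR_le2; lra.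
have h := expC_sub2 z.
have : normc z <= normc (1 - q n) + normc (expC z - 1 - z).
  rewrite -(normc_opp (1 - _)) -(normc_opp (_ - z)).
  rewrite [X in normc X <= _](_ : z = - (1 - q n) + - (expC z - 1 - z)).
    exact: normc_add.
  by rewrite /q -zE; ring.
have hz : 4 * normc z ^+ 2 * expR (normc z) <= normc z / 2.
  rewrite expr2; have z0 := normc_ge0 z.
  apply: (@le_trans _ _ (4 * (normc z * normc z) * 2)).
    by rewrite ler_wpM2l// !mulr_ge0.
  nra.
have -> : t / (4 * n%:R) = t / (2 * n%:R) / 2 by field; rewrite gt_eqF.
lra.
Qed.

Lemma norm_c_le n : 32 * t <= n%:R -> normc (c n) <= 4 * n%:R / t.
Proof.
move=> tn; have n0' : 0 < n%:R :> R by apply: lt_le_trans tn; rewrite mulr_gt0.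
rewrite ComplexField.Normc.normcV -[leRHS]invrK lef_pV2 ?posrE.
- by rewrite invf_div norm_1q_ge.
- by apply: lt_le_trans (norm_1q_ge tn); rewrite divr_gt0// mulr_gt0.
- by rewrite invr_gt0 divr_gt0// mulr_gt0.
Qed.

Lemma one_sub_q_neq0 n : 32 * t <= n%:R -> 1 - q n != 0.
Proof.
move=> tn; have n0' : 0 < n%:R :> R by apply: lt_le_trans tn; rewrite mulr_gt0.
apply/negP => /eqP e; have := norm_1q_ge tn; rewrite e ComplexField.Normc.normc0.
by apply/negP; rewrite -ltNge divr_gt0// mulr_gt0.
Qed.

(** By [lam_diff] one step of [q] is O(t/n^2), while [c n] and [c n.+1] are O(n/t); the product is
    O(1/t) uniformly in n. *)
Lemma norm_c_diff n : 32 * t <= n%:R -> normc (c n.+1 - c n) <= 128 / t.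
Proof.
move=> tn; have n0' : 0 < n%:R :> R by apply: lt_le_trans tn; rewrite mulr_gt0.
have n0 : (0 < n)%N by rewrite -(ltr0n R).
have tn1 : 32 * t <= n.+1%:R by apply: le_trans tn _; rewrite ler_nat.
have q0 := one_sub_q_neq0 tn; have q1 := one_sub_q_neq0 tn1.
have -> : c n.+1 - c n = (q n.+1 - q n) * (c n.+1 * c n).
  by rewrite /c; field; rewrite q0 q1.
have /andP[d0 d1] := lam_diff n0.
have [w wE] : {w | w = - s * (lam n - lam n.+1)%:C} by eexists.
have -> : q n.+1 - q n = - (q n.+1 * (expC w - 1)).
  rewrite wE /q mulrBr mulr1 -expCD -mulrDr -rcD addrCA subrr addr0; ring.
rewrite normc_mul normc_opp (normc_mul (q _)) (normc_mul (c _)).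
have nw : normc w <= 2 * t * (n%:R * n.+2%:R)^-1.
  rewrite wE normc_mul normc_opp normcr ger0_norm//.
  by apply: ler_pM => //; [exact: normc_ge0|exact: norm_s_le].
have n2 : n.+2%:R = n%:R + 2 :> R by rewrite -addn2 natrD.
have n1 : n.+1%:R = n%:R + 1 :> R by rewrite -natr1.
have w2 : normc w <= 2^-1.
  apply: le_trans nw _; rewrite ler_pdivrMr ?mulr_gt0 ?ltr0n// n2; nra.
have we : normc (expC w - 1) <= 4 * normc w.
  apply: le_trans (expC_sub1 w) _.
  have := expR_le2 w2; have := normc_ge0 w; nra.
apply: (@le_trans _ _ (1 * (4 * (2 * t * (n%:R * n.+2%:R)^-1)) *
   (4 * n.+1%:R / t * (4 * n%:R / t)))).
  apply: ler_pM; rewrite ?mulr_ge0 ?normc_ge0//.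
    apply: ler_pM; rewrite ?normc_ge0//; first exact: norm_q_le1.
    by apply: le_trans we _; rewrite ler_wpM2l.
  by apply: ler_pM; rewrite ?normc_ge0//; exact: norm_c_le.
rewrite n1 n2.
have -> : 1 * (4 * (2 * t / (n%:R * (n%:R + 2)))) * (4 * (n%:R + 1) / t * (4 * n%:R / t))
   = 128 / t * ((n%:R + 1) / (n%:R + 2)).
  field; rewrite !gt_eqF//; lra.
rewrite ler_piMr ?divr_ge0 ?(ltW t0)// ler_pdivrMr; lra.
Qed.

Lemma sqrt_succ_ge n : (Num.sqrt n.+1%:R)^-1 <= 2 * (Num.sqrt n.+1%:R - Num.sqrt n%:R) :> R.
Proof.
have a0 : 0 < Num.sqrt n.+1%:R :> R by rewrite sqrtr_gt0 ltr0n.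
have b0 : 0 <= Num.sqrt n%:R :> R := sqrtr_ge0 _.
have ba : Num.sqrt n%:R <= Num.sqrt n.+1%:R :> R by rewrite ler_wsqrtr// ler_nat.
have a2 : Num.sqrt n.+1%:R ^+ 2 = Num.sqrt n%:R ^+ 2 + 1 :> R.
  by rewrite !sqr_sqrtr// natr1.
rewrite -[leLHS]mul1r ler_pdivrMr//; nra.
Qed.

(** Adding the boundary term [c K * a K] leaves a quantity whose increment is
    [(c K.+1 - c K) * a K.+1], of size O(1/(t sqrt K)); these increments sum to O(sqrt K / t). *)
Lemma sum_a_parts M K : 32 * t <= M%:R -> (M <= K)%N ->
  normc (\sum_(M <= n < K) a n + c K * a K) <= 256 / t * Num.sqrt K%:R.
Proof.
move=> tM; elim: K => [|K IH] MK.
  by move: MK tM; rewrite leqn0 => /eqP ->; rewrite leNgt mulr_gt0.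
have M0' : 0 < M%:R :> R by apply: lt_le_trans tM; rewrite mulr_gt0.
have base k : 32 * t <= k%:R -> normc (c k * a k) <= 4 / t * Num.sqrt k%:R.
  move=> tk; have k0' : 0 < k%:R :> R by apply: lt_le_trans tk; rewrite mulr_gt0.
  rewrite normc_mul norm_a -?(ltr0n R)//.
  rewrite [leRHS](_ : _ = 4 * k%:R / t / Num.sqrt k%:R).
    by rewrite ler_wpM2r ?invr_ge0 ?sqrtr_ge0//; exact: norm_c_le.
  have q0 : 0 < Num.sqrt k%:R :> R by rewrite sqrtr_gt0.
  move: (Num.sqrt _) q0 (@sqr_sqrtr R k%:R (ler0n _ _)) => u u0 <-.
  by field; rewrite !gt_eqF.
move: MK; rewrite leq_eqVlt => /orP[/eqP <-|MK].
  rewrite big_geq// add0r; apply: le_trans (base _ tM) _.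
  by rewrite ler_wpM2r ?sqrtr_ge0// ler_wpM2r ?invr_ge0 ?(ltW t0)// ler_nat.
rewrite ltnS in MK.
have K0 : (0 < K)%N by apply: leq_trans MK; rewrite -(ltr0n R).
have tK : 32 * t <= K%:R by apply: le_trans tM _; rewrite ler_nat.
have qK := one_sub_q_neq0 tK.
rewrite big_nat_recr//=.
have -> : \sum_(M <= n < K) a n + a K + c K.+1 * a K.+1 =
   (\sum_(M <= n < K) a n + c K * a K) + (c K.+1 - c K) * a K.+1.
  by rewrite !aS// /c; field; rewrite qK; apply: one_sub_q_neq0; apply: le_trans tK _; rewrite ler_nat.
apply: le_trans (normc_add _ _) _; apply: le_trans (lerD (IH MK) (lexx _)) _.
rewrite normc_mul norm_a//.
have h1 : normc (c K.+1 - c K) / Num.sqrt K.+1%:R <= 128 / t / Num.sqrt K.+1%:R.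
  by rewrite ler_wpM2r ?invr_ge0 ?sqrtr_ge0//; exact: norm_c_diff.
have h2 := sqrt_succ_ge K.
have t' : 0 < t^-1 by rewrite invr_gt0.
have h3 : 128 / t / Num.sqrt K.+1%:R <= 128 / t * (2 * (Num.sqrt K.+1%:R - Num.sqrt K%:R)).
  by rewrite ler_wpM2l// mulr_ge0// ltW.
lra.
Qed.

Lemma sum_a_le M K : 32 * t <= M%:R -> (M <= K)%N ->
  normc (\sum_(M <= n < K) a n) <= 260 / t * Num.sqrt K%:R.
Proof.
move=> tM MK.
have tK : 32 * t <= K%:R by apply: le_trans tM _; rewrite ler_nat.
have k0' : 0 < K%:R :> R by apply: lt_le_trans tK; rewrite mulr_gt0.
have h1 := sum_a_parts tM MK.
have h2 : normc (c K * a K) <= 4 / t * Num.sqrt K%:R.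
  rewrite normc_mul norm_a -?(ltr0n R)//.
  rewrite [leRHS](_ : _ = 4 * K%:R / t / Num.sqrt K%:R).
    by rewrite ler_wpM2r ?invr_ge0 ?sqrtr_ge0//; exact: norm_c_le.
  have q0 : 0 < Num.sqrt K%:R :> R by rewrite sqrtr_gt0.
  move: (Num.sqrt _) q0 (@sqr_sqrtr R K%:R (ler0n _ _)) => u u0 <-.
  by field; rewrite !gt_eqF.
have := normc_add (\sum_(M <= n < K) a n + c K * a K) (- (c K * a K)).
rewrite addrK normc_opp => h3.
have -> : 260 / t * Num.sqrt K%:R = 256 / t * Num.sqrt K%:R + 4 / t * Num.sqrt K%:R.
  by ring.
by apply: le_trans h3 (lerD h1 h2).
Qed.

(** The weight decays like k^(-3/2), so the Euler-Maclaurin tail past K is O(t / sqrt K), which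
    balances the O(sqrt K / t) of [sum_a_le]. The general bound [em_pw] would only give k^(-5/4)
    here, and no K would keep both errors bounded. *)
Lemma emz_le k : normc (emz s k) <= 4 * (normc s * wt 2^-1 k).
Proof.
have s1 : 1 - s != 0.
  by apply/negP => /eqP/(congr1 (fun z : R[i] => Im z))/= /eqP; rewrite sub0r oppr_eq0 gt_eqF.
apply: (@em_bound _ _ _ (fun x => - s * (x^-1)%:C * cpow x (- s))) => [x kx|x kx|x kx];
  have x0 := gt0n kx.
- exact: cder_pA.
- exact: cder_pw.
rewrite normc_mul normc_cpow normc_mul normc_opp normcr ger0_norm ?invr_ge0 ?(ltW x0)//.
rewrite -mulrA ler_wpM2l ?normc_ge0//.
apply: le_trans (@wt_ge _ 2^-1 x k _ kx); last by rewrite invr_ge0.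
rewrite VexpR// -expRD ler_expR cReN/=; lra.
Qed.

Lemma sum_wt_le K n : (0 < K)%N ->
  \sum_(K <= k < n + K) wt (2^-1 : R) k <= 2 * ((Num.sqrt K%:R)^-1 - (Num.sqrt (n + K)%:R)^-1).
Proof.
move=> K0; elim: n => [|n IH]; first by rewrite add0n big_geq// subrr mulr0.
rewrite addSn big_nat_recr ?leq_addl//=.
apply: le_trans (lerD IH (lexx _)) _.
have nK : (0 < n + K)%N by rewrite addn_gt0 K0 orbT.
have := @wt_telescope R 2^-1 (n + K).-1; rewrite invr_gt0 ltr0n => /(_ isT).
rewrite prednK// invrK !mulNr !expRN -!sqrt_expR ?ltr0n//; lra.
Qed.

Lemma zeta_sub_approx K : (0 < K)%N ->
  normc (zeta s - zeta_approx s K.+1) <= 16 * t / Num.sqrt K%:R.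
Proof.
move=> K0.
have s1 : s != 1.
  by apply/negP => /eqP/(congr1 (fun z : R[i] => Im z))/= /eqP; rewrite gt_eqF.
have s0 : 0 < Re s by rewrite /= invr_gt0.
rewrite zetaE// zeta_approxS opprD addrACA subrr add0r.
have cv : ((fun n => series (emz s) (n + K)%N - series (emz s) K) : nat -> R[i]^o) @ \oo -->
   (limn (series (emz s)) - series (emz s) K : R[i]^o).
  apply: cvgB; last exact: cvg_cst.
  by rewrite (@cvg_shiftn K _ (series (emz s))); exact: emz_cvg.
apply: (normc_lim_le cv) => n.
rewrite sub_series_geq ?leq_addl//; apply: le_trans (normc_sum _ _ _) _.
apply: (@le_trans _ _ (\sum_(K <= i < n + K) 4 * normc s * wt (2^-1 : R) i)).
  by apply: ler_sum => i _; rewrite -mulrA; exact: emz_le.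
rewrite -mulr_sumr.
have w0 : 0 <= \sum_(K <= k < n + K) wt (2^-1 : R) k by apply: sumr_ge0 => ? _; exact: expR_ge0.
have h := sum_wt_le n K0.
have i0 : 0 <= (Num.sqrt (n + K)%:R)^-1 :> R by rewrite invr_ge0 sqrtr_ge0.
have := norm_s_le; have := normc_ge0 s => n0 n1.
have h' : \sum_(K <= k < n + K) wt (2^-1 : R) k <= 2 * (Num.sqrt K%:R)^-1 by lra.
have : normc s * \sum_(K <= k < n + K) wt (2^-1 : R) k <= (2 * t) * (2 * (Num.sqrt K%:R)^-1).
  by apply: ler_pM.
lra.
Qed.
End Critical.

Definition zpoly M t : R[i] := \sum_(1 <= n < M.+1) cpow n%:R (- (2^-1 +i* t)).

(** Zeta is approximated at a length K of order T^2, where t / sqrt K and sqrt K / t are both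
    bounded. The terms from M to K are then discarded by [sum_a_le], whose condition 32t <= M
    follows from t <= 2T and 64T <= M. *)
Lemma zeta_near_zpoly : exists C : R, 0 < C /\ forall T t M, 1 <= T ->
  T <= t <= 2 * T -> 64 * T <= M%:R <= 128 * T ->
  normc (zeta (2^-1 +i* t) - zpoly M t) <= C.
Proof.
exists (16 * 2 + 20 + 260 * 20); split; first by lra.
move=> T t M T1 /andP[tT tT2] /andP[M1 M2].
have t1 : 1 <= t by exact: le_trans tT.
set s := 2^-1 +i* t.
pose K := (M + Num.truncn (T ^+ 2))%N.
have T0 : 0 < T by lra.
have /andP[tr1 tr2] := truncn_itv (sqr_ge0 T).
have K1 : T ^+ 2 <= K%:R.
  rewrite natrD; apply: ltW; apply: lt_le_trans tr2 _; rewrite -natr1 addrC lerD2r.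
  by apply: le_trans M1; lra.
have K2 : K.+1%:R <= (12 * T) ^+ 2.
  rewrite -natr1 natrD; nra.
have K0 : (0 < K)%N by rewrite -(ltr0n R); apply: lt_le_trans K1; rewrite exprn_gt0.
have sK : T <= Num.sqrt K%:R.
  by rewrite -(@ler_pXn2r _ 2) ?nnegrE ?sqrtr_ge0 ?(ltW T0)// sqr_sqrtr.
have sK2 : Num.sqrt K.+1%:R <= 12 * T.
  by rewrite -(@ler_pXn2r _ 2) ?nnegrE ?sqrtr_ge0 ?mulr_ge0 ?(ltW T0)// sqr_sqrtr.
have h1 := zeta_sub_approx t1 K0; rewrite -/s in h1.
have h1' : 16 * t / Num.sqrt K%:R <= 16 * 2.
  rewrite ler_pdivrMr; last exact: lt_le_trans sK.
  nra.
have -> : zeta s - zpoly M t = (zeta s - zeta_approx s K.+1) +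
   (- (cpow K.+1%:R (1 - s) / (1 - s)) + \sum_(M.+1 <= n < K.+2) cpow n%:R (- s)).
  rewrite /zpoly -/s /zeta_approx (@big_cat_nat _ _ _ M.+1 1 K.+2)//=; last first.
    by rewrite !ltnS leqW// leq_addr.
  ring.
apply: le_trans (normc_add _ _) _; rewrite -addrA; apply: lerD; first exact: le_trans h1 h1'.
apply: le_trans (normc_add _ _) _; apply: lerD.
  rewrite normc_opp normc_mul ComplexField.Normc.normcV normc_cpow.
  have -> : Re (1 - s) = 2^-1 by rewrite /=; lra.
  rewrite -sqrt_expR ?ltr0n//.
  have ns : T <= normc (1 - s).
    by apply: le_trans (Im_le_normc _); rewrite /= sub0r normrN; apply: le_trans tT (ler_norm _).
  rewrite ler_pdivrMr; last exact: lt_le_trans ns.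
  nra.
have := @sum_a_le t t1 M.+1 K.+2.
have -> : 32 * t <= M.+1%:R by rewrite -natr1; lra.
rewrite !ltnS leqW ?leq_addr// => /(_ isT isT) h2.
apply: le_trans h2 _.
have sK3 : Num.sqrt K.+2%:R <= 20 * T.
  rewrite -(@ler_pXn2r _ 2) ?nnegrE ?sqrtr_ge0 ?mulr_ge0 ?(ltW T0)// sqr_sqrtr//.
  rewrite -natr1; nra.
rewrite mulrAC ler_pdivrMr; last exact: lt_le_trans T0 tT.
nra.
Qed.
End ZetaApprox.

(** * Mertens' estimates *)

Section Mertens.
Variable R : realType.
Implicit Types (n m k p M N : nat) (x y : R).
Local Notation "n %:L" := (ln (n%:R : R)) (at level 1, left associativity, format "n %:L").

(** [logn p n] vanishes at composite p, so the range may be any initial segment reaching n; a common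
    range lets such expansions be added and compared. *)
Lemma ln_part n N : (0 < n <= N)%N ->
  n%:L = \sum_(0 <= p < N.+1) (logn p n)%:R * p%:L.
Proof.
move=> /andP[n0 nN].
have := widen_partn predT nN; rewrite partnT// => e.
rewrite [in LHS]e big_mkcond/=.
have lp p : (0 < (if predT p then p ^ logn p n else 1))%N.
  by case: p => [|p] //=; rewrite expn_gt0.
transitivity (\sum_(0 <= p < N.+1) (ln ((if predT p then p ^ logn p n else 1)%N%:R) : R)).
  elim: N.+1 => [|k IH]; first by rewrite !big_geq// ln1.
  rewrite !(big_nat_recr k)//= natrM lnM ?posrE ?ltr0n; first by rewrite -IH.
    by apply: prodn_gt0 => p; exact: (lp p).
  exact: (lp k).
apply: eq_bigr => p _ /=; rewrite natrX.
case: p => [|p]; first by rewrite expr0 ln1 mul0r.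
by rewrite lnXn ?ltr0n// mulr_natl.
Qed.

(** Legendre's formula for the exponent of a prime p in n!; the quotients with k > n vanish. *)
Definition fdiv n p : nat := \sum_(1 <= k < n.+1) n %/ p ^ k.

Lemma ln_fact n : (n`!)%:L = \sum_(0 <= p < n.+1 | prime p) (fdiv n p)%:R * p%:L.
Proof.
transitivity (\sum_(0 <= p < n.+1) (logn p n`!)%:R * p%:L).
  have H m : (m <= n)%N -> (m`!)%:L = \sum_(0 <= p < n.+1) (logn p m`!)%:R * p%:L.
    elim: m => [|m IH] mn.
      by rewrite ln1 big1// => p _; rewrite logn1 mul0r.
    rewrite factS natrM lnM ?posrE ?ltr0n ?fact_gt0// (IH (ltnW mn)).
    rewrite (@ln_part m.+1 n)// -big_split/=; apply: eq_bigr => p _.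
    by rewrite lognM ?fact_gt0// natrD mulrDl.
  exact: H.
rewrite [RHS]big_mkcond/=; apply: eq_bigr => p _.
case: ifPn => pp; first by rewrite logn_fact.
by rewrite lognE (negbTE pp) mul0r.
Qed.

Lemma ln_fact_le n : (n`!)%:L <= n%:R * n%:L.
Proof.
elim: n => [|n IH]; first by rewrite ln1 mul0r.
rewrite factS natrM lnM ?posrE ?ltr0n ?fact_gt0//.
have : n%:R * n%:L <= n%:R * n.+1%:L.
  case: n {IH} => [|n]; first by rewrite !mul0r.
  by rewrite ler_wpM2l// ler_ln ?posrE ?ltr0n// ler_nat.
have e : n.+1%:R = n%:R + 1 :> R by rewrite natr1.
move: IH; move: (ln n.+1%:R) => l; rewrite e; lra.
Qed.

Lemma ln_fact_ge n : n%:R * n%:L - n%:R <= (n`!)%:L.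
Proof.
elim: n => [|n IH]; first by rewrite ln1 mul0r subr0.
rewrite factS natrM lnM ?posrE ?ltr0n ?fact_gt0//.
have : n%:R * (n.+1%:L - n%:L) <= 1.
  case: n {IH} => [|n]; first by rewrite mul0r.
  have := @ln_succ_le R n.+1 isT; rewrite -(ler_pM2l (x := n.+1%:R)) ?ltr0n//.
  by rewrite mulfV ?pnatr_eq0.
have e : n.+1%:R = n%:R + 1 :> R by rewrite natr1.
move: IH; move: (ln n.+1%:R) => l; rewrite e; lra.
Qed.

Definition theta n : R := \sum_(0 <= p < n.+1 | prime p) p%:L.

Lemma fdivS n p : (0 < n)%N -> fdiv n p = (n %/ p + \sum_(2 <= k < n.+1) n %/ p ^ k)%N.
Proof. by move=> n0; rewrite /fdiv big_ltn// expn1. Qed.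

Lemma ln2_le1 : ln (2 : R) <= 1.
Proof. have := @le_ln1Dx R 1; rewrite (_ : 1 + 1 = 2 :> R)//; apply; lra. Qed.

Lemma lnn_ge0 n : 0 <= n%:L.
Proof. by case: n => [|n]; [rewrite ln0|apply: ln_ge0; rewrite ler1n]. Qed.

Lemma prime_dvd_fact p n : prime p -> (p %| n`!)%N = (p <= n)%N.
Proof.
move=> pp; elim: n => [|n IH]; first by rewrite fact0 dvdn1 leqn0; case: p pp => [|[|]].
rewrite factS Euclid_dvdM// IH; apply/orP/idP => [[/dvdn_leq|/leqW]//|]; first exact.
by rewrite leq_eqVlt ltnS => /orP[/eqP ->|->]; [left|right].
Qed.

Lemma prime_dvd_bin p n : prime p -> (n < p <= n.*2)%N -> (p %| 'C(n.*2, n))%N.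
Proof.
move=> pp /andP[np pn].
have := @bin_fact n.*2 n; rewrite -{1}addnn leq_addr => /(_ isT) e.
have : (p %| 'C(n.*2, n) * (n`! * (n.*2 - n)`!))%N by rewrite e prime_dvd_fact.
rewrite -{2}addnn addnK !Euclid_dvdM// !prime_dvd_fact//.
by rewrite leqNgt np /= !orbF.
Qed.

Lemma bin_le_exp n m : ('C(n, m) <= 2 ^ n)%N.
Proof.
case: (leqP m n) => [mn|nm]; last by rewrite bin_small.
rewrite -[2%N]/(1 + 1)%N expnDn (bigD1 (Ordinal (mn : (m < n.+1)%N)))//=.
by rewrite !exp1n !muln1 leq_addr.
Qed.

(** Every prime in (n, 2n] divides the central binomial coefficient, which is at most 4^n, and ln 2
    <= 1. *)
Lemma theta_double n : theta n.*2 - theta n <= 2 * n%:R.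
Proof.
have C0 : (0 < 'C(n.*2, n))%N by rewrite bin_gt0 -addnn leq_addr.
have C2 : ('C(n.*2, n))%:L <= 2 * n%:R.
  apply: (@le_trans _ _ ((2 ^ n.*2)%N%:L)).
    by rewrite ler_ln ?posrE ?ltr0n// ?ler_nat ?bin_le_exp// expn_gt0.
  rewrite natrX lnXn ?ltr0n// -[X in X <= _]mulr_natl -muln2 natrM mulrC.
  have := ln2_le1; have := ler0n R n; nra.
apply: le_trans C2; rewrite (@ln_part _ (maxn 'C(n.*2, n) n.*2)); last first.
  by rewrite C0 leq_maxl.
have -> : theta n.*2 - theta n = \sum_(n.+1 <= p < n.*2.+1 | prime p) p%:L.
  rewrite /theta [X in X - _ = _](@big_cat_nat _ _ _ n.+1)//=; last by rewrite ltnS -addnn leq_addr.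
  by rewrite [X in X - _]addrC addrK.
rewrite [leRHS](@big_cat_nat _ _ _ n.*2.+1)//=; last by rewrite ltnS leq_maxr.
rewrite [X in _ <= X + _](@big_cat_nat _ _ _ n.+1)//=; last by rewrite ltnS -addnn leq_addr.
rewrite -[leLHS]addr0 -[X in X + 0]add0r; apply: lerD; first apply: lerD.
- by apply: sumr_ge0 => p _; rewrite mulr_ge0// lnn_ge0.
- rewrite big_mkcond big_nat_cond [leRHS]big_nat_cond; apply: ler_sum => p /andP[/andP[np pn] _].
  case: ifPn => pp; last by rewrite mulr_ge0// lnn_ge0.
  rewrite -[leLHS]mul1r ler_wpM2r ?lnn_ge0// ler1n logn_gt0 mem_primes pp C0/=.
  by apply: prime_dvd_bin => //; rewrite np.
- by apply: sumr_ge0 => p _; rewrite mulr_ge0// lnn_ge0.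
Qed.

Lemma theta_mono n m : (n <= m)%N -> theta n <= theta m.
Proof.
move=> nm; rewrite /theta [leRHS](@big_cat_nat _ _ _ n.+1)//= lerDl.
by apply: sumr_ge0 => p _; exact: lnn_ge0.
Qed.

Lemma theta_le n : theta n <= 6 * n%:R.
Proof.
have [m] := ubnP n; elim: m n => // m IH n; rewrite ltnS => nm.
have [n1|n1] := leqP n 1.
  apply: (@le_trans _ _ (theta 1)); first exact: theta_mono.
  rewrite /theta big_nat_cond big1 ?mulr_ge0// => p /andP[/andP[_ p2] /prime_gt1]; lia.
have [k kE] : {k | k = uphalf n} by eexists.
have kn : (k < m)%N by lia.
have nk : (n <= k.*2)%N by lia.
have := theta_double k; have := theta_mono nk; have := IH k kn.
(* Halving upwards gives the bound 6k + 2k with k = [uphalf n]; the constant 6 absorbs the rounding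
   for odd n. *)
have : 8 * k%:R <= 6 * n%:R :> R by rewrite -!natrM ler_nat; lia.
lra.
Qed.

Definition mert n : R := \sum_(0 <= p < n.+1 | prime p) p%:L / p%:R.

(** The exponent of p in n! is at least the integer part of n/p, hence more than n/p - 1; the
    rounding loss sums to [theta n] = O(n), and ln n! <= n ln n. *)
Lemma mert_upper n : (0 < n)%N -> mert n <= n%:L + 6.
Proof.
move=> n0; have n0' : 0 < n%:R :> R by rewrite ltr0n.
have H : n%:R * mert n - theta n <= n%:R * n%:L.
  apply: le_trans (ln_fact_le n); rewrite ln_fact /mert /theta mulr_sumr -sumrB.
  rewrite big_nat_cond [leRHS]big_nat_cond; apply: ler_sum => p /andP[_ pp].
  have p0 : 0 < p%:R :> R by rewrite ltr0n prime_gt0.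
  rewrite (_ : _ - _ = (n%:R / p%:R - 1) * p%:L); last by ring.
  rewrite ler_wpM2r ?lnn_ge0// lerBlDr natr1 ler_pdivrMr// -natrM ler_nat.
  rewrite fdivS// (@leq_trans ((n %/ p).+1 * p))//; first by rewrite ltnW// ltn_ceil ?prime_gt0.
  by rewrite leq_mul2r ltnS leq_addr orbT.
have t6 := theta_le n.
have : n%:R * mert n <= n%:R * (n%:L + 6) by rewrite mulrDr; lra.
by rewrite ler_pM2l.
Qed.

Lemma geom_le p K : (1 < p)%N ->
  \sum_(1 <= k < K.+1) (p%:R ^+ k)^-1 <= (p.-1%:R)^-1 - ((p.-1%:R) * p%:R ^+ K)^-1 :> R.
Proof.
move=> p1; have q0 : 0 < p.-1%:R :> R by rewrite ltr0n; lia.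
have pq : p%:R = p.-1%:R + 1 :> R by rewrite natr1 prednK//; lia.
elim: K => [|K IH]; first by rewrite big_geq// expr0 mulr1 subrr.
rewrite big_nat_recr//=; apply: le_trans (lerD IH (lexx _)) _.
have P0 : 0 < p%:R ^+ K :> R by rewrite exprn_gt0// pq; lra.
rewrite exprS pq; rewrite pq in P0; move: (_ ^+ K) P0 => P P0.
apply: eq_ler; field.
by rewrite !gt_eqF//; lra.
Qed.

(** The subtracted term makes the induction close; what is wanted is the bound 2. *)
Lemma sum_ln_sq n : (0 < n)%N ->
  \sum_(2 <= m < n.+1) m%:L / (m%:R * m.-1%:R) <= 2 - (n%:L + 2) / n%:R.
Proof.
case: n => // n _; elim: n => [|n IH].
  by rewrite big_geq// ln1 add0r divr1 subrr.
rewrite big_nat_recr//=; apply: le_trans (lerD IH (lexx _)) _.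
have h := @ln_succ_le R n.+1 isT.
have a0 : 0 < n.+1%:R :> R by rewrite ltr0n.
have a1 : 1 <= n.+1%:R :> R by rewrite ler1n.
have e : n.+2%:R = n.+1%:R + 1 :> R by rewrite natr1.
move: a0 a1 e h; move: (n.+1%:R) (n.+2%:R) => a b a0 a1 -> h.
move: h; move: (ln (a + 1)) (ln a) => v u h.
have h2 : (a + 1) * (v - u) <= 2.
  apply: (@le_trans _ _ ((a + 1) * a^-1)); first by apply: ler_wpM2l h; lra.
  rewrite ler_pdivrMr//; lra.
rewrite -subr_ge0 (_ : _ - _ = (2 - (a + 1) * (v - u)) / (a * (a + 1))); last first.
  by field; rewrite !gt_eqF//; lra.
by apply: divr_ge0; [lra|rewrite mulr_ge0//; lra].
Qed.

(** The exponent of p in n! is at most n/(p-1), and 1/(p-1) = 1/p + 1/(p(p-1)); the second part,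
    extended from primes to all integers, is bounded by [sum_ln_sq]. *)
Lemma mert_lower n : (0 < n)%N -> n%:L - 3 <= mert n.
Proof.
move=> n0; have n0' : 0 < n%:R :> R by rewrite ltr0n.
have H : (n`!)%:L <= n%:R * (mert n + \sum_(2 <= m < n.+1) m%:L / (m%:R * m.-1%:R)).
  rewrite ln_fact.
  apply: (@le_trans _ _ (\sum_(0 <= p < n.+1 | prime p) n%:R * (p%:L / p.-1%:R))).
    rewrite big_nat_cond [leRHS]big_nat_cond; apply: ler_sum => p /andP[_ pp].
    have p1 := prime_gt1 pp.
    have q0 : 0 < p.-1%:R :> R by rewrite ltr0n; lia.
    rewrite mulrCA mulrC ler_wpM2l ?lnn_ge0//.
    rewrite /fdiv natr_sum.
    apply: (@le_trans _ _ (\sum_(1 <= k < n.+1) n%:R * (p%:R ^+ k)^-1)).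
      apply: ler_sum => k _; rewrite ler_pdivlMr ?exprn_gt0 ?ltr0n ?prime_gt0//.
      by rewrite -natrX -natrM ler_nat leq_trunc_div.
    rewrite -mulr_sumr ler_wpM2l//; apply: le_trans (geom_le n p1) _.
    by rewrite lerBlDr lerDl invr_ge0 mulr_ge0 ?exprn_ge0// ltW.
  rewrite -mulr_sumr ler_wpM2l//.
  have -> : \sum_(2 <= m < n.+1) m%:L / (m%:R * m.-1%:R) =
      \sum_(0 <= m < n.+1) m%:L / (m%:R * m.-1%:R).
    rewrite [RHS]big_ltn// ln0// mul0r add0r [RHS]big_ltn; last by rewrite ltnS.
    by rewrite ln1 mul0r add0r.
  rewrite /mert [X in _ <= X + _]big_mkcond/= [leLHS]big_mkcond/= -big_split/=.
  apply: ler_sum => p _; case: ifPn => pp.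
    have p1 := prime_gt1 pp.
    have q0 : 0 < p.-1%:R :> R by rewrite ltr0n; lia.
    have pq : p%:R = p.-1%:R + 1 :> R by rewrite natr1 prednK//; lia.
    apply: eq_ler.
    rewrite pq; field; rewrite -pq !gt_eqF// ltr0n; lia.
  by rewrite add0r mulr_ge0 ?lnn_ge0// invr_ge0 mulr_ge0.
have h := sum_ln_sq n0; have h2 := ln_fact_ge n; have L0 := lnn_ge0 n.
have h3 : \sum_(2 <= m < n.+1) m%:L / (m%:R * m.-1%:R) <= 2.
  apply: le_trans h _; rewrite lerBlDr lerDl divr_ge0//; lra.
have : n%:R * (mert n + \sum_(2 <= m < n.+1) m%:L / (m%:R * m.-1%:R)) <= n%:R * (mert n + 2).
  by rewrite ler_wpM2l// lerD2l.
move=> h4; have : n%:R * (n%:L - 3) <= n%:R * mert n by nra.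
by rewrite ler_pM2l.
Qed.

Section Abel.
Variable h : nat -> R.
Variable M : nat.
Hypothesis M0 : (0 < M)%N.
Hypothesis h0 : forall n, (M < n)%N -> 0 <= h n.
Hypothesis hmono : forall n, (M < n)%N -> h n.+1 <= h n.

Let E n : R := mert n - n%:L.
Let E6 n : (0 < n)%N -> `|E n| <= 6.
Proof.
move=> n0; rewrite /E ler_norml; have := mert_upper n0; have := mert_lower n0; lra.
Qed.

(** For decreasing h the variation h(N) - h(N+1), weighted by |E| <= 6, telescopes; subtracting h(N)
    in the bound records what has been used so far. *)
Lemma abel_aux N : (M < N)%N ->
  `|\sum_(M <= n < N) h n.+1 * (E n.+1 - E n) - h N * E N| <= 6 * (2 * h M.+1 - h N).
Proof.
elim: N => // N IH; rewrite ltnS leq_eqVlt => /orP[/eqP <-|MN].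
  rewrite big_nat1 mulrBr addrAC subrr sub0r normrN normrM ger0_norm ?h0//.
  have := E6 M0; have := h0 (ltnSn M); nra.
rewrite big_nat_recr ?(ltnW MN)//=.
rewrite (_ : _ - _ = (\sum_(M <= n < N) h n.+1 * (E n.+1 - E n) - h N * E N)
   + (h N - h N.+1) * E N); last by ring.
apply: le_trans (ler_normD _ _) _; apply: le_trans (lerD (IH MN) (lexx _)) _.
rewrite normrM ger0_norm; last by rewrite subr_ge0 hmono.
have := E6 (leq_trans M0 (ltnW MN)); have := hmono MN.
nra.
Qed.

(** Summation by parts against [E], which Mertens' first theorem bounds by 6, replaces a weighted
    prime sum by its smooth analogue with an error set by the first weight alone. *)
Lemma abel N : (M <= N)%N ->
  `|\sum_(M <= n < N) (if prime n.+1 then n.+1%:L / n.+1%:R * h n.+1 else 0)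
    - \sum_(M <= n < N) h n.+1 * (n.+1%:L - n%:L)| <= 12 * h M.+1.
Proof.
have hM := h0 (ltnSn M).
rewrite leq_eqVlt => /orP[/eqP <-|MN].
  by rewrite !big_geq// subrr normr0 mulr_ge0.
rewrite -sumrB.
have -> : \sum_(M <= n < N) ((if prime n.+1 then n.+1%:L / n.+1%:R * h n.+1 else 0)
    - h n.+1 * (n.+1%:L - n%:L)) = \sum_(M <= n < N) h n.+1 * (E n.+1 - E n).
  apply: eq_big_nat => n _; rewrite /E /mert [in RHS]big_mkcond big_nat_recr//=.
  rewrite -big_mkcond/=; case: ifP => _; ring.
have h1 := abel_aux MN.
have h2 : `|h N * E N| <= 6 * h N.
  rewrite normrM ger0_norm ?h0// mulrC ler_wpM2r ?h0// E6//.
  exact: leq_trans M0 (ltnW MN).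
have := ler_normD (\sum_(M <= n < N) h n.+1 * (E n.+1 - E n) - h N * E N) (h N * E N).
rewrite subrK; lra.
Qed.
End Abel.

Lemma lnn_gt0 n : (1 < n)%N -> 0 < n%:L.
Proof. by move=> n1; rewrite ln_gt0// ltr1n. Qed.

Lemma ln_le_succ n : (0 < n)%N -> n%:L <= n.+1%:L.
Proof. by move=> n0; rewrite ler_ln ?posrE ?ltr0n// ler_nat. Qed.

Lemma ln_concave n : (0 < n)%N -> n.+2%:L - n.+1%:L <= n.+1%:L - n%:L.
Proof.
move=> n0; apply: le_trans (ln_succ_le R (ltn0Sn n)) (ln_succ_ge R n0).
Qed.

(** With h = 1/ln in [abel] the weight ln p / p becomes 1/p, and the comparison sum is bounded below
    by a telescoping difference of ln ln. *)
Lemma sum_recip_prime_ge M N : (1 < M <= N)%N ->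
  ln (N%:L) - ln (M.+1%:L) - 12 / M.+1%:L <=
  \sum_(M <= n < N) (if prime n.+1 then (n.+1%:R)^-1 else 0).
Proof.
move=> /andP[M1 MN].
have M0 : (0 < M)%N by exact: ltnW.
have L0 n : (M < n)%N -> 0 < n%:L by move=> Mn; apply: lnn_gt0; exact: ltn_trans Mn.
have H := @abel (fun n => (n%:L)^-1) M M0 _ _ N MN.
have {H} : `|\sum_(M <= n < N) (if prime n.+1 then n.+1%:L / n.+1%:R * (n.+1%:L)^-1 else 0)
    - \sum_(M <= n < N) (n.+1%:L)^-1 * (n.+1%:L - n%:L)| <= 12 * (M.+1%:L)^-1.
  apply: H => n Mn; first by rewrite invr_ge0 ltW// L0.
  have n0 := L0 n Mn; have n1 := L0 n.+1 (leqW Mn).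
  by rewrite lef_pV2 ?posrE// ln_le_succ//; exact: leq_trans Mn.
have -> : \sum_(M <= n < N) (if prime n.+1 then n.+1%:L / n.+1%:R * (n.+1%:L)^-1 else 0)
  = \sum_(M <= n < N) (if prime n.+1 then (n.+1%:R)^-1 else 0).
  apply: eq_big_nat => n /andP[Mn _]; case: ifP => // _.
  by rewrite mulrAC mulfV ?mul1r// gt_eqF// L0.
rewrite ler_norml => /andP[h _].
have h2 : ln (N.+1%:L) - ln (M.+1%:L) <= \sum_(M <= n < N) (n.+1%:L)^-1 * (n.+1%:L - n%:L).
  rewrite -(telescope_sumr (fun n => ln (n.+1%:L)) MN).
  apply: ler_sum_nat => n /andP[Mn _]; cbv beta.
  have n1 := L0 n.+1 Mn; have n2 := L0 n.+2 (leqW Mn).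
  rewrite -[X in X <= _]ln_div ?posrE//.
  rewrite (_ : n.+2%:L / n.+1%:L = 1 + (n.+1%:L)^-1 * (n.+2%:L - n.+1%:L)); last first.
    by field; rewrite gt_eqF.
  apply: (@le_trans _ _ ((n.+1%:L)^-1 * (n.+2%:L - n.+1%:L))).
    apply: le_ln1Dx; apply: (lt_le_trans (ltrN10 R)).
    by rewrite mulr_ge0 ?invr_ge0 ?(ltW n1)// subr_ge0 ln_le_succ.
  (* The increment of ln ln from n+1 to n+2 involves the next increment of ln; concavity bounds it
     by the current one. *)
  by rewrite ler_wpM2l ?invr_ge0 ?(ltW n1)// ln_concave//; exact: leq_trans Mn.
have N0 : 0 < N%:L by apply: lnn_gt0; exact: leq_trans MN.
have h3 : ln (N%:L) <= ln (N.+1%:L).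
  have NS := ln_le_succ (leq_trans M0 MN).
  by rewrite ler_ln ?posrE// (lt_le_trans N0 NS).
lra.
Qed.

(** With h = 1/ln^2 in [abel] the comparison sum lies between two telescoping differences of
    1/ln. *)
Lemma sum_recip_pln_ge M N : (1 < M <= N)%N ->
  (M.+1%:L)^-1 - (N%:L)^-1 - 12 / M.+1%:L ^+ 2 <=
  \sum_(M <= n < N) (if prime n.+1 then (n.+1%:R * n.+1%:L)^-1 else 0) <=
  (M%:L)^-1 + 12 / M.+1%:L ^+ 2.
Proof.
move=> /andP[M1 MN].
have M0 : (0 < M)%N by exact: ltnW.
have L0 n : (M <= n)%N -> 0 < n%:L by move=> Mn; apply: lnn_gt0; exact: leq_trans Mn.
have H := @abel (fun n => (n%:L ^+ 2)^-1) M M0 _ _ N MN.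
have {H} : `|\sum_(M <= n < N) (if prime n.+1 then n.+1%:L / n.+1%:R * (n.+1%:L ^+ 2)^-1 else 0)
    - \sum_(M <= n < N) (n.+1%:L ^+ 2)^-1 * (n.+1%:L - n%:L)| <= 12 * (M.+1%:L ^+ 2)^-1.
  apply: H => n Mn; first by rewrite invr_ge0 sqr_ge0.
  have n0 := L0 n (ltnW Mn); have n1 := L0 n.+1 (leqW (ltnW Mn)).
  rewrite lef_pV2 ?posrE ?exprn_gt0// lerXn2r ?nnegrE ?(ltW n0) ?(ltW n1)//.
  by rewrite ln_le_succ//; exact: leq_trans Mn.
have -> : \sum_(M <= n < N) (if prime n.+1 then n.+1%:L / n.+1%:R * (n.+1%:L ^+ 2)^-1 else 0)
  = \sum_(M <= n < N) (if prime n.+1 then (n.+1%:R * n.+1%:L)^-1 else 0).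
  apply: eq_big_nat => n /andP[Mn _]; case: ifP => // _.
  have := L0 n.+1 (leqW Mn); have : 0 < n.+1%:R :> R by rewrite ltr0n.
  move: (ln n.+1%:R) => u; move: (n.+1%:R) => v v0 u0; field; by rewrite !gt_eqF.
rewrite ler_norml => /andP[h h'].
have h2 : (M.+1%:L)^-1 - (N.+1%:L)^-1 <= \sum_(M <= n < N) (n.+1%:L ^+ 2)^-1 * (n.+1%:L - n%:L).
  rewrite (_ : _ - _ = - (N.+1%:L)^-1 - - (M.+1%:L)^-1); last by ring.
  rewrite -(telescope_sumr (fun n => - (n.+1%:L)^-1) MN).
  apply: ler_sum_nat => n /andP[Mn _]; cbv beta.
  have n1 := L0 n.+1 (leqW Mn); have n2 := L0 n.+2 (leqW (leqW Mn)).
  apply: (@le_trans _ _ ((n.+1%:L ^+ 2)^-1 * (n.+2%:L - n.+1%:L))); last first.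
    by rewrite ler_wpM2l ?invr_ge0 ?sqr_ge0// ln_concave//; exact: leq_trans Mn.
  have := ln_le_succ (ltn0Sn n); move: (n.+2%:L) (n.+1%:L) n1 n2 => b a a0 b0 ab.
  rewrite (_ : - b^-1 - - a^-1 = (a * b)^-1 * (b - a)); last by field; rewrite !gt_eqF.
  rewrite ler_wpM2r ?subr_ge0// lef_pV2 ?posrE ?mulr_gt0 ?exprn_gt0// expr2.
  by rewrite ler_wpM2l// ltW.
have h3 : \sum_(M <= n < N) (n.+1%:L ^+ 2)^-1 * (n.+1%:L - n%:L) <= (M%:L)^-1 - (N%:L)^-1.
  rewrite (_ : _ - _ = - (N%:L)^-1 - - (M%:L)^-1); last by ring.
  rewrite -(telescope_sumr (fun n => - (n%:L)^-1) MN).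
  apply: ler_sum_nat => n /andP[Mn _]; cbv beta.
  have n1 := L0 n Mn; have n2 := L0 n.+1 (leqW Mn).
  have := ln_le_succ (leq_trans M0 Mn).
  move: (n.+1%:L) (n%:L) n1 n2 => b a a0 b0 ab.
  rewrite (_ : - b^-1 - - a^-1 = (a * b)^-1 * (b - a)); last by field; rewrite !gt_eqF.
  rewrite ler_wpM2r ?subr_ge0// lef_pV2 ?posrE ?mulr_gt0 ?exprn_gt0// expr2.
  by rewrite ler_wpM2r// ltW.
have N0 : 0 < N%:L by exact: L0.
have h4 : (N.+1%:L)^-1 <= (N%:L)^-1.
  have NS := ln_le_succ (leq_trans M0 MN).
  by rewrite lef_pV2 ?posrE// (lt_le_trans N0 NS).
have h5 : 0 < (N%:L)^-1 by rewrite invr_gt0.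
by apply/andP; split; lra.
Qed.
End Mertens.

(** * Smoothed mean values *)

Section Integrals.
Variable R : realType.
Implicit Types (f g F : R -> R) (v w x y t T om : R) (n J : nat).

Lemma dD f g x df dg : is_derive x 1 f df -> is_derive x 1 g dg ->
  is_derive x 1 (fun t => f t + g t) (df + dg).
Proof. by move=> Hf Hg; exact: (is_deriveD Hf Hg). Qed.
Lemma dZ (c : R) f x df : is_derive x 1 f df ->
  is_derive x 1 (fun t => c * f t) (c * df).
Proof. by move=> Hf; exact: (is_deriveZ c Hf). Qed.
Lemma dM f g x df dg : is_derive x 1 f df -> is_derive x 1 g dg ->
  is_derive x 1 (fun t => f t * g t) (df * g x + f x * dg).
Proof.
move=> Hf Hg; have H := is_deriveM Hf Hg; apply: is_derive_eq H _.
by rewrite /GRing.scale/=; ring.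
Qed.
Lemma dX n f x df : is_derive x 1 f df ->
  is_derive x 1 (fun t => f t ^+ n.+1) (n.+1%:R * f x ^+ n * df).
Proof.
move=> Hf; have H := @is_deriveX R _ f n.+1 x 1 df Hf.
have -> : (fun t => f t ^+ n.+1) = f ^+ n.+1.
  by apply/funext => t; rewrite fctE.
exact: H.
Qed.
Lemma dsin (a x : R) : is_derive x 1 (fun t => sin (a * t)) (a * cos (a * x)).
Proof.
have H : is_derive x 1 (fun t => a * t) (a * 1) by apply: dZ; exact: is_derive_id.
rewrite mulr1 in H; rewrite mulrC.
exact: (@is_derive1_comp _ sin (fun t => a * t) x _ _ (is_derive_sin _) H).
Qed.
Lemma dcos (a x : R) : is_derive x 1 (fun t => cos (a * t)) (- (a * sin (a * x))).
Proof.
have H : is_derive x 1 (fun t => a * t) (a * 1) by apply: dZ; exact: is_derive_id.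
rewrite mulr1 in H; rewrite mulrC -mulNr.
exact: (@is_derive1_comp _ cos (fun t => a * t) x _ _ (is_derive_cos _) H).
Qed.

(* v is the integral of f over [T, 2T], expressed by a primitive of f. *)
Definition isint T f v := continuous (f : R^o -> R^o) /\
  exists F, (forall x, is_derive x 1 F (f x)) /\ F (2 * T) - F T = v.

Lemma isint_ext T f g v : f =1 g -> isint T f v -> isint T g v.
Proof. by move=> /funext ->. Qed.

Lemma isint_eq T f v w : isint T f v -> v = w -> isint T f w.
Proof. by move=> ? <-. Qed.

Lemma isintD T f g v w : isint T f v -> isint T g w ->
  isint T (fun t => f t + g t) (v + w).
Proof.
move=> [cf [F [dF <-]]] [cg [G [dG <-]]]; split.
  by move=> x; apply: cvgD; [exact: cf|exact: cg].
by exists (fun t => F t + G t); split; [move=> x; exact: dD|ring].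
Qed.

Lemma isintZ T (c : R) f v : isint T f v -> isint T (fun t => c * f t) (c * v).
Proof.
move=> [cf [F [dF <-]]]; split.
  by move=> x; apply: cvgM; [exact: cvg_cst|exact: cf].
by exists (fun t => c * F t); split; [move=> x; exact: dZ|ring].
Qed.

Lemma isintB T f g v w : isint T f v -> isint T g w ->
  isint T (fun t => f t - g t) (v - w).
Proof.
move=> hf hg; have := isintD hf (isintZ (-1) hg); rewrite mulN1r.
by apply: isint_ext => t; rewrite mulN1r.
Qed.

Lemma isint0 T : isint T (fun=> 0) 0.
Proof.
split; first by move=> x; exact: cvg_cst.
by exists (fun=> 0); split; [move=> x; exact: is_derive_cst|rewrite subrr].
Qed.

Lemma isint_sum T (I : Type) (r : seq I) (P : pred I) (f : I -> R -> R) (v : I -> R) :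
  (forall i, P i -> isint T (f i) (v i)) ->
  isint T (fun t => \sum_(i <- r | P i) f i t) (\sum_(i <- r | P i) v i).
Proof.
move=> H; elim: r => [|i r IH].
  by rewrite big_nil; apply: isint_ext (isint0 T) => t; rewrite big_nil.
rewrite big_cons; case: ifPn => Pi.
  by apply: isint_ext (isintD (H i Pi) IH) => t; rewrite big_cons Pi.
by apply: isint_ext IH => t; rewrite big_cons (negbTE Pi).
Qed.

Lemma isint_le T f g v w : 0 < T -> isint T f v -> isint T g w ->
  (forall t, T <= t <= 2 * T -> f t <= g t) -> v <= w.
Proof.
move=> T0 hf hg fg; rewrite -subr_ge0.
have [_ [F [dF <-]]] := isintB hg hf.
have T2 : T <= 2 * T by lra.
have [|c] := @MVT_segment R F (fun t => g t - f t) T (2 * T) T2 (fun x _ => dF x).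
  by apply: derivable_within_continuous => x _; have [] := dF x.
rewrite in_itv/= => cT ->; apply: mulr_ge0; last lra.
by rewrite subr_ge0 fg.
Qed.

(** The passage from primitives to the Lebesgue integral: the fundamental theorem of calculus, then
    comparison with [lam] times an indicator. *)
Lemma isint_le_measure T f v (lam : R) (S : set R) : 0 < T -> isint T f v ->
  0 <= lam -> measurable S -> S `<=` `[T, 2 * T] ->
  (forall t, T <= t <= 2 * T -> f t <= lam * \1_S t) ->
  (v%:E <= lam%:E * lebesgue_measure S)%E.
Proof.
move=> T0 [cf [F [dF <-]]] lam0 mS ST fS.
have T2 : T < 2 * T by lra.
have cw : {within `[T, 2 * T], continuous (f : R^o -> R^o)}.
  by apply: continuous_subspaceT => x; exact: cf.
have dlr : derivable_oo_LRcontinuous (F : R -> R^o) T (2 * T).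
  have cF x : {for x, continuous (F : R^o -> R^o)}.
    by apply: differentiable_continuous; apply/derivable1_diffP; have [] := dF x.
  split; first by move=> x _; have [] := dF x.
  - exact: cvg_at_right_filter (cF T).
  - exact: cvg_at_left_filter (cF (2 * T)).
have dFf : {in `]T, 2 * T[, (F : R -> R^o)^`()%classic =1 f}.
  by move=> x _; rewrite derive1E; exact: derive_val.
rewrite EFinB -(continuous_FTC2 T2 cw dlr dFf).
have mT : measurable (`[T, 2 * T] : set R) by exact: measurable_itv.
have If : lebesgue_measure.-integrable `[T, 2 * T] (EFin \o f).
  apply: continuous_compact_integrable => //; exact: segment_compact.
have I1 : lebesgue_measure.-integrable (`[T, 2 * T] : set R) (EFin \o (fun t => \1_S t : R)).
  apply: (@le_integrable _ _ _ lebesgue_measure `[T, 2 * T] _ _ (EFin \o (fun=> (1 : R)))).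
  - exact: measurable_itv.
  - by apply/measurable_EFinP; apply: measurable_funTS; exact: measurable_indic.
  - move=> t _ /=; rewrite lee_fin normr1 ger0_norm ?indicE// /indic.
    by case: (_ \in _).
  - apply: continuous_compact_integrable; first exact: segment_compact.
    by apply: continuous_subspaceT => x; exact: cvg_cst.
apply: (@le_trans _ _ (\int[lebesgue_measure]_(x in `[T, (2 * T)%R]) (lam%:E * (\1_S x)%:E))%E).
  apply: le_integral => //.
    exact: integrableZl.
  move=> x /set_mem; rewrite /= in_itv/= => /fS; rewrite -EFinM lee_fin //.
rewrite integralZl//; apply: lee_wpmul2l; first by rewrite lee_fin.
rewrite integral_indic// (_ : S `&` _ = S)//; exact/setIidPl.
Qed.

Lemma continuous_cosM om : continuous ((fun t => cos (om * t)) : R^o -> R^o).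
Proof.
move=> x; apply: differentiable_continuous; apply/derivable1_diffP.
by have [] := dcos om x.
Qed.

Lemma isint_cos T om : om != 0 -> 0 < T ->
  exists v, isint T (fun t => cos (om * t)) v /\ `|v| <= 2 / `|om|.
Proof.
move=> om0 T0; eexists; split.
  split; first exact: continuous_cosM.
  exists (fun t => om^-1 * sin (om * t)); split; last by reflexivity.
  by move=> x; apply: is_derive_eq (dZ om^-1 (dsin om x)) _; rewrite mulrA mulVf// mul1r.
rewrite -mulrBr normrM normfV mulrC ler_wpM2r ?invr_ge0//.
apply: le_trans (ler_normB _ _) _.
have s1 y : `|sin y| <= 1 :> R by rewrite ler_norml sin_geN1 sin_le1.
by have := lerD (s1 (om * (2 * T))) (s1 (om * T)).
Qed.

Lemma isint_cst T (c : R) : isint T (fun=> c) (c * T).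
Proof.
split; first by move=> x; exact: cvg_cst.
exists (fun t => c * t); split; last by ring.
by move=> x; apply: is_derive_eq (dZ c (is_derive_id x 1)) _; rewrite mulr1.
Qed.

Let aw T : R := pi / T.

Lemma sin_aT T : 0 < T -> sin (aw T * T) = 0 /\ sin (aw T * (2 * T)) = 0.
Proof.
move=> T0; rewrite /aw mulrCA divfK ?gt_eqF// sinpi; split => //.
by rewrite mulrC mulr_natr sin2pi.
Qed.

(** Two integrations by parts. The second derivative of sin^m(at) is m(m-1)a^2 sin^(m-2)(at) - m^2
    a^2 sin^m(at); integrated against cos(om t) it gives -om^2 times the integral of sin^m(at)
    cos(om t). The boundary terms vanish because a = pi/T makes the sine zero at both T and 2T. *)
Lemma isint_sin_step T n om v : 0 < T ->
  (n.+2%:R * aw T) ^+ 2 - om ^+ 2 != 0 ->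
  isint T (fun t => sin (aw T * t) ^+ n * cos (om * t)) v ->
  isint T (fun t => sin (aw T * t) ^+ n.+2 * cos (om * t))
    (n.+2%:R * n.+1%:R * aw T ^+ 2 / ((n.+2%:R * aw T) ^+ 2 - om ^+ 2) * v).
Proof.
move=> T0 D0 [cf [F [dF Fv]]].
have [D DE] : {D | D = (n.+2%:R * aw T) ^+ 2 - om ^+ 2} by eexists.
rewrite -DE in D0 *.
split.
  have h (h1 h2 : R -> R) : continuous (h1 : R^o -> R^o) -> continuous (h2 : R^o -> R^o) ->
      continuous ((fun t => h1 t * h2 t) : R^o -> R^o).
    by move=> c1 c2 x; apply: cvgM; [exact: c1|exact: c2].
  apply: (h (fun t => sin (aw T * t) ^+ n.+2) _ _ (@continuous_cosM om)) => x; apply: differentiable_continuous; apply/derivable1_diffP.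
  by have [] := dX n.+1 (dsin (aw T) x).
have [s1 s2] := sin_aT T0.
exists (fun t => D^-1 * (n.+2%:R * n.+1%:R * aw T ^+ 2 * F t +
   (-1) * (n.+2%:R * aw T * ((sin (aw T * t) ^+ n.+1 * cos (aw T * t)) * cos (om * t))
   + om * (sin (aw T * t) ^+ n.+2 * sin (om * t))))); split.
  move=> x.
  have dS := dsin (aw T) x; have dC := dcos (aw T) x.
  have dSn := dX n dS; have dSn2 := dX n.+1 dS.
  have H := dZ D^-1 (dD (dZ (n.+2%:R * n.+1%:R * aw T ^+ 2) (dF x))
    (dZ (-1) (dD (dZ (n.+2%:R * aw T) (dM (dM dSn dC) (dcos om x)))
                 (dZ om (dM dSn2 (dsin om x)))))).
  apply: is_derive_eq H _.
  rewrite !exprS !expr0 !mulr1; have := cos2Dsin2 (aw T * x).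
  move: (cos (aw T * x)) (sin (aw T * x)) (cos (om * x)) (sin (om * x)) => C S C' S' e.
  have e2 : C * C = 1 - S * S by move: e; rewrite !expr2; lra.
  have n2 : n.+2%:R = n.+1%:R + 1 :> R by rewrite -natr1.
  apply: (mulfI D0).
  rewrite [LHS]mulVKf// DE ?expr2 n2.
  move: (S ^+ n) => Sn.
  rewrite (_ : (n.+1%:R * Sn * (aw T * C) * C) = n.+1%:R * Sn * aw T * (C * C)); last by ring.
  by rewrite e2; ring.
rewrite s1 s2 !expr0n/= -Fv; ring.
Qed.

Definition win T J t : R := sin (aw T * t) ^+ J.*2.
(* The mean value of sin^(2J). *)
Fixpoint winc J : R := if J is J'.+1 then (J'.*2.+1%:R / J'.*2.+2%:R) * winc J' else 1.

Lemma winc_gt0 J : 0 < winc J.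
Proof. by elim: J => //= J IH; rewrite mulr_gt0// divr_gt0// ltr0n. Qed.

Lemma win_ge0 T J t : 0 <= win T J t.
Proof. by rewrite /win -mul2n exprM exprn_ge0// sqr_ge0. Qed.

Lemma win_le1 T J t : win T J t <= 1.
Proof.
rewrite /win -mul2n exprM; apply: exprn_ile1; first exact: sqr_ge0.
have := cos2Dsin2 (aw T * t); have := sqr_ge0 (cos (aw T * t)); lra.
Qed.

Lemma aw_gt0 T : 0 < T -> 0 < aw T.
Proof. by move=> T0; rewrite divr_gt0// (lt_le_trans _ (pi_ge2 R)). Qed.

Lemma aw_le T : 0 < T -> aw T <= 4 / T.
Proof.
move=> T0; rewrite ler_wpM2r ?invr_ge0 ?(ltW T0)//.
have [/andP[_ h] _] := pihalf_02_cos_pihalf R; lra.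
Qed.

Lemma isint_win T J : 0 < T -> isint T (win T J) (winc J * T).
Proof.
move=> T0.
apply: (@isint_ext T (fun t => sin (aw T * t) ^+ J.*2 * cos (0 * t))).
  by move=> t; rewrite mul0r cos0 mulr1.
elim: J => [|J IH].
  rewrite mul1r; apply: isint_ext (isint_eq (isint_cst T 1) (mul1r T)) => t.
  by rewrite expr0 mul0r cos0 mulr1.
have a0 := aw_gt0 T0.
have D0 : (J.*2.+2%:R * aw T) ^+ 2 - 0 ^+ 2 != 0.
  by rewrite expr0n/= subr0 expf_neq0// mulf_neq0 ?gt_eqF// ltr0n.
rewrite doubleS; apply: isint_eq (isint_sin_step T0 D0 IH) _ => /=.
have : J.*2.+2%:R != 0 :> R by rewrite pnatr_eq0.
move: (J.*2.+2%:R) (J.*2.+1%:R) => u v u0; field.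
rewrite u0/= gt_eqF//= expr2 mulf_neq0// mulf_neq0// gt_eqF//.
Qed.

(** Each of the J reductions by [isint_sin_step] gains a factor at most (2J a)^2 / (om^2/2) with a =
    pi/T <= 4/T, since the assumption on om keeps the denominator above om^2/2; [isint_cos] ends the
    recursion. *)
Lemma isint_win_cos T J om : 0 < T -> 16 * J%:R < `|om| * T -> 0 < `|om| ->
  exists v, isint T (fun t => win T J t * cos (om * t)) v /\
    `|v| <= (16 * J%:R / (T * `|om|)) ^+ J.*2 * (2 / `|om|).
Proof.
move=> T0 + om0.
(* Only the number j of reductions moves; J stays fixed in the ratio, so that all steps share the
   same factor. *)
suff H j : (j <= J)%N -> 16 * J%:R < `|om| * T ->
  exists v, isint T (fun t => win T j t * cos (om * t)) v /\
    `|v| <= (16 * J%:R / (T * `|om|)) ^+ j.*2 * (2 / `|om|) by exact: H.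
move=> + big; elim: j => [|j IH] jJ.
  have [|v [hv v1]] := @isint_cos T om _ T0; first by rewrite -normr_gt0.
  exists v; rewrite expr0 mul1r; split => //.
  by apply: isint_ext hv => t; rewrite /win expr0 mul1r.
have [v [hv v1]] := IH (ltnW jJ).
have a0 := aw_gt0 T0; have a4 := aw_le T0.
have [m mE] : {m | m = `|om|} by eexists.
have om2 : om ^+ 2 = m ^+ 2 by rewrite mE real_normK ?num_real.
rewrite -mE in big om0 v1 *.
have J0 : 0 <= J%:R :> R by [].
have am : 4 * J%:R * aw T <= m.
  apply: (@le_trans _ _ (4 * J%:R * (4 / T))); first by rewrite ler_wpM2l// mulr_ge0.
  rewrite mulrA ler_pdivrMr//; lra.
have jJr : j.*2.+2%:R <= 2 * J%:R :> R by rewrite -natrM ler_nat; clear - jJ; lia.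
have j1r : j.*2.+1%:R <= 2 * J%:R :> R by rewrite -natrM ler_nat; clear - jJ; lia.
have j20 : 0 < j.*2.+2%:R :> R by rewrite ltr0n.
have j10 : 0 < j.*2.+1%:R :> R by rewrite ltr0n.
have l1 : j.*2.+2%:R * aw T <= m / 2.
  have : j.*2.+2%:R * aw T <= 2 * J%:R * aw T by rewrite ler_wpM2r// ltW.
  lra.
have l0 : 0 <= j.*2.+2%:R * aw T by rewrite mulr_ge0// ltW.
have D2 : m ^+ 2 / 2 <= m ^+ 2 - (j.*2.+2%:R * aw T) ^+ 2 by nra.
have m20 : 0 < m ^+ 2 by rewrite exprn_gt0.
have D0 : (j.*2.+2%:R * aw T) ^+ 2 - om ^+ 2 != 0.
  by rewrite om2; apply/negP => /eqP; lra.
have := isint_sin_step T0 D0 hv; rewrite om2 -doubleS => h.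
eexists; split; first exact: h.
have [X XE] : {X | X = 16 * J%:R / (T * m)} by eexists.
rewrite -XE in v1 *; rewrite normrM.
have -> : X ^+ (j.+1).*2 * (2 / m) = (X * X) * (X ^+ j.*2 * (2 / m)).
  by rewrite doubleS !exprS; ring.
apply: ler_pM => //; rewrite XE.
rewrite normrM normfV (distrC _ (m ^+ 2)) ger0_norm; last first.
  by apply: mulr_ge0; [apply: mulr_ge0; rewrite ler0n|exact: sqr_ge0].
rewrite [`|_ - _|]ger0_norm; last by apply: le_trans D2; rewrite divr_ge0// ltW.
rewrite ler_pdivrMr; last by apply: lt_le_trans D2; rewrite divr_gt0.
have aT : aw T * T <= 4 by rewrite -ler_pdivlMr.
apply: (@le_trans _ _ (16 * J%:R / (T * m) * (16 * J%:R / (T * m)) * (m ^+ 2 / 2))); last first.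
  by apply: ler_wpM2l => //; rewrite -expr2 sqr_ge0.
rewrite [leRHS](_ : _ = (2 * J%:R) * (2 * J%:R) * (4 / T) ^+ 2 * 2); last first.
  by field; rewrite !gt_eqF.
apply: (@le_trans _ _ ((2 * J%:R) * (2 * J%:R) * (4 / T) ^+ 2)).
  apply: ler_pM; [by rewrite mulr_ge0 ?ler0n|exact: sqr_ge0| |].
    by apply: ler_pM; rewrite ?ler0n.
  by apply: lerXn2r => //; rewrite nnegrE ?(ltW a0)// divr_ge0// ltW.
rewrite ler_peMr ?ler1n//; apply: mulr_ge0; [by rewrite !mulr_ge0|exact: sqr_ge0].
Qed.

(** Zero frequencies contribute the mean value of the window and all others a uniformly small
    amount. Separation is asked only where the coefficient is nonzero, because truncated
    coefficients vanish exactly at the integers that are too long. *)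
Lemma isint_win_sum T J (M : R) (I : finType) (c om : I -> R) :
  0 < T -> 0 < M -> 16 * J%:R * M < T ->
  (forall i, 0 <= c i) ->
  (forall i, c i != 0 -> om i = 0 \/ M^-1 <= `|om i|) ->
  exists v, isint T (fun t => win T J t * \sum_i c i * cos (om i * t)) v /\
   `|v - winc J * T * \sum_(i | om i == 0) c i| <=
      (16 * J%:R * M / T) ^+ J.*2 * (2 * M) * \sum_i c i.
Proof.
move=> T0 M0 JM c0 omM.
have B0 : 0 <= (16 * J%:R * M / T) ^+ J.*2 * (2 * M).
  by rewrite mulr_ge0 ?exprn_ge0 ?divr_ge0 ?mulr_ge0 ?(ltW M0) ?(ltW T0).
have /choice [v hv] : forall i, exists v,
    isint T (fun t => win T J t * (c i * cos (om i * t))) v /\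
    `|v - (if om i == 0 then winc J * T * c i else 0)| <=
       (16 * J%:R * M / T) ^+ J.*2 * (2 * M) * c i.
  move=> i; have [ci0|ci0] := eqVneq (c i) 0.
    exists 0; rewrite ci0 !mulr0; split; last by case: ifP; rewrite subrr normr0.
    by apply: isint_ext (isint0 T) => t; rewrite mul0r mulr0.
  case: (omM i ci0) => [ez|ebig].
    exists (c i * (winc J * T)); split.
      apply: isint_ext (isintZ (c i) (isint_win J T0)) => t.
      by rewrite ez mul0r cos0 mulr1 mulrC.
    by rewrite ez eqxx mulrC subrr normr0 mulr_ge0.
  have om0 : 0 < `|om i| by apply: lt_le_trans ebig; rewrite invr_gt0.
  have ebig' : `|om i|^-1 <= M by rewrite -[leRHS]invrK lef_pV2 ?posrE ?invr_gt0.
  have [||v [hv v1]] := @isint_win_cos T J (om i) T0.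
    apply: (@le_lt_trans _ _ (16 * J%:R * M * `|om i|)).
      rewrite -[leLHS]mulr1 -!mulrA ler_wpM2l// ler_wpM2l//.
      by rewrite -ler_pdivrMl// mulr1.
    by rewrite mulrC ltr_pM2l.
  - exact: om0.
  exists (c i * v); split.
    by apply: isint_ext (isintZ (c i) hv) => t; ring.
  have omn : om i != 0 by rewrite -normr_gt0.
  rewrite (negbTE omn) subr0 normrM (ger0_norm (c0 i)) mulrC ler_wpM2r//.
  apply: le_trans v1 _; apply: ler_pM.
  - by rewrite exprn_ge0 ?divr_ge0 ?mulr_ge0 ?(ltW T0).
  - by rewrite divr_ge0.
  - apply: lerXn2r; rewrite ?nnegrE ?divr_ge0 ?mulr_ge0 ?(ltW T0) ?(ltW M0)//.
    by rewrite invfM mulrA mulrAC -!mulrA ler_wpM2l// ler_wpM2l// ler_wpM2r ?invr_ge0 ?(ltW T0).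
  - by rewrite ler_wpM2l.
exists (\sum_i v i); split.
  apply: isint_ext (isint_sum (index_enum I) (P := predT) (fun i _ => (hv i).1)) => t.
  by rewrite mulr_sumr.
rewrite mulr_sumr [X in _ - X]big_mkcond/= -sumrB mulr_sumr.
apply: le_trans (ler_norm_sum _ _ _) _; apply: ler_sum => i _; exact: (hv i).2.
Qed.
End Integrals.

(** * Finite exponential sums and the second moment of the zeta polynomial *)

Section TrigSums.
Variable R : realType.
Implicit Types (t x y T : R) (I J K : finType).

Definition cis x : R[i] := cos x +i* sin x.

Lemma cisD x y : cis (x + y) = cis x * cis y.
Proof. by apply: complex_ext; rewrite /cis ?(cReM, cImM)/= ?cosD ?sinD; ring. Qed.
Lemma cis0 : cis 0 = 1.
Proof. by rewrite /cis cos0 sin0. Qed.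

Definition csum I (c om : I -> R) t : R[i] := \sum_i (c i)%:C * cis (om i * t).

Lemma Re_sum I (P : pred I) (F : I -> R[i]) : Re (\sum_(i | P i) F i) = \sum_(i | P i) Re (F i).
Proof. by elim/big_rec2 : _ => //= i a b _ <-; rewrite cReD. Qed.
Lemma Im_sum I (P : pred I) (F : I -> R[i]) : Im (\sum_(i | P i) F i) = \sum_(i | P i) Im (F i).
Proof. by elim/big_rec2 : _ => //= i a b _ <-; rewrite cImD. Qed.

Lemma Re_csum I (c om : I -> R) t : Re (csum c om t) = \sum_i c i * cos (om i * t).
Proof. by rewrite Re_sum; apply: eq_bigr => i _; rewrite cReM/= mul0r subr0. Qed.

Lemma csumM I J (c om : I -> R) (d mu : J -> R) t :
  csum c om t * csum d mu t =
  csum (fun ij : I * J => c ij.1 * d ij.2) (fun ij => om ij.1 + mu ij.2) t.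
Proof.
rewrite /csum big_distrlr/= pair_big/=; apply: eq_bigr => ij _.
by rewrite rcM mulrDl cisD; ring.
Qed.

Lemma prod_rc I (F : I -> R) : \prod_i (F i)%:C = (\prod_i F i)%:C :> R[i].
Proof. by elim/big_rec2 : _ => // i a b _ ->; rewrite rcM. Qed.

Lemma csumX I (c om : I -> R) t n :
  csum c om t ^+ n =
  csum (fun f : {ffun 'I_n -> I} => \prod_j c (f j)) (fun f => \sum_j om (f j)) t.
Proof.
transitivity (\prod_(j < n) csum c om t); first by rewrite prodr_const card_ord.
rewrite bigA_distr_bigA/=; apply: eq_bigr => f _.
rewrite big_split/= prod_rc; congr (_ * _).
rewrite mulr_suml; elim/big_rec2 : _ => [|j a b _ ->]; first by rewrite cis0.
by rewrite cisD.
Qed.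

Definition cconj (z : R[i]) : R[i] := Re z +i* - Im z.

Lemma cconj_csum I (c om : I -> R) t : cconj (csum c om t) = csum c (fun i => - om i) t.
Proof.
apply: complex_ext; rewrite /cconj/= ?Re_sum ?Im_sum -?sumrN; apply: eq_bigr => i _.
  by rewrite !cReM/= !mul0r mulNr cosN.
by rewrite !cImM/= !mul0r !addr0 mulNr sinN mulrN.
Qed.

Lemma mul_cconj z : z * cconj z = (normc z ^+ 2)%:C.
Proof.
case: z => a b; apply: complex_ext; rewrite /cconj ?(cReM, cImM)/=; last ring.
by rewrite sqr_sqrtr ?addr_ge0 ?sqr_ge0//; ring.
Qed.

Lemma ln_sep (a b : nat) (M : R) : (0 < a)%N -> (0 < b)%N -> a != b ->
  a%:R <= M -> b%:R <= M -> M^-1 <= `|ln (a%:R : R) - ln (b%:R : R)|.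
Proof.
wlog ab : a b / (a < b)%N => [H a0 b0 ab aM bM|a0 b0 _ aM bM].
  have [l|l|/eqP] := ltngtP a b; [|rewrite distrC|by rewrite (negbTE ab)]; apply: H => //.
  by rewrite eq_sym.
have a0' : 0 < a%:R :> R by rewrite ltr0n.
have b0' : 0 < b%:R :> R by rewrite ltr0n.
apply: (@le_trans _ _ (b%:R^-1)).
  by rewrite lef_pV2 ?posrE// (lt_le_trans b0' bM).
rewrite distrC; apply: le_trans (ler_norm _); rewrite -[leRHS]opprB lerNr -ln_div ?posrE//.
rewrite (_ : a%:R / b%:R = 1 + - ((b%:R - a%:R) / b%:R)); last by field; rewrite gt_eqF.
have d1 : 1 <= b%:R - a%:R :> R by rewrite -natrB ?(ltnW ab)// ler1n subn_gt0.
apply: le_trans (le_ln1Dx _) _.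
  by rewrite ltrN2 ltr_pdivrMr// mul1r ltrBlDr ltrDl.
by rewrite lerN2 -[leLHS]mul1r ler_wpM2r// invr_ge0 ltW.
Qed.

Let dc M (i : 'I_M) : R := (Num.sqrt i.+1%:R)^-1.
Let dom M (i : 'I_M) : R := - ln (i.+1%:R : R).

Lemma zpolyE M t : zpoly M t = csum (@dc M) (@dom M) t.
Proof.
rewrite /zpoly big_add1 big_mkord; apply: eq_bigr => i _.
rewrite /cpow /expC cReM cImM /dc /dom sqrt_expR ?ltr0n//=; congr (_ * _).
  by congr (_%:C); rewrite -expRN; congr expR; ring.
by rewrite /cis; congr (_ +i* _); [congr cos|congr sin]; ring.
Qed.

Lemma dc_gt0 M (i : 'I_M) : 0 < dc i.
Proof. by rewrite invr_gt0 sqrtr_gt0 ltr0n. Qed.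

Lemma harm_le n : \sum_(0 <= k < n) (k.+1%:R)^-1 <= 1 + ln (n%:R : R).
Proof.
case: n => [|n]; first by rewrite big_geq// ln0// addr0.
elim: n => [|n IH]; first by rewrite big_nat1 invr1 ln1 addr0.
rewrite big_nat_recr//=; apply: le_trans (lerD IH (lexx _)) _.
by rewrite -addrA lerD2l -lerBrDl; exact: ln_succ_ge.
Qed.

Lemma sum_diff_le M (n : 'I_M) :
  \sum_(m < M | (m < n)%N) (n%:R - m%:R)^-1 <= 1 + ln (M%:R : R).
Proof.
have -> : \sum_(m < M | (m < n)%N) (n%:R - m%:R)^-1 = \sum_(m < n) (n%:R - m%:R)^-1 :> R.
  by rewrite -(big_ord_widen M (fun m => (n%:R - m%:R)^-1 : R))// ltnW.
rewrite (reindex_inj rev_ord_inj)/=.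
rewrite (eq_bigr (fun k : 'I_n => (k.+1%:R)^-1 : R)).
  rewrite -(big_mkord xpredT (fun k => (k.+1%:R)^-1 : R)).
  apply: le_trans (harm_le _) _; rewrite lerD2l.
  case: (posnP n) => [->|n0]; first by rewrite ln0// lnn_ge0.
  by rewrite ler_ln ?posrE ?ltr0n ?(leq_trans n0)// ?ler_nat ltnW.
by move=> k _; rewrite natrB// opprB addrC subrK.
Qed.

(** An off-diagonal pair contributes at most 2/(sqrt(mn) |ln(m/n)|), which is at most 1/m + 1/n +
    2/|m - n|. Each piece sums to a multiple of M (1 + ln M), in total 6 of them, so no Hilbert-type
    inequality is required. *)
Lemma isint_zpoly_sq T M : 0 < T -> (0 < M)%N ->
  exists v, isint T (fun t => normc (zpoly M t) ^+ 2) v /\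
    v <= (T + 6 * M%:R) * (1 + ln (M%:R : R)).
Proof.
move=> T0 M0.
pose C (ij : 'I_M * 'I_M) : R := dc ij.1 * dc ij.2.
pose O (ij : 'I_M * 'I_M) : R := dom ij.1 + - dom ij.2.
pose B (ij : 'I_M * 'I_M) : R := if ij.1 == ij.2 then T / ij.1.+1%:R else
  ((ij.1.+1%:R)^-1 + (ij.2.+1%:R)^-1) + 2 / `|ij.1%:R - ij.2%:R|.
have HB ij : exists v, isint T (fun t => C ij * cos (O ij * t)) v /\ v <= B ij.
  case: ij => i j; rewrite /C /O /B/=; case: eqVneq => [->|ij].
    exists (dc j * dc j * T); split.
      by apply: isint_ext (isint_cst T (dc j * dc j)) => t; rewrite subrr mul0r cos0 mulr1.
    by rewrite mulrC /dc -invfM -expr2 sqr_sqrtr.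
  have n0 : 0 < i.+1%:R :> R by rewrite ltr0n.
  have m0 : 0 < j.+1%:R :> R by rewrite ltr0n.
  have on0 : dom i - dom j != 0.
    rewrite /dom opprK addrC subr_eq0; apply: contra ij => /eqP/ln_inj.
    rewrite !posrE => /(_ m0 n0)/eqP; rewrite eqr_nat eqSS => /eqP e.
    by apply/eqP/val_inj.
  have [v [hv v1]] := isint_cos on0 T0.
  exists (dc i * dc j * v); split; first exact: isintZ.
  apply: (@le_trans _ _ (dc i * dc j * (2 / `|dom i - dom j|))).
    rewrite ler_wpM2l// ?mulr_ge0 ?(ltW (dc_gt0 _))//.
    exact: le_trans (ler_norm _) v1.
  rewrite /dom opprK addrC.
  wlog ltij : i j ij n0 m0 {on0 v hv v1} / (i < j)%N => [H|].
    have [l|l|e] := ltngtP i j; first exact: H.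
      rewrite (mulrC (dc i)) distrC [X in X + _ / _]addrC [X in _ + _ / X]distrC.
      by apply: H => //; rewrite eq_sym.
    by move: ij; rewrite (val_inj e) eqxx.
  have d0 : 0 < j%:R - i%:R :> R by rewrite subr_gt0 ltr_nat.
  have lnd : (j%:R - i%:R) / j.+1%:R <= ln (j.+1%:R : R) - ln (i.+1%:R : R).
    rewrite -[leRHS]opprB lerNr -ln_div ?posrE//.
    rewrite (_ : i.+1%:R / j.+1%:R = 1 + - ((j%:R - i%:R) / j.+1%:R)); last first.
      move: n0 m0; rewrite -!natr1 => n0 m0; field; rewrite gt_eqF//.
    apply: le_ln1Dx; rewrite ltrN2 ltr_pdivrMr// mul1r -natr1.
    have := ler0n R i; lra.
  have lnd0 : 0 < ln (j.+1%:R : R) - ln (i.+1%:R : R).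
    by apply: lt_le_trans lnd; rewrite divr_gt0.
  rewrite (ger0_norm (ltW lnd0)) distrC (ger0_norm (ltW d0)).
  have h1 : 2 / (ln (j.+1%:R : R) - ln (i.+1%:R : R)) <= 2 / ((j%:R - i%:R) / j.+1%:R).
    by rewrite ler_wpM2l// lef_pV2 ?posrE// divr_gt0.
  apply: le_trans (ler_wpM2l (mulr_ge0 (ltW (dc_gt0 i)) (ltW (dc_gt0 j))) h1) _.
  rewrite /dc; set a := Num.sqrt i.+1%:R; set b := Num.sqrt j.+1%:R.
  have a0 : 0 < a by rewrite sqrtr_gt0.
  have b0 : 0 < b by rewrite sqrtr_gt0.
  have ea : i.+1%:R = a ^+ 2 by rewrite sqr_sqrtr.
  have eb : j.+1%:R = b ^+ 2 by rewrite sqr_sqrtr.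
  have ed : j%:R - i%:R = b ^+ 2 - a ^+ 2 by rewrite -ea -eb -!natr1; ring.
  rewrite ed in d0 *; rewrite ea eb.
  have ab : a < b by rewrite -(@ltr_pXn2r _ 2) ?nnegrE ?(ltW a0) ?(ltW b0)// -subr_gt0.
  (* With a^2 and b^2 the two integers, the excess of 1/a^2 + 1/b^2 + 2/(b^2 - a^2) over the
     off-diagonal bound is visibly nonnegative in this form. *)
  rewrite -subr_ge0 (_ : _ - _ = (a - b) ^+ 2 / (a * b) ^+ 2 + 2 * (1 - a / b) / (b ^+ 2 - a ^+ 2)).
    apply: addr_ge0; first by rewrite divr_ge0 ?sqr_ge0.
    apply: divr_ge0; last exact: ltW.
    by rewrite mulr_ge0// subr_ge0 ler_pdivrMr// mul1r ltW.
  field; rewrite !gt_eqF//.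
have /choice[v hv] := HB.
exists (\sum_ij v ij); split.
  apply: isint_ext (isint_sum (index_enum _) (P := predT) (fun ij _ => (hv ij).1)) => t.
  have := mul_cconj (zpoly M t); rewrite zpolyE cconj_csum csumM => /(congr1 (fun z : R[i] => Re z)).
  by rewrite Re_csum/= -zpolyE => <-.
apply: (@le_trans _ _ (\sum_ij B ij)); first by apply: ler_sum => ij _; exact: (hv ij).2.
set H := 1 + ln (M%:R : R).
have H0 : 0 <= H by rewrite addr_ge0// lnn_ge0.
have HM : \sum_(i < M) (i.+1%:R)^-1 <= H by rewrite -(big_mkord xpredT (fun k => (k.+1%:R)^-1 : R)) harm_le.
apply: (@le_trans _ _ (\sum_(ij : 'I_M * 'I_M) ((if ij.1 == ij.2 then T / ij.1.+1%:R else 0) +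
   ((ij.1.+1%:R)^-1 + (ij.2.+1%:R)^-1) +
   2 * ((if (ij.2 < ij.1)%N then (ij.1%:R - ij.2%:R)^-1 else 0) +
        (if (ij.1 < ij.2)%N then (ij.2%:R - ij.1%:R)^-1 else 0))))).
  apply: ler_sum => -[i j] _; rewrite /B/=; case: eqVneq => [->|ij].
    by rewrite ltnn addr0 mulr0 addr0 lerDl addr_ge0// invr_ge0.
  rewrite add0r lerD2l ler_wpM2l//.
  have [l|l|e] := ltngtP i j; last by move: ij; rewrite (val_inj e) eqxx.
    by rewrite add0r distrC ger0_norm// subr_ge0 ler_nat ltnW.
  by rewrite addr0 ger0_norm// subr_ge0 ler_nat ltnW.
rewrite big_split big_split/= -mulr_sumr !big_split/=.
have P (F : 'I_M -> 'I_M -> R) : \sum_(ij : 'I_M * 'I_M) F ij.1 ij.2 = \sum_i \sum_j F i j.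
  by rewrite pair_bigA.
rewrite (P (fun i j => if i == j then T / i.+1%:R else 0)) (P (fun i j => (i.+1%:R)^-1)).
rewrite (P (fun i j => (j.+1%:R)^-1)) (P (fun i j => if (j < i)%N then (i%:R - j%:R)^-1 else 0)).
rewrite (P (fun i j => if (i < j)%N then (j%:R - i%:R)^-1 else 0)).
have S1 : \sum_(i < M) \sum_(j < M) (if i == j then T / i.+1%:R else 0) <= T * H.
  rewrite (eq_bigr (fun i : 'I_M => T * (i.+1%:R)^-1)).
    by rewrite -mulr_sumr ler_wpM2l// ltW.
  by move=> i _; rewrite -big_mkcond (big_pred1 i).
have S2 : \sum_(i < M) \sum_(j < M) (i.+1%:R)^-1 <= M%:R * H :> R.
  rewrite exchange_big/=; apply: le_trans (ler_sum _ (fun i _ => HM)) _.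
  by rewrite sumr_const card_ord mulr_natl.
have S3 : \sum_(i < M) \sum_(j < M) (j.+1%:R)^-1 <= M%:R * H :> R.
  by rewrite exchange_big.
have S4 : \sum_(i < M) \sum_(j < M) (if (j < i)%N then (i%:R - j%:R)^-1 else 0) <= M%:R * H :> R.
  apply: (@le_trans _ _ (\sum_(i < M) H)); last by rewrite sumr_const card_ord mulr_natl.
  by apply: ler_sum => i _; rewrite -big_mkcond; exact: sum_diff_le.
have S5 : \sum_(i < M) \sum_(j < M) (if (i < j)%N then (j%:R - i%:R)^-1 else 0) <= M%:R * H :> R.
  by rewrite exchange_big.
lra.
Qed.
End TrigSums.

(** * Smoothed moments: diagonal main terms and off-diagonal errors *)

Section TwistedMoments.
Variable R : realType.
Implicit Types (t x y T N : R) (J M : nat).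

Definition dpoly (I : finType) (c : I -> R) (a : I -> nat) t : R[i] :=
  csum c (fun i => - ln ((a i)%:R : R)) t.

(** The factor by which [isint_win_sum] multiplies the total coefficient mass when nonzero
    frequencies are at least 1/(2N). *)
Definition offdiag J N T : R := (32 * J%:R * N / T) ^+ J.*2 * (4 * N).

Lemma ln_eq_nat (a b : nat) : (0 < a)%N -> (0 < b)%N ->
  (ln (a%:R : R) - ln (b%:R : R) == 0) = (a == b).
Proof.
move=> a0 b0; rewrite subr_eq0; apply/eqP/eqP => [|->//].
by move/ln_inj; rewrite !posrE !ltr0n => /(_ a0 b0)/eqP; rewrite eqr_nat => /eqP.
Qed.

(** A bound on the smaller side suffices: if a <= 2N this is the usual spacing of logarithms, and if
    a > 2N then a/b > 2 and the gap is at least 1/2. This lets the zeta polynomial be longer than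
    T. *)
Lemma ln_sep2 (a b : nat) N : (0 < a)%N -> (0 < b)%N -> a != b -> b%:R <= N ->
  (2 * N)^-1 <= `|ln (b%:R : R) - ln (a%:R : R)|.
Proof.
move=> a0 b0 ab bN.
have b1 : 1 <= b%:R :> R by rewrite ler1n.
have [aN|aN] := lerP a%:R (2 * N).
  by apply: ln_sep => //; [rewrite eq_sym|lra].
apply: (@le_trans _ _ (2^-1)).
  by rewrite lef_pV2 ?posrE; lra.
rewrite distrC; apply: le_trans (ler_norm _).
have a0' : 0 < a%:R :> R by rewrite ltr0n.
have b0' : 0 < b%:R :> R by rewrite ltr0n.
rewrite -[leRHS]opprB lerNr -ln_div ?posrE//.
apply: (@le_trans _ _ (ln (1 + - 2^-1))); last by apply: le_ln1Dx; lra.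
rewrite ler_ln ?posrE ?divr_gt0//; last lra.
rewrite ler_pdivrMr//; lra.
Qed.

Lemma isint_pair (I K : finType) (c : I -> R) (d : K -> R) (a : I -> nat) (b : K -> nat)
    N J T : 0 < T -> 0 < N -> 32 * J%:R * N < T ->
  (forall i, 0 <= c i) -> (forall k, 0 <= d k) ->
  (forall i, c i != 0 -> (0 < a i)%N /\ (a i)%:R <= N) ->
  (forall k, d k != 0 -> (0 < b k)%N /\ (b k)%:R <= N) ->
  exists v, isint T (fun t => win T J t * Re (dpoly c a t * cconj (dpoly d b t))) v /\
   `|v - winc R J * T * \sum_i \sum_(k | a i == b k) c i * d k| <=
    offdiag J N T * ((\sum_i c i) * (\sum_k d k)).
Proof.
move=> T0 N0 JN c0 d0 aN bN.
have N20 : 0 < 2 * N by rewrite mulr_gt0.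
pose C (ik : I * K) := c ik.1 * d ik.2.
pose O (ik : I * K) := - ln ((a ik.1)%:R : R) + - - ln ((b ik.2)%:R : R).
have C0 ik : 0 <= C ik by exact: mulr_ge0.
have OE ik : C ik != 0 -> [/\ (0 < a ik.1)%N, (0 < b ik.2)%N, (b ik.2)%:R <= N &
    O ik = ln ((b ik.2)%:R : R) - ln ((a ik.1)%:R : R)].
  rewrite mulf_eq0 negb_or => /andP[/aN [a0 _] /bN [b0 bN']]; split => //.
  by rewrite /O opprK addrC.
have [||v [hv v1]] := @isint_win_sum R T J (2 * N) _ C O T0 N20 _ C0.
- by rewrite (_ : _ * (2 * N) = 32 * J%:R * N)//; ring.
- move=> ik /OE[a0 b0 bN' ->].
  have [ab|ab] := eqVneq (a ik.1) (b ik.2); first by left; rewrite ab subrr.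
  by right; exact: ln_sep2.
exists v; split.
  apply: isint_ext hv => t; rewrite /dpoly cconj_csum csumM Re_csum//.
have -> : \sum_i \sum_(k | a i == b k) c i * d k = \sum_(ik | O ik == 0) C ik.
  rewrite [RHS]big_mkcond/=.
  under eq_bigr do rewrite big_mkcond.
  rewrite pair_bigA/=; apply: eq_bigr => ik _.
  have [Cz|Cnz] := eqVneq (C ik) 0.
    by rewrite -[c _ * d _]/(C ik) Cz !if_same.
  have [a0 b0 _ ->] := OE _ Cnz.
  by rewrite ln_eq_nat// eq_sym.
rewrite big_distrlr/= pair_bigA/=.
rewrite /offdiag (_ : 32 * _ * _ / T = 16 * J%:R * (2 * N) / T); last by ring.
by rewrite (_ : 4 * N = 2 * (2 * N))//; ring.
Qed.

(** The product (l+1)a may far exceed N, yet [ln_sep2] separates it from b. The zeta coefficients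
    are at most 1, whence the factor M in the error. *)
Lemma isint_triple (I K : finType) (c : I -> R) (d : K -> R) (a : I -> nat) (b : K -> nat)
    N J T M : 0 < T -> 0 < N -> 32 * J%:R * N < T ->
  (forall i, 0 <= c i) -> (forall k, 0 <= d k) ->
  (forall i, c i != 0 -> (0 < a i)%N) ->
  (forall k, d k != 0 -> (0 < b k)%N /\ (b k)%:R <= N) ->
  exists v, isint T (fun t => win T J t *
       Re (zpoly M t * (dpoly c a t * cconj (dpoly d b t)))) v /\
   winc R J * T * \sum_i \sum_k \sum_(l < M | (l.+1 * a i)%N == b k)
        (Num.sqrt l.+1%:R)^-1 * (c i * d k)
   - offdiag J N T * (M%:R * ((\sum_i c i) * (\sum_k d k))) <= v.
Proof.
move=> T0 N0 JN c0 d0 aN bN.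
have N20 : 0 < 2 * N by rewrite mulr_gt0.
pose dc (l : 'I_M) : R := (Num.sqrt l.+1%:R)^-1.
pose C (q : 'I_M * (I * K)) := dc q.1 * (c q.2.1 * d q.2.2).
pose O (q : 'I_M * (I * K)) := - ln (q.1.+1%:R : R) +
   (- ln ((a q.2.1)%:R : R) + - - ln ((b q.2.2)%:R : R)).
have dc0 l : 0 <= dc l by rewrite invr_ge0 sqrtr_ge0.
have C0 q : 0 <= C q by rewrite mulr_ge0// mulr_ge0.
have OE q : C q != 0 -> [/\ (0 < q.1.+1 * a q.2.1)%N, (0 < b q.2.2)%N, (b q.2.2)%:R <= N &
    O q = ln ((b q.2.2)%:R : R) - ln ((q.1.+1 * a q.2.1)%N%:R : R)].
  rewrite 2!mulf_eq0 !negb_or => /andP[_ /andP[/aN a0 /bN [b0 bN']]].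
  split => //; first by rewrite muln_gt0.
  rewrite /O natrM lnM ?posrE ?ltr0n//; ring.
have [||v [hv v1]] := @isint_win_sum R T J (2 * N) _ C O T0 N20 _ C0.
- by rewrite (_ : _ * (2 * N) = 32 * J%:R * N)//; ring.
- move=> q /OE[a0 b0 bN' ->].
  have [ab|ab] := eqVneq (q.1.+1 * a q.2.1)%N (b q.2.2); first by left; rewrite ab subrr.
  by right; exact: ln_sep2.
exists v; split.
  apply: isint_ext hv => t; rewrite /dpoly zpolyE cconj_csum !csumM Re_csum//.
have -> : \sum_i \sum_k \sum_(l < M | (l.+1 * a i)%N == b k)
        (Num.sqrt l.+1%:R)^-1 * (c i * d k) = \sum_(q | O q == 0) C q.
  rewrite [RHS]big_mkcond/=.
  under eq_bigr do under eq_bigr do rewrite big_mkcond.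
  rewrite pair_bigA/= exchange_big/= pair_bigA/=; apply: eq_bigr => q _.
  have [Cz|Cnz] := eqVneq (C q) 0.
    by rewrite -[_ * (_ * _)]/(C q) Cz !if_same.
  have [a0 b0 _ ->] := OE _ Cnz.
  by rewrite ln_eq_nat// eq_sym.
move: v1; rewrite ler_norml => /andP[v1 _].
have SC : \sum_q C q <= M%:R * ((\sum_i c i) * (\sum_k d k)).
  rewrite big_distrlr/= pair_bigA/= -(pair_bigA _ (fun l ik => dc l * (c ik.1 * d ik.2)))/=.
  rewrite -big_distrlr/= ler_wpM2r//.
    by apply: sumr_ge0 => ik _; rewrite mulr_ge0.
  apply: (@le_trans _ _ (\sum_(l < M) 1)); last by rewrite sumr_const card_ord.
  apply: ler_sum => l _; rewrite /dc invf_le1 ?sqrtr_gt0 ?ltr0n//.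
  by rewrite -[leLHS]sqrtr1 ler_wsqrtr// ler1n.
have E0 : 0 <= offdiag J N T.
  by rewrite mulr_ge0 ?exprn_ge0 ?mulr_ge0 ?divr_ge0 ?invr_ge0 ?(ltW N0) ?(ltW T0).
have := ler_wpM2l E0 SC.
have -> : offdiag J N T = (16 * J%:R * (2 * N) / T) ^+ J.*2 * (2 * (2 * N)).
  rewrite /offdiag (_ : 32 * _ * _ / T = 16 * J%:R * (2 * N) / T); last by ring.
  by rewrite (_ : 4 * N = 2 * (2 * N))//; ring.
lra.
Qed.
End TwistedMoments.

(** * The multiplicative resonator *)

Section Resonator.
Variable R : realType.
Implicit Types (t x y T N : R) (J M : nat).

Lemma prodD_subset (I : finType) (F G : I -> R) (B : {set I}) :
  \prod_(i in B) (F i + G i) =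
  \sum_(A : {set I} | A \subset B) (\prod_(i in A) F i) * \prod_(i in B :\: A) G i.
Proof.
pose F' i := if i \in B then F i else 0.
pose G' i := if i \in B then G i else 1.
transitivity (\prod_i (F' i + G' i)).
  rewrite big_mkcond/=; apply: eq_bigr => i _; rewrite /F' /G'; case: ifP => //.
  by rewrite add0r.
rewrite bigA_distr [RHS]big_mkcond/=; apply: eq_bigr => A _.
case: ifPn => [AB|/fintype.subsetPn[i iA iB]].
  rewrite [X in X * _]big_mkcond [X in _ * X]big_mkcond -big_split/=.
  apply: eq_bigr => i _; rewrite inE /F' /G'; case: ifPn => iA.
    by rewrite (fintype.subsetP AB) //= mulr1.
  by rewrite mul1r.
by rewrite (bigD1 i)//= iA /F' (negbTE iB) mul0r.
Qed.

Lemma prod1D_sets (I : finType) (F : I -> R) :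
  \prod_i (1 + F i) = \sum_(A : {set I}) \prod_(i in A) F i.
Proof.
rewrite (eq_bigr (fun i => F i + 1)); last by move=> i _; rewrite addrC.
rewrite bigA_distr; apply: eq_bigr => A _.
by rewrite [RHS]big_mkcond.
Qed.

(** Cauchy-Schwarz on the support, from c_i c_j <= c_i^2/2 + c_j^2/2. *)
Lemma sqr_sum_le (I : finType) (c : I -> R) (S : {set I}) :
  (forall i, i \notin S -> c i = 0) ->
  (\sum_i c i) ^+ 2 <= #|S|%:R * \sum_i c i ^+ 2.
Proof.
move=> cS.
have e (G : I -> R) : (forall i, i \notin S -> G i = 0) -> \sum_i G i = \sum_(i in S) G i.
  move=> G0; rewrite [RHS]big_mkcond; apply: eq_bigr => i _; case: ifPn => // /G0//.
rewrite (e c)// (e (fun i => c i ^+ 2)); last by move=> i /cS ->; rewrite expr0n.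
rewrite expr2 big_distrlr/=.
apply: (@le_trans _ _ (\sum_(i in S) \sum_(j in S) (c i ^+ 2 / 2 + c j ^+ 2 / 2))).
  apply: ler_sum => i _; apply: ler_sum => j _.
  have := sqr_ge0 (c i - c j); rewrite !expr2; lra.
rewrite (eq_bigr (fun i => #|S|%:R * (c i ^+ 2 / 2) + (\sum_(j in S) c j ^+ 2) / 2)).
  rewrite big_split/= sumr_const -mulr_sumr -!mulr_suml -mulr_natl; lra.
by move=> i _; rewrite big_split/= sumr_const -mulr_suml mulr_natl.
Qed.

Variables (P : finType) (pr : P -> nat).
Hypothesis pr_prime : forall p, prime (pr p).
Hypothesis pr_inj : injective pr.

Definition nset (A : {set P}) : nat := \prod_(p in A) pr p.

Lemma nset_gt0 A : (0 < nset A)%N.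
Proof. by rewrite prodn_gt0// => p; rewrite prime_gt0. Qed.

Lemma dvd_nset p A : (pr p %| nset A)%N = (p \in A).
Proof.
apply/idP/idP => [|pA]; last by rewrite /nset (bigD1 p)//= dvdn_mulr.
rewrite /nset big_seq_cond; elim/big_ind : _ => //.
- by rewrite dvdn1 => /eqP e; have := pr_prime p; rewrite e.
- by move=> x y hx hy; rewrite Euclid_dvdM// => /orP[/hx|/hy].
- move=> q /andP[_ qA]; rewrite dvdn_prime2// => /eqP/pr_inj -> //.
Qed.

Lemma nset_inj : injective nset.
Proof. by move=> A B e; apply/finset.setP => p; rewrite -!dvd_nset e. Qed.

Lemma nset_setD (A B : {set P}) : A \subset B -> (nset (B :\: A) * nset A)%N = nset B.
Proof.
move=> AB; rewrite /nset [RHS](big_setID A)/= mulnC; congr (_ * _)%N.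
by apply: eq_bigl => p; rewrite inE; case: (boolP (p \in A)) => [/(fintype.subsetP AB) ->|]; rewrite ?andbF.
Qed.

Variable f : P -> R.
Hypothesis f0 : forall p, 0 <= f p.
Variable N : R.
Hypothesis N1 : 1 <= N.

Let c (A : {set P}) : R := if (nset A)%:R <= N then \prod_(p in A) f p else 0.
(** The local term of the twisted moment: a prime of the longer product occurs in both resonators,
    giving f^2, or in one of them with zeta supplying it, giving f / sqrt p. *)
Let g p := f p ^+ 2 + f p / Num.sqrt (pr p)%:R.

Let g0 p : 0 <= g p.
Proof. by rewrite addr_ge0 ?sqr_ge0// divr_ge0// sqrtr_ge0. Qed.

Let N0 : 0 < N. Proof. exact: lt_le_trans ltr01 N1. Qed.

Lemma c_ge0 A : 0 <= c A.
Proof. by rewrite /c; case: ifP => // _; apply: prodr_ge0. Qed.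

Lemma c_supp A : c A != 0 -> (0 < nset A)%N /\ (nset A)%:R <= N.
Proof. by rewrite /c nset_gt0; case: ifP => //; rewrite eqxx. Qed.

Lemma sum_c2_le : \sum_A c A ^+ 2 <= \prod_p (1 + f p ^+ 2).
Proof.
rewrite prod1D_sets; apply: ler_sum => A _; rewrite /c; case: ifP => _.
  by rewrite -prodrXl.
by rewrite expr0n/=; apply: prodr_ge0 => p _; exact: sqr_ge0.
Qed.

Lemma sum_c2_gt0 : 0 < \sum_A c A ^+ 2.
Proof.
rewrite (bigD1 finset.set0)//= ltr_wpDr ?sumr_ge0//.
  by move=> A _; exact: sqr_ge0.
by rewrite /c /nset !finset.big_set0 N1 expr1n.
Qed.

(** By unique factorization the support embeds in the positive integers up to N, so it has at most N
    elements. *)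
Lemma sqr_sum_c : (\sum_A c A) ^+ 2 <= N * \sum_A c A ^+ 2.
Proof.
pose S := [set A | (nset A)%:R <= N]%SET.
apply: le_trans (@sqr_sum_le _ c S _) _.
  by move=> A; rewrite inE /c => /negbTE ->.
apply: ler_wpM2r; first by apply: sumr_ge0 => A _; exact: sqr_ge0.
have /andP[t1 _] := truncn_itv (ltW N0).
apply: le_trans t1; rewrite ler_nat.
have tN A : A \in S -> (nset A <= Num.truncn N)%N.
  by rewrite inE => h; rewrite truncn_ge_nat// ltW.
have t0 : (0 < Num.truncn N)%N by rewrite truncn_gt0.
pose F A : 'I_(Num.truncn N).-1.+1 := inord (nset A).-1.
have FE A : A \in S -> F A = (nset A).-1 :> nat.
  move=> /tN h; rewrite /F inordK//; have := nset_gt0 A; lia.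
rewrite -(card_in_imset (f := F)); last first.
  move=> A B AS BS /(congr1 val)/=; rewrite !FE// => e; apply: nset_inj.
  have := nset_gt0 A; have := nset_gt0 B; lia.
by apply: leq_trans (max_card _) _; rewrite card_ord prednK.
Qed.

Lemma diag_sum : \sum_A \sum_(B | nset A == nset B) c A * c B = \sum_A c A ^+ 2.
Proof.
apply: eq_bigr => A _; rewrite (big_pred1 A) ?expr2// => B.
by rewrite (inj_eq nset_inj) eq_sym.
Qed.

(** For each B only the subsets A of B are kept, with zeta supplying [nset (B :\: A)]; summing over
    A gives the product of f (f + 1/sqrt p) over B. All other terms are nonnegative. *)
Lemma twisted_diag_ge M : N <= M%:R ->
  \sum_(B : {set P} | (nset B)%:R <= N) \prod_(p in B) g p <=
  \sum_A \sum_B \sum_(l < M | (l.+1 * nset A)%N == nset B)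
     (Num.sqrt l.+1%:R)^-1 * (c A * c B).
Proof.
move=> NM; rewrite exchange_big/= big_mkcond/=; apply: ler_sum => B _.
have t0 A (l : 'I_M) : 0 <= (Num.sqrt l.+1%:R)^-1 * (c A * c B).
  by rewrite mulr_ge0 ?invr_ge0 ?sqrtr_ge0// mulr_ge0// c_ge0.
case: ifPn => BN; last by apply: sumr_ge0 => A _; apply: sumr_ge0.
pose G p : R := (Num.sqrt (pr p)%:R)^-1.
have -> : \prod_(p in B) g p = \prod_(p in B) f p * \prod_(p in B) (f p + G p).
  by rewrite -big_split; apply: eq_bigr => p _; rewrite /g /G /=; ring.
rewrite prodD_subset mulr_sumr big_mkcond/=; apply: ler_sum => A _.
case: ifPn => AB; last by apply: sumr_ge0.
have nD := nset_setD AB.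
have D0 := nset_gt0 (B :\: A).
have AleB : (nset A <= nset B)%N by rewrite -nD leq_pmull.
have DleB : (nset (B :\: A) <= nset B)%N by rewrite -nD leq_pmulr// nset_gt0.
(* The index l starts at 0, hence the predecessor; the cofactor divides [nset B], so it is at most N
   <= M and occurs in the zeta polynomial. *)
have lM : ((nset (B :\: A)).-1 < M)%N.
  by rewrite prednK// -(ler_nat R); apply: le_trans NM; apply: le_trans BN; rewrite ler_nat.
rewrite (bigD1 (Ordinal lM))/= ?prednK ?nD//.
rewrite -[leLHS]addr0; apply: lerD; last by apply: sumr_ge0.
have -> : c A = \prod_(p in A) f p.
  by rewrite /c (le_trans _ BN)// ler_nat.
have -> : c B = \prod_(p in B) f p by rewrite /c BN.
have -> : (Num.sqrt (nset (B :\: A))%:R)^-1 = \prod_(p in B :\: A) G p.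
  rewrite /nset natr_prod /G; elim/big_rec2 : _ => [|p y1 y2 _ <-]; first by rewrite sqrtr1 invr1.
  by rewrite sqrtrM// invfM.
by apply: eq_ler; ring.
Qed.

(** On the discarded sets [nset B] > N, so (nset B / N)^alpha >= 1 may be inserted; the sum over all
    sets then factors over primes. *)
Lemma rankin (alpha : R) : 0 <= alpha ->
  \prod_p (1 + g p) - expR (- alpha * ln N) * \prod_p (1 + expR (alpha * ln (pr p)%:R) * g p)
  <= \sum_(B : {set P} | (nset B)%:R <= N) \prod_(p in B) g p.
Proof.
move=> a0; rewrite !prod1D_sets lerBlDr (bigID (fun B : {set P} => (nset B)%:R <= N))/=.
rewrite lerD2l mulr_sumr big_mkcond/=; apply: ler_sum => B _.
have gB : 0 <= \prod_(p in B) g p by apply: prodr_ge0.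
have -> : \prod_(p in B) (expR (alpha * ln (pr p)%:R) * g p) =
   expR (alpha * ln (nset B)%:R) * \prod_(p in B) g p.
  rewrite big_split/=; congr (_ * _); rewrite /nset.
  have [] : (0 < \prod_(p in B) pr p)%N /\ \prod_(p in B) expR (alpha * ln (pr p)%:R) =
      expR (alpha * ln (\prod_(p in B) pr p)%N%:R); last by [].
  apply: (big_ind2 (fun (x : R) (n : nat) => (0 < n)%N /\ x = expR (alpha * ln n%:R))).
  - by rewrite ln1 mulr0 expR0.
  - move=> x1 x2 y1 y2 [x20 ->] [y20 ->]; rewrite muln_gt0 x20 y20; split => //.
    by rewrite natrM lnM ?posrE ?ltr0n// mulrDr expRD.
  - by move=> p _; rewrite prime_gt0.
rewrite mulrA -expRD; case: ifPn => BN; last by rewrite mulr_ge0// expR_ge0.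
rewrite -[leLHS]mul1r ler_wpM2r// -[X in X <= _]expR0 ler_expR mulNr addrC -mulrBr mulr_ge0// subr_ge0.
by rewrite ler_ln ?posrE ?ltr0n ?nset_gt0//; apply: ltW; rewrite ltNge.
Qed.

(** If Re of the zeta polynomial stays below B, the twisted moment is at most B times the plain one.
    Each of the two errors is at most the plain diagonal, which turns B into 2B + 1. *)
Lemma resonance (alpha B T : R) J M : 0 < T -> 32 * J%:R * N < T -> N <= M%:R ->
  0 <= alpha -> 0 <= B ->
  offdiag J N T * (N * M%:R) <= winc R J * T ->
  (forall t, T <= t <= 2 * T -> Re (zpoly M t) <= B) ->
  \prod_p (1 + g p) - expR (- alpha * ln N) * \prod_p (1 + expR (alpha * ln (pr p)%:R) * g p)
   <= (2 * B + 1) * \prod_p (1 + f p ^+ 2).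
Proof.
move=> T0 JN NM a0 B0 err ub.
have [v1 [h1]] := isint_pair T0 N0 JN c_ge0 c_ge0 c_supp c_supp.
have [v2 [h2]] := @isint_triple R _ _ c c nset nset N J T M T0 N0 JN c_ge0 c_ge0
   (fun A h => (c_supp h).1) c_supp.
rewrite diag_sum -expr2; set Q := \sum_A c A ^+ 2; set S := \sum_A c A.
set D := \sum_A \sum_B _; set E := offdiag J N T; set w := winc R J => e2 e1.
have Q0 : 0 < Q := sum_c2_gt0.
have SQ : S ^+ 2 <= N * Q := sqr_sum_c.
have w0 : 0 < w := winc_gt0 R J.
have E0 : 0 <= E.
  by rewrite mulr_ge0 ?exprn_ge0 ?mulr_ge0 ?divr_ge0 ?invr_ge0 ?(ltW N0) ?(ltW T0).
have M1 : 1 <= M%:R :> R by exact: le_trans N1 NM.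
have v21 : v2 <= B * v1.
  apply: (isint_le T0 h2 (isintZ B h1)) => t tT.
  rewrite [leRHS]mulrCA; apply: ler_wpM2l; first exact: win_ge0.
  rewrite mul_cconj cReM/= mulr0 subr0; apply: ler_wpM2r; first exact: sqr_ge0.
  exact: ub.
have v1le : v1 <= w * T * Q + E * (N * Q).
  move: e1; rewrite ler_norml => /andP[_ e1].
  by have := ler_wpM2l E0 SQ; lra.
have SQM : E * (M%:R * S ^+ 2) <= E * (N * M%:R) * Q.
  rewrite -mulrA ler_wpM2l// (mulrC N) -mulrA ler_wpM2l//.
have ENQ : E * (N * Q) <= E * (N * M%:R) * Q.
  rewrite -mulrA ler_wpM2l// -mulrA ler_wpM2l// ?(ltW N0)//.
  by rewrite -[leLHS]mul1r ler_wpM2r// ltW.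
have errQ : E * (N * M%:R) * Q <= w * T * Q by rewrite ler_wpM2r// ltW.
have wT0 : 0 < w * T by rewrite mulr_gt0.
have DQ : w * T * D <= w * T * ((2 * B + 1) * Q).
  have : B * v1 <= B * (w * T * Q + w * T * Q) by rewrite ler_wpM2l//; lra.
  rewrite (_ : w * T * ((2 * B + 1) * Q) = B * (w * T * Q + w * T * Q) + w * T * Q); last by ring.
  lra.
rewrite ler_pM2l// in DQ.
apply: le_trans (rankin a0) _; apply: le_trans (twisted_diag_ge NM) _.
apply: le_trans DQ _; rewrite ler_wpM2l ?sum_c2_le//; lra.
Qed.
End Resonator.

Section PrimeIndex.
Variable R : realType.
Variables M N : nat.

Definition prime_pred : {pred 'I_N.+1} := [pred i : 'I_N.+1 | (M < i)%N && prime i].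
Definition prime_ind := {i : 'I_N.+1 | i \in prime_pred}.
Definition prime_val (p : prime_ind) : nat := val (val p).

Lemma prime_val_prime p : prime (prime_val p).
Proof. by have /andP[] := valP p. Qed.
Lemma prime_val_inj : injective prime_val.
Proof. by move=> p q /val_inj/val_inj. Qed.
Lemma prime_val_bounds p : (M < prime_val p <= N)%N.
Proof. by have /andP[Mi _] := valP p; rewrite /prime_val Mi -ltnS ltn_ord. Qed.

Lemma sum_prime_ind (F : nat -> R) : (M <= N)%N ->
  \sum_(p : prime_ind) F (prime_val p) =
  \sum_(M <= n < N) (if prime n.+1 then F n.+1 else 0).
Proof.
move=> MN.
rewrite -(big_sub prime_pred (fun i : 'I_N.+1 => F i)) big_mkcond/=.
transitivity (\sum_(0 <= i < N.+1) (if (M < i)%N && prime i then F i else 0)).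
  by rewrite big_mkord.
rewrite (@big_cat_nat _ _ _ M.+1)//= big_nat_cond big1 ?add0r.
  rewrite big_add1; apply: eq_big_nat => n /andP[Mn _].
  by rewrite ltnS Mn.
by move=> i /andP[/andP[_ iM] _]; rewrite ltnS in iM; rewrite ltnNge iM.
Qed.
End PrimeIndex.

(** * Comparison of the two Euler products *)

Section EulerRatio.
Variable R : realType.
Variables (P : finType) (pr : P -> nat) (L alpha u : R).
Hypothesis u1 : 1 <= u.
Hypothesis uL : 1 <= L.
Hypothesis prL : forall p, L ^+ 2 <= (pr p)%:R.
Hypothesis pru : forall p, 2 * u <= ln ((pr p)%:R : R).
Hypothesis alpha0 : 0 <= alpha.
Hypothesis pra : forall p, alpha * ln ((pr p)%:R : R) <= u^-1.

Definition reson p : R := L / (Num.sqrt (pr p)%:R * ln (pr p)%:R).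
Let f := reson.
Let g p := f p ^+ 2 + f p / Num.sqrt (pr p)%:R.
Let S1 := \sum_p ((pr p)%:R * ln ((pr p)%:R : R))^-1.
Let S2 := \sum_p ((pr p)%:R : R)^-1.

Let pr0 p : 0 < (pr p)%:R :> R.
Proof. by apply: lt_le_trans (prL p); rewrite exprn_gt0// (lt_le_trans ltr01 uL). Qed.
Let lp0 p : 0 < ln ((pr p)%:R : R).
Proof. by apply: lt_le_trans (pru p); have := u1; lra. Qed.
Let L0 : 0 < L. Proof. exact: lt_le_trans ltr01 uL. Qed.

Lemma reson_ge0 p : 0 <= f p.
Proof. by rewrite divr_ge0 ?(ltW L0)// mulr_ge0 ?sqrtr_ge0// ltW. Qed.

Lemma reson_sq p : f p ^+ 2 = L ^+ 2 / ((pr p)%:R * ln (pr p)%:R) / ln (pr p)%:R.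
Proof.
rewrite /f /reson expr_div_n exprMn sqr_sqrtr ?(ltW (pr0 p))//.
by field; rewrite !gt_eqF.
Qed.

Lemma reson_sqrt p : f p / Num.sqrt (pr p)%:R = L / ((pr p)%:R * ln (pr p)%:R).
Proof.
rewrite /f /reson; move: (ln _) (lp0 p) => l l0.
have s0 : 0 < Num.sqrt (pr p)%:R :> R by rewrite sqrtr_gt0.
move: (Num.sqrt _) s0 (@sqr_sqrtr _ (pr p)%:R (ltW (pr0 p))) => s s0 <-.
by field; rewrite !gt_eqF.
Qed.

Lemma gain_ge0 p : 0 <= g p.
Proof. by rewrite addr_ge0 ?sqr_ge0// divr_ge0 ?reson_ge0// sqrtr_ge0. Qed.

(** The cut-offs p >= L^2 and ln p >= 2u make each of the two summands at most 1/u, so the Euler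
    factors are 1 + O(1/u). *)
Lemma gain_le p : g p <= 2 / u.
Proof.
have u1' := u1; have u0 : 0 < u by lra.
have l0 := lp0 p; have lu := pru p; have pL := prL p.
have iu : 0 < u^-1 by rewrite invr_gt0.
have e1 : L ^+ 2 / ((pr p)%:R * ln (pr p)%:R) <= (ln ((pr p)%:R : R))^-1.
  by rewrite ler_pdivrMr ?mulr_gt0// mulrCA mulVf ?gt_eqF// mulr1.
have e2 : (ln ((pr p)%:R : R))^-1 <= u^-1.
  by rewrite lef_pV2 ?posrE//; lra.
have e3 : f p ^+ 2 <= u^-1.
  rewrite reson_sq; apply: (@le_trans _ _ (u^-1 * 1)); last by rewrite mulr1.
  apply: ler_pM; rewrite ?invr_ge0 ?(ltW l0)//.
  - by rewrite divr_ge0 ?sqr_ge0// mulr_ge0// ltW.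
  - exact: le_trans e1 e2.
  - by rewrite invf_le1//; lra.
have e4 : f p / Num.sqrt (pr p)%:R <= u^-1.
  rewrite reson_sqrt; apply: le_trans (le_trans e1 e2).
  rewrite ler_wpM2r//; first by rewrite invr_ge0 mulr_ge0// ltW.
  by rewrite expr2 ler_peMr// ltW.
rewrite /g; lra.
Qed.

Lemma expR_sub1_le (x : R) : 0 <= x -> expR x - 1 <= x * expR x.
Proof.
move=> x0; have := expR_ge1Dx (- x); rewrite expRN.
have := expR_gt0 x; move: (expR x) => e e0 h.
have : (1 + - x) * e <= e^-1 * e by rewrite ler_wpM2r// ltW.
rewrite mulVf ?gt_eqF//; lra.
Qed.

(** e^x - 1 <= x e^x with x = alpha ln p <= 1/u, and ln p times [g p] equals L^2/(p ln p) + L/p,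
    which produces S1 and S2. *)
Lemma gain_shift_le :
  \sum_p (expR (alpha * ln ((pr p)%:R : R)) - 1) * g p <=
  alpha * expR u^-1 * (L ^+ 2 * S1 + L * S2).
Proof.
rewrite /S1 /S2 2!mulr_sumr -big_split/= mulr_sumr; apply: ler_sum => p _.
have l0 := lp0 p; have p0 := pr0 p.
have -> : L ^+ 2 / ((pr p)%:R * ln ((pr p)%:R : R)) + L / (pr p)%:R = ln ((pr p)%:R : R) * g p.
  rewrite /g reson_sqrt reson_sq; move: (ln _) l0 => l l0.
  by field; rewrite !gt_eqF.
rewrite mulrA; apply: ler_wpM2r; first exact: gain_ge0.
apply: le_trans (expR_sub1_le _) _; first by rewrite mulr_ge0// ltW.
rewrite mulrAC; apply: ler_wpM2r; first exact: ltW.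
by apply: ler_wpM2l => //; rewrite ler_expR.
Qed.

Lemma prod_shift_le :
  \prod_p (1 + expR (alpha * ln ((pr p)%:R : R)) * g p) <=
  expR (alpha * expR u^-1 * (L ^+ 2 * S1 + L * S2)) * \prod_p (1 + g p).
Proof.
apply: (@le_trans _ _ (\prod_p (expR ((expR (alpha * ln ((pr p)%:R : R)) - 1) * g p) * (1 + g p)))).
  apply: ler_prod => p _; rewrite addr_ge0 ?mulr_ge0 ?expR_ge0 ?gain_ge0//=.
  have g0 := gain_ge0 p.
  have x0 : 0 <= (expR (alpha * ln ((pr p)%:R : R)) - 1) * g p.
    by rewrite mulr_ge0// subr_ge0 -[leLHS]expR0 ler_expR mulr_ge0// ltW.
  have := expR_ge1Dx ((expR (alpha * ln ((pr p)%:R : R)) - 1) * g p).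
  move: x0; move: (expR (alpha * _)) => e x0 h.
  apply: (@le_trans _ _ ((1 + (e - 1) * g p) * (1 + g p))); last by rewrite ler_wpM2r//; lra.
  have := mulr_ge0 x0 g0; lra.
rewrite big_split/=; apply: ler_wpM2r.
  by apply: prodr_ge0 => p _; have := gain_ge0 p; lra.
by rewrite -expR_sum ler_expR; exact: gain_shift_le.
Qed.

(** With a = f^2 and b = f / sqrt p, the quotient (1+a)/(1+a+b) = 1 - b/(1+a+b) is at most
    exp(-b/(1+a+b)), and 1+a+b <= 1 + 2/u. *)
Lemma prod_ratio_ge :
  expR (L * S1 / (1 + 2 / u)) * \prod_p (1 + f p ^+ 2) <= \prod_p (1 + g p).
Proof.
have u1' := u1; have u0 : 0 < u by lra.
have iu : 0 < u^-1 by rewrite invr_gt0.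
rewrite /S1 mulrAC mulr_sumr expR_sum -big_split/=; apply: ler_prod => p _.
have f2 := sqr_ge0 (f p); have gu := gain_le p.
rewrite mulr_ge0 ?expR_ge0//=; last by lra.
have h0 : 0 <= f p / Num.sqrt (pr p)%:R by rewrite divr_ge0 ?reson_ge0// sqrtr_ge0.
apply: (@le_trans _ _ (expR ((f p / Num.sqrt (pr p)%:R) / (1 + g p)) * (1 + f p ^+ 2))).
  apply: ler_wpM2r; first lra.
  rewrite ler_expR reson_sqrt mulrAC; apply: ler_wpM2l; first by rewrite -reson_sqrt.
  by rewrite lef_pV2 ?posrE; have := gain_ge0 p; lra.
move: gu h0; rewrite /g; move: (f p ^+ 2) (f p / _) f2 => a b a0 gu b0.
have ab0 : 0 < 1 + (a + b) by lra.
have := expR_ge1Dx (- (b / (1 + (a + b)))); rewrite expRN.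
have := expR_gt0 (b / (1 + (a + b))); move: (expR _) => e e0 h.
have h2 : (1 + a) / (1 + (a + b)) <= e^-1.
  by apply: le_trans h; apply: eq_ler; field; rewrite gt_eqF.
rewrite ler_pdivrMr// mulrC -ler_pdivrMr ?invr_gt0// invrK in h2.
by rewrite mulrC.
Qed.

(** The hypothesis makes Rankin's tail at most e^(-1), hence at most half, of the full Euler
    product. *)
Lemma resonance_gain (nu : R) :
  - alpha * nu + alpha * expR u^-1 * (L ^+ 2 * S1 + L * S2) <= -1 ->
  2^-1 * expR (L * S1 / (1 + 2 / u)) * \prod_p (1 + f p ^+ 2) <=
  \prod_p (1 + g p) - expR (- alpha * nu) * \prod_p (1 + expR (alpha * ln ((pr p)%:R : R)) * g p).
Proof.
move=> h.
have P0 : 0 <= \prod_p (1 + g p) by apply: prodr_ge0 => p _; have := gain_ge0 p; lra.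
have h1 : expR (- alpha * nu) * \prod_p (1 + expR (alpha * ln ((pr p)%:R : R)) * g p) <=
    2^-1 * \prod_p (1 + g p).
  apply: le_trans (ler_wpM2l (expR_ge0 _) prod_shift_le) _.
  rewrite mulrA -expRD; apply: ler_wpM2r => //.
  apply: (@le_trans _ _ (expR (-1))); first by rewrite ler_expR.
  rewrite expRN lef_pV2 ?posrE ?expR_gt0//; first by have := expR_ge1Dx (1 : R); lra.
have := prod_ratio_ge; lra.
Qed.
End EulerRatio.

(** * Statements valid for all large arguments *)

Section Near.
Variable R : realType.
Implicit Types (P : R -> Prop) (x K : R).

Lemma near_pinftyP P : (exists K, forall x, K <= x -> P x) <-> \forall x \near +oo, P x.
Proof.
split=> [[K HK]|].
  by near=> x; apply: HK; near: x; apply: nbhs_pinfty_ge; exact: num_real.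
move=> [K [_ HK]]; exists (K + 1) => x Kx; apply: HK; lra.
Unshelve. all: by end_near. Qed.

Lemma near_ln P : (\forall x \near +oo, P x) -> \forall x \near +oo, P (ln x).
Proof.
move=> /near_pinftyP[K HK]; apply/near_pinftyP; exists (expR K) => x Kx; apply: HK.
by rewrite -[leLHS]expRK ler_ln ?posrE ?expR_gt0// (lt_le_trans (expR_gt0 K)).
Qed.

Lemma near_mull P (c : R) : 0 < c -> (\forall x \near +oo, P x) -> \forall x \near +oo, P (c * x).
Proof.
move=> c0 /near_pinftyP[K HK]; apply/near_pinftyP; exists (c^-1 * K) => x Kx; apply: HK.
by rewrite -ler_pdivrMl.
Qed.

Lemma near_ge K : \forall x \near +oo, K <= x.
Proof. by apply/near_pinftyP; exists K. Qed.

Lemma near_ln_pow (k : nat) (d : R) : 0 < d -> \forall x \near +oo, ln x ^+ k <= d * x.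
Proof.
move=> d0; apply/near_pinftyP.
have F0 : 0 < (k.+1)`!%:R / d by rewrite divr_gt0// ltr0n fact_gt0.
exists (expR ((k.+1)`!%:R / d)) => x Kx.
have x0 : 0 < x by apply: lt_le_trans Kx; exact: expR_gt0.
have y1 : (k.+1)`!%:R / d <= ln x by rewrite -[leLHS]expRK ler_ln ?posrE ?expR_gt0.
have y0 : 0 < ln x by exact: lt_le_trans y1.
have := @expR_ge1Dxn R (ln x) k (ltW y0); rewrite lnK ?posrE// => h.
have f0 : 0 < (k.+1)`!%:R :> R by rewrite ltr0n fact_gt0.
have h2 : ln x ^+ k.+1 <= x * (k.+1)`!%:R.
  rewrite -ler_pdivrMr//; lra.
rewrite -(ler_pM2l y0) -exprS; apply: le_trans h2 _.
rewrite ler_pdivrMr// in y1; have := ler_wpM2r (ltW x0) y1; lra.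
Qed.
End Near.

(** * Asymptotics of the resonator's prime sums and of its gain *)

Section ResonatorAsymptotics.
Variable R : realType.
Implicit Types (e u T : R).

Lemma ln_trunc_ge (y : R) : 1 <= y -> y - 1 <= ln ((Num.truncn (expR y))%:R : R).
Proof.
move=> y1; have e2 : 2 <= expR y by have := expR_ge1Dx y; lra.
have /andP[_ h] := truncn_itv (expR_ge0 y).
have h2 : expR y / 2 <= (Num.truncn (expR y))%:R by move: h; rewrite -natr1; lra.
apply: le_trans (_ : ln (expR y / 2) <= _); last first.
  by rewrite ler_ln ?posrE ?divr_gt0 ?expR_gt0// (lt_le_trans _ h2)// divr_gt0 ?expR_gt0.
rewrite ln_div ?posrE ?expR_gt0// expRK; have := ln2_le1 R; lra.
Qed.

Lemma ln_trunc_le (y : R) : 0 <= y -> ln ((Num.truncn (expR y))%:R : R) <= y.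
Proof.
move=> y0; have /andP[h _] := truncn_itv (expR_ge0 y).
have t0 : (0 < Num.truncn (expR y))%N by rewrite truncn_gt0 -[leLHS]expR0 ler_expR.
by rewrite -[leRHS]expRK ler_ln ?posrE ?expR_gt0 ?ltr0n.
Qed.

Lemma ln_truncS_bounds (y : R) : 0 <= y ->
  y <= ln ((Num.truncn (expR y)).+1%:R : R) <= y + 1.
Proof.
move=> y0; have /andP[h h'] := truncn_itv (expR_ge0 y).
have e1 : 1 <= expR y by rewrite -[leLHS]expR0 ler_expR.
apply/andP; split.
  by rewrite -[leLHS]expRK ler_ln ?posrE ?expR_gt0 ?ltr0n// ltW.
apply: le_trans (_ : ln (expR y * 2) <= _).
  by rewrite ler_ln ?posrE ?mulr_gt0 ?expR_gt0 ?ltr0n// -natr1; lra.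
rewrite lnM ?posrE ?expR_gt0// expRK; have := ln2_le1 R; lra.
Qed.

Lemma shifted_inverses e u : 0 < e -> 20 <= u -> 20 <= e * u ->
  [/\ u^-1 / 2 - (u ^+ 2)^-1 / 4 <= (2 * u + 1)^-1,
      (u ^+ 2 - 1)^-1 <= 2 * (u ^+ 2)^-1,
      (2 * u - 1)^-1 <= u^-1 / 2 + (u ^+ 2)^-1 / 2,
      ((2 * u) ^+ 2)^-1 = (u ^+ 2)^-1 / 4 &
      20 * (u ^+ 2)^-1 <= e * u^-1].
Proof.
move=> e0 u20 ue; have u0 : 0 < u by apply: lt_le_trans u20; rewrite ltr0n.
have un0 : u != 0 by rewrite gt_eqF.
have u2 : 0 < u ^+ 2 by exact: exprn_gt0.
have p0 : 0 < 2 * u + 1 by clear - u0; lra.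
have m0 : 0 < 2 * u - 1 by clear - u20; lra.
have s0 : 2 <= u ^+ 2.
  by rewrite expr2; have := ler_wpM2l (ltW u0) u20; clear - u20; lra.
split.
- rewrite -subr_ge0 (_ : _ - _ = (4 * u ^+ 2 * (2 * u + 1))^-1).
    by rewrite invr_ge0; apply: mulr_ge0; [apply: mulr_ge0 => //|]; exact: ltW.
  by move: p0 un0; clear => p0 un0; field; rewrite un0 gt_eqF.
- have -> : 2 * (u ^+ 2)^-1 = (u ^+ 2 / 2)^-1 by rewrite invf_div.
  by rewrite lef_pV2 ?posrE; clear - s0; lra.
- rewrite -subr_ge0 (_ : _ - _ = (u - 1) / (2 * u ^+ 2 * (2 * u - 1))).
    apply: divr_ge0; first by clear - u20; lra.
    by apply: mulr_ge0; [apply: mulr_ge0 => //|]; exact: ltW.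
  by move: m0 un0; clear => m0 un0; field; rewrite un0 gt_eqF.
- by move: un0; clear => un0; field.
- rewrite (_ : e * u^-1 = e * u * (u ^+ 2)^-1).
    by rewrite ler_wpM2r// invr_ge0 ltW.
  by move: un0; clear => un0; field.
Qed.

(** The sum is 1/ln M - 1/ln N up to O(1/ln^2 M). With ln M near 2u and ln N near u^2, everything
    except 1/(2u) is O(1/u^2) and is absorbed once e u >= 20. *)
Lemma sum_recip_pln_asymp e : 0 < e -> e <= 1 -> forall u, 20 / e <= u ->
  let M := Num.truncn (expR (2 * u)) in let N := Num.truncn (expR (u ^+ 2)) in
  (1 < M <= N)%N /\
  (1 - e) / (2 * u) <=
  \sum_(M <= n < N) (if prime n.+1 then (n.+1%:R * ln (n.+1%:R : R))^-1 else 0)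
  <= (1 + e) / (2 * u).
Proof.
move=> e0 e1 u uK M N.
have u20 : 20 <= u by apply: le_trans uK; rewrite ler_pdivlMr//; clear - e1; lra.
have ue : 20 <= e * u by rewrite mulrC -ler_pdivrMr.
have u2 : 2 * u <= u ^+ 2 by rewrite expr2; clear - u20; nra.
have u3 : 4 <= u ^+ 2 by apply: le_trans u2; clear - u20; lra.
have MN : (1 < M <= N)%N.
  rewrite le_truncn ?ler_expR// andbT truncn_gt_nat.
  have := expR_ge1Dx (2 * u); clear - u20; lra.
split=> //.
have /andP[lo up] := sum_recip_pln_ge R MN.
have u0' : 0 <= 2 * u by clear - u20; lra.
have /andP[a1 a2] := ln_truncS_bounds u0'; rewrite -/M in a1 a2.
have b1 : 2 * u - 1 <= ln (M%:R : R) by apply: ln_trunc_ge; clear - u20; lra.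
have c1 : u ^+ 2 - 1 <= ln (N%:R : R) by apply: ln_trunc_ge; clear - u3; lra.
move: a1 a2 b1 c1 lo up; set S := \sum_(_ <= _ < _) _.
move: (ln M.+1%:R) (ln M%:R) (ln N%:R) S; clear M N MN => l m n S a1 a2 b1 c1.
have i1 : (2 * u + 1)^-1 <= l^-1 by rewrite lef_pV2 ?posrE; clear - a1 a2 u20; lra.
have i2 : n^-1 <= (u ^+ 2 - 1)^-1 by rewrite lef_pV2 ?posrE; clear - c1 u3; lra.
have i3 : (l ^+ 2)^-1 <= ((2 * u) ^+ 2)^-1.
  have l0 : 0 < l by clear - a1 u20; lra.
  have v0 : 0 < 2 * u by clear - u20; lra.
  by rewrite lef_pV2 ?posrE ?exprn_gt0// lerXn2r ?nnegrE// ltW.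
have i4 : m^-1 <= (2 * u - 1)^-1 by rewrite lef_pV2 ?posrE; clear - b1 u20; lra.
have [j1 j2 j3 j4 j5] := shifted_inverses e0 u20 ue.
have j6 x : x / (2 * u) = x * u^-1 / 2 by rewrite invfM mulrA mulrAC.
have w0 : 0 <= (u ^+ 2)^-1 by rewrite invr_ge0 sqr_ge0.
have v0 : 0 <= u^-1 by rewrite invr_ge0; clear - u20; lra.
rewrite j4 in i3; rewrite !j6 => lo up; clear - i1 i2 i3 i4 j1 j2 j3 j5 w0 v0 lo up.
by apply/andP; split; lra.
Qed.

(** Here alpha = u^(-3). The main term L^2 S1 is at most (1-e)(1+e) nu, a deficit of e^2 nu = 4 d
    nu. The factor exp(1/u) <= 1 + d and the term L S2 <= d nu consume half of it; the remaining 2 d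
    nu is at least u^3 = 1/alpha. *)
Lemma rankin_cond e d nu l u L S1 S2 : 0 < e -> e <= 8^-1 -> d = e ^+ 2 / 4 ->
  0 < nu -> 2 <= l -> l <= 2 * u -> u <= l -> 4 / d <= u ->
  0 <= L -> L ^+ 2 = (1 - e) * nu * l -> 0 <= S1 -> S1 <= (1 + e) / (2 * u) ->
  0 <= S2 -> S2 <= 1 + u ^+ 2 -> l ^+ 5 <= d ^+ 2 / 4 * nu -> l ^+ 3 <= 2 * d * nu ->
  - (u ^+ 3)^-1 * nu + (u ^+ 3)^-1 * expR u^-1 * (L ^+ 2 * S1 + L * S2) <= -1.
Proof.
move=> e0 e8 dE nu0 l2 ul u_le_l du L0 LL S10 S1up S20 S2le q5 q6.
have d0 : 0 < d by rewrite dE divr_gt0 ?exprn_gt0.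
have d1 : d <= 1 by rewrite dE expr2; clear - e0 e8; nra.
have u1 : 1 <= u by clear - l2 ul; lra.
have u0 : 0 < u := lt_le_trans ltr01 u1.
have l0 : 0 < l by clear - l2; lra.
have alpha0 : 0 < (u ^+ 3)^-1 by rewrite invr_gt0 exprn_gt0.
have expu : expR u^-1 <= 1 + d.
  have iu : u^-1 <= d / 4.
    have -> : d / 4 = (4 / d)^-1 by rewrite invf_div.
    rewrite lef_pV2 ?posrE//; by rewrite divr_gt0.
  have := expR_ge1Dx (- u^-1); rewrite expRN => h.
  have iu0 : 0 < u^-1 by rewrite invr_gt0.
  rewrite -[leLHS]invrK -[leRHS]invrK lef_pV2 ?posrE ?invr_gt0 ?expR_gt0//; last exact: addr_gt0.
  apply: le_trans h; rewrite -[leLHS]mul1r ler_pdivrMr; last exact: addr_gt0.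
  have h5 : u^-1 * (1 + d) <= d / 4 * 2 by apply: ler_pM; clear - iu iu0 d0 d1; lra.
  by clear - h5 d0; lra.
have A1 : L ^+ 2 * S1 <= (1 - e ^+ 2) * nu.
  have LL0 : 0 <= L ^+ 2 by exact: sqr_ge0.
  apply: (@le_trans _ _ (L ^+ 2 * ((1 + e) / (2 * u)))).
    by rewrite ler_wpM2l.
  apply: (@le_trans _ _ (L ^+ 2 * ((1 + e) / l))).
    rewrite ler_wpM2l// ler_wpM2l//; first by clear - e0; lra.
    by rewrite lef_pV2 ?posrE// mulr_gt0.
  rewrite LL le_eqVlt; apply/orP; left; apply/eqP; by field; rewrite gt_eqF.
have A2 : L * S2 <= d * nu.
  have B1 : L * S2 <= L * (2 * l ^+ 2).
    rewrite ler_wpM2l//.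
    have ul2 : u ^+ 2 <= l ^+ 2 by rewrite lerXn2r ?nnegrE// ltW.
    have l21 : 1 <= l ^+ 2 by rewrite exprn_ege1//; clear - l2; lra.
    by apply: le_trans S2le _; clear - ul2 l21; lra.
  apply: le_trans B1 _.
  rewrite -(@ler_pXn2r _ 2) ?nnegrE//; [|by rewrite mulr_ge0// mulr_ge0// sqr_ge0|by rewrite mulr_ge0// ltW].
  rewrite exprMn LL.
  apply: (@le_trans _ _ (4 * nu * l ^+ 5)).
    rewrite (_ : 4 * nu * _ = (nu * l) * (2 * l ^+ 2) ^+ 2); last by ring.
    rewrite ler_wpM2r ?sqr_ge0// -mulrA ler_piMl ?mulr_ge0 ?(ltW nu0) ?(ltW l0)//.
    by clear - e0 e8; lra.
  by have := ler_wpM2l (ltW nu0) q5; clear; lra.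
have h1 : expR u^-1 * (L ^+ 2 * S1 + L * S2) <= (1 + d) * ((1 - e ^+ 2) * nu + d * nu).
  apply: ler_pM; rewrite ?expR_ge0//; last exact: lerD.
  by rewrite addr_ge0// mulr_ge0 ?sqr_ge0.
have e2d : e ^+ 2 = 4 * d by rewrite dE; field.
have h2 : (1 + d) * ((1 - e ^+ 2) * nu + d * nu) <= nu - 2 * d * nu.
  rewrite e2d; have := mulr_ge0 (sqr_ge0 d) (ltW nu0); by rewrite expr2; clear; lra.
have u3 : u ^+ 3 <= 2 * d * nu.
  by apply: le_trans q6; rewrite lerXn2r ?nnegrE// ltW.
have h3 : 1 <= (u ^+ 3)^-1 * (2 * d * nu).
  by rewrite -[leLHS](@mulVf _ (u ^+ 3)) ?expf_neq0 ?gt_eqF// ler_wpM2l// ltW.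
have := ler_wpM2l (ltW alpha0) (le_trans h1 h2).
by rewrite !mulNr; clear - h3; lra.
Qed.

(** L/l is close to sqrt(nu/l), at the price of one factor 1-e. Another 1-e is lost in S1, and two
    factors 1+e come from 2u <= (1+e) l and from 1 + 2/u <= 1 + e; the quotient (1-e)^2/(1+e)^2 is
    at least 1 - 4e. *)
Lemma gain_cond e nu LT l u L S1 : 0 < e -> e <= 8^-1 -> 0 < LT -> nu = (1 - e) * LT ->
  l = ln nu -> 2 <= l -> 2 * u <= (1 + e) * l -> 20 / e <= u ->
  0 <= L -> L ^+ 2 = (1 - e) * nu * l -> (1 - e) / (2 * u) <= S1 ->
  (1 - 4 * e) * (Num.sqrt LT / Num.sqrt (ln LT)) <= L * S1 / (1 + 2 / u).
Proof.
move=> e0 e8 LT0 nuE lE l2 uu Ke L0 LL S1lo.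
have u20 : 20 <= u by apply: le_trans Ke; rewrite ler_pdivlMr//; clear - e8; lra.
have u0 : 0 < u by apply: lt_le_trans u20; rewrite ltr0n.
have l0 : 0 < l by apply: lt_le_trans l2; rewrite ltr0n.
have e1' : 0 < 1 - e by clear - e8; lra.
have e1 : 0 <= 1 - e := ltW e1'.
have ep : 0 < 1 + e by exact: addr_gt0.
have nu0 : 0 < nu by rewrite nuE mulr_gt0.
have iu : 2 / u <= e.
  rewrite ler_pdivrMr// -ler_pdivrMl// mulrC.
  by apply: le_trans Ke; rewrite ler_wpM2r ?invr_ge0 ?(ltW e0)// ler_nat.
have iu0 : 0 <= 2 / u by rewrite divr_ge0// ltW.
have lle : l <= ln LT.
  rewrite lE nuE ler_ln ?posrE -?nuE// nuE ler_piMl ?(ltW LT0)// lerBlDr lerDl ltW//.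
set X := Num.sqrt LT / Num.sqrt (ln LT).
have X0 : 0 <= X by rewrite /X divr_ge0 ?sqrtr_ge0.
have Ll0 : 0 <= L / l by rewrite divr_ge0// ltW.
have sl : (1 - e) * X <= L / l.
  rewrite -(@ler_pXn2r _ 2) ?nnegrE//; last by rewrite mulr_ge0.
  rewrite /X exprMn !expr_div_n !sqr_sqrtr ?(ltW LT0)//; last exact: le_trans (ltW l0) lle.
  rewrite LL (_ : (1 - e) * nu * l / l ^+ 2 = (1 - e) ^+ 2 * (LT / l)); last first.
    by rewrite nuE; field; rewrite gt_eqF.
  rewrite ler_wpM2l ?sqr_ge0// ler_wpM2l ?(ltW LT0)// lef_pV2 ?posrE//.
  exact: lt_le_trans lle.
apply: (@le_trans _ _ ((L / l) * ((1 - e) / (1 + e) / (1 + e)))); last first.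
  apply: (@le_trans _ _ (L * ((1 - e) / (2 * u)) / (1 + e))).
    rewrite mulrA ler_wpM2r ?invr_ge0//; first exact: ltW.
    rewrite -!mulrA ler_wpM2l//.
    rewrite mulrCA ler_wpM2l//.
    by rewrite -invfM lef_pV2 ?posrE ?mulr_gt0//; clear - uu; lra.
  apply: ler_pM.
  - by apply: mulr_ge0 => //; apply: divr_ge0 => //; apply: mulr_ge0 => //; exact: ltW.
  - by rewrite invr_ge0 ltW.
  - by rewrite ler_wpM2l.
  - by rewrite lef_pV2 ?posrE// ?lerD2l// ltr_wpDr.
apply: (@le_trans _ _ ((1 - e) * X * ((1 - e) / (1 + e) / (1 + e)))); last first.
  by rewrite ler_wpM2r// !divr_ge0// ltW.
rewrite [leRHS]mulrAC; apply: ler_wpM2r => //.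
rewrite !mulrA ler_pdivlMr// ler_pdivlMr//.
rewrite -subr_ge0 (_ : _ - _ = 4 * e ^+ 2 * (2 + e)); last by ring.
apply: mulr_ge0; first by apply: mulr_ge0 => //; exact: sqr_ge0.
by apply: addr_ge0 => //; exact: ltW.
Qed.

End ResonatorAsymptotics.

(** * Large values with an arbitrarily small loss in the exponent *)

Section LargeValueEps.
Variable R : realType.
Implicit Types (e u T : R).

(** For N = T^(1-e) the base of [offdiag] is 32 J T^(-e); raised to the power 2J with J e >= 4 it is
    O(T^(-8)), which beats the remaining factors, of size O(T^4). *)
Lemma window_cond e J T N : 0 < e -> 4 <= J%:R * e -> 1 <= T ->
  N = expR ((1 - e) * ln T) -> ln (64 * J%:R) / e <= ln T ->
  (32 * J%:R) ^+ J.*2 * 512 / winc R J <= T ->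
  [/\ N <= T, 32 * J%:R * N < T &
      forall M, M%:R <= 128 * T -> offdiag J N T * (N ^+ 2 * M%:R) <= winc R J].
Proof.
move=> e0 Je T1 NE q9 q8.
have Jp : 0 < J%:R :> R.
  rewrite ltr0n lt0n; apply/negP => /eqP J0.
  by move: Je; rewrite J0 mul0r lern0.
have T0 : 0 < T := lt_le_trans ltr01 T1.
have J0 := ltW Jp.
have w0 := winc_gt0 R J.
have LT0 : 0 <= ln T by rewrite ln_ge0.
have TE : T = expR (ln T) by rewrite lnK ?posrE.
have N0 : 0 <= N by rewrite NE expR_ge0.
have NT : N = T * expR (- (e * ln T)).
  by rewrite NE [in RHS]TE -expRD expRK; congr expR; clear; ring.
have NleT : N <= T.
  by rewrite NT ler_piMr ?(ltW T0)// -[leRHS]expR0 ler_expR oppr_le0 mulr_ge0// ltW.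
have J64 : 0 < 64 * J%:R :> R by exact: mulr_gt0.
have eLTV : expR (- (e * ln T)) <= (64 * J%:R)^-1.
  rewrite expRN lef_pV2 ?posrE ?expR_gt0//.
  by rewrite -[leLHS]lnK ?posrE// ler_expR [leRHS]mulrC -ler_pdivrMr.
split=> // [|M MT].
  apply: (@le_lt_trans _ _ (32 * J%:R * (T * (64 * J%:R)^-1))).
    by rewrite NT ler_wpM2l ?mulr_ge0// ler_wpM2l// ltW.
  rewrite (_ : 32 * _ * _ = T / 2); last by clear - Jp; field; rewrite gt_eqF.
  by clear - T0; lra.
have r2 : (32 * J%:R * N / T) ^+ J.*2 <= (32 * J%:R) ^+ J.*2 * (T ^+ 8)^-1.
  rewrite (_ : 32 * J%:R * N / T = 32 * J%:R * expR (- (e * ln T))); last first.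
    by rewrite NT; clear - T0; field; rewrite gt_eqF.
  rewrite exprMn ler_wpM2l ?exprn_ge0 ?mulr_ge0//.
  rewrite -expRM_natr [in leRHS]TE -expRM_natr -expRN ler_expR.
  by have := ler_wpM2r LT0 Je; rewrite -mul2n natrM; clear; lra.
have r3 : 4 * N * (N ^+ 2 * M%:R) <= 512 * T ^+ 4.
  rewrite (_ : 512 * T ^+ 4 = 4 * T * (T ^+ 2 * (128 * T))); last by clear; ring.
  apply: ler_pM; rewrite ?mulr_ge0// ?sqr_ge0//; first by rewrite ler_wpM2l.
  by apply: ler_pM; rewrite ?sqr_ge0// lerXn2r ?nnegrE// ltW.
rewrite /offdiag -mulrA.
apply: le_trans (ler_pM _ _ r2 r3) _.
- by rewrite exprn_ge0// divr_ge0 ?(ltW T0)// mulr_ge0// mulr_ge0.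
- by rewrite !mulr_ge0// sqr_ge0.
have T3 : T <= T ^+ 4 by rewrite -[leLHS]expr1 ler_weXn2l.
rewrite [leLHS](_ : _ = (32 * J%:R) ^+ J.*2 * 512 / T ^+ 4).
  rewrite ler_pdivrMr ?exprn_gt0// -ler_pdivrMl// mulrC.
  exact: le_trans q8 T3.
by move: (_ ^+ J.*2) => A; clear - T0; field; rewrite gt_eqF.
Qed.

Lemma resonator_exists e LT : 0 < e -> e <= 8^-1 -> 0 < LT ->
  let nu := (1 - e) * LT in let l := ln nu in let d := e ^+ 2 / 4 in
  40 / e <= l -> 8 / d <= l -> - ln (1 - e) <= ln l -> ln l <= e * l ->
  l ^+ 5 <= d ^+ 2 / 4 * nu -> l ^+ 3 <= 2 * d * nu ->
  forall B T J M, 0 < T -> 32 * J%:R * expR nu < T -> expR nu <= M%:R -> 0 <= B ->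
  offdiag J (expR nu) T * (expR nu * M%:R) <= winc R J * T ->
  (forall t, T <= t <= 2 * T -> Re (zpoly M t) <= B) ->
  2^-1 * expR ((1 - 4 * e) * (Num.sqrt LT / Num.sqrt (ln LT))) <= 2 * B + 1.
Proof.
move=> e0 e8 LT0 nu l d q0 q1 q2 q3 q5 q6 B T J Mz T0 JN NM B0 err ub.
have ee : 40 <= 40 / e by rewrite ler_pdivlMr//; clear - e8; lra.
have l2 : 2 <= l by apply: le_trans q0; apply: le_trans ee; rewrite ler_nat.
have l0 : 0 < l by apply: lt_le_trans l2; rewrite ltr0n.
have ce : 0 < 1 - e by clear - e8; lra.
have nu0 : 0 < nu by exact: mulr_gt0.
(* The gain L S1 grows with L, while Rankin's trick requires L^2 S1 < nu with S1 near 1/l; up to the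
   margin 1-e this is the largest admissible value of L^2. *)
pose L2 := (1 - e) * nu * l.
have L20 : 0 < L2 by rewrite !mulr_gt0.
have [u uE] : {u | u = 2^-1 * ln L2} by eexists.
have lnL2 : ln L2 = ln (1 - e) + l + ln l. rewrite /L2 lnM ?posrE ?mulr_gt0// lnM ?posrE//.
have lne0 : ln (1 - e) <= 0 by apply: ln_le0; rewrite lerBlDr lerDl ltW.
have ul : l <= 2 * u by rewrite uE lnL2; clear - q2; lra.
have uu : 2 * u <= (1 + e) * l by rewrite uE lnL2; clear - lne0 q3; lra.
have Ke : 20 / e <= u by clear - ul q0; lra.
have Kd : 4 / d <= u by clear - ul q1; lra.
have u1 : 1 <= u by clear - ul l2; lra.
have u0 : 0 < u := lt_le_trans ltr01 u1.
have u_le_l : u <= l.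
  have h : e * l <= 8^-1 * l by rewrite ler_wpM2r// ltW.
  by clear - h uu l0; lra.
have [L LE] : {L | L = Num.sqrt L2} by eexists.
have Lexp : L = expR u by rewrite LE uE sqrt_expR.
have LL : L ^+ 2 = L2 by rewrite LE sqr_sqrtr// ltW.
have LL' : L ^+ 2 = expR (2 * u) by rewrite Lexp -expRM_natr mulrC.
have L1 : 1 <= L by rewrite Lexp -[leLHS]expR0 ler_expR ltW.
have L0 : 0 <= L by exact: le_trans L1.
pose M := Num.truncn (expR (2 * u)).
pose Np := Num.truncn (expR (u ^+ 2)).
have e1 : e <= 1 by clear - e8; lra.
have := @sum_recip_pln_asymp R e e0 e1 u Ke.
rewrite /= -/M -/Np => -[MN /andP[S1lo S1up]].
have MleN : (M <= Np)%N by case/andP: MN.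
pose P := prime_ind M Np.
pose pr := @prime_val M Np.
have prL p : L ^+ 2 <= (pr p)%:R.
  rewrite LL'; have /andP[_ h] := truncn_itv (expR_ge0 (2 * u)).
  apply: ltW; apply: lt_le_trans h _; rewrite ler_nat.
  by have /andP[] := prime_val_bounds p.
have pr_le p : (pr p)%:R <= expR (u ^+ 2).
  have /andP[h _] := truncn_itv (expR_ge0 (u ^+ 2)).
  by apply: le_trans h; rewrite ler_nat; have /andP[] := prime_val_bounds p.
have pr0 p : 0 < (pr p)%:R :> R by rewrite ltr0n prime_gt0// prime_val_prime.
have pru p : 2 * u <= ln ((pr p)%:R : R).
  by rewrite -[leLHS]expRK ler_ln ?posrE ?expR_gt0// -LL'.
have pru2 p : ln ((pr p)%:R : R) <= u ^+ 2.
  by rewrite -[leRHS]expRK ler_ln ?posrE ?expR_gt0.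
(* The primes satisfy ln p <= u^2, so this exponent keeps alpha ln p below 1/u. *)
pose alpha := (u ^+ 3)^-1.
have alpha0 : 0 <= alpha by rewrite invr_ge0 exprn_ge0// ltW.
have pra p : alpha * ln ((pr p)%:R : R) <= u^-1.
  have -> : u^-1 = alpha * u ^+ 2 by rewrite /alpha; field; rewrite gt_eqF.
  by rewrite ler_wpM2l.
have S1E : \sum_p ((pr p)%:R * ln ((pr p)%:R : R))^-1 =
  \sum_(M <= n < Np) (if prime n.+1 then (n.+1%:R * ln (n.+1%:R : R))^-1 else 0).
  exact: (sum_prime_ind (fun n => (n%:R * ln (n%:R : R))^-1) MleN).
rewrite -S1E in S1lo S1up.
have S2le : \sum_p ((pr p)%:R : R)^-1 <= 1 + u ^+ 2.
  rewrite (sum_prime_ind (fun n => (n%:R : R)^-1) MleN).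
  apply: (@le_trans _ _ (\sum_(0 <= n < Np) (n.+1%:R)^-1)).
    rewrite [leRHS](@big_cat_nat _ _ _ M)//=.
    rewrite -[leLHS]add0r; apply: lerD; first by apply: sumr_ge0 => n _; rewrite invr_ge0.
    by apply: ler_sum => n _; case: ifP => // _; rewrite invr_ge0.
  apply: le_trans (harm_le R _) _; rewrite lerD2l; apply: ln_trunc_le; exact: sqr_ge0.
set S1 := \sum_p _ in S1lo S1up; set S2 := \sum_p _ in S2le.
have S10 : 0 <= S1.
  by apply: le_trans S1lo; apply: divr_ge0; [exact: ltW|rewrite mulr_ge0// ltW].
have S20 : 0 <= S2 by apply: sumr_ge0 => p _; rewrite invr_ge0.
have rank := rankin_cond e0 e8 (erefl d) nu0 l2 ul u_le_l Kd L0 LL S10 S1up S20 S2le q5 q6.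
have gain := gain_cond e0 e8 LT0 (erefl nu) (erefl l) l2 uu Ke L0 LL S1lo.
have main := @resonance_gain R P pr L alpha u u1 L1 prL pru alpha0 pra nu rank.
rewrite -/S1 in main.
have f0 p : 0 <= reson pr L p by exact: (reson_ge0 u1 L1 pru).
have N1 : 1 <= expR nu by rewrite -[leLHS]expR0 ler_expR ltW.
have main2 := @resonance R P pr (@prime_val_prime M Np) (@prime_val_inj M Np) (reson pr L) f0 (expR nu) N1
  alpha B T J Mz T0 JN NM alpha0 B0 err ub.
rewrite expRK in main2.
have P0 : 0 < \prod_p (1 + reson pr L p ^+ 2).
  by apply: prodr_gt0 => p _; rewrite ltr_wpDr// sqr_ge0.
have main3 := le_trans main main2; rewrite ler_pM2r// in main3.
by apply: le_trans main3; rewrite ler_wpM2l ?invr_ge0// ler_expR.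
Qed.

Lemma truncn128_bounds T : 1 <= T -> 64 * T <= (Num.truncn (128 * T))%:R <= 128 * T.
Proof.
move=> T1; have T0 : 0 <= 128 * T by apply: mulr_ge0 => //; exact: le_trans T1.
have /andP[h1 h2] := truncn_itv T0.
have {}h2 : 128 * T < (Num.truncn (128 * T))%:R + 1 by rewrite natr1.
by rewrite h1 andbT; move: h2; move: (Num.truncn _) => n; clear - T1; lra.
Qed.

Lemma normc_zeta_ge (M : nat) (t C : R) :
  normc (zeta (2^-1 +i* t) - zpoly M t) <= C ->
  normc (zpoly M t) - C <= normc (zeta (2^-1 +i* t)).
Proof.
move=> h; rewrite lerBlDr.
have := normc_add (zeta (2^-1 +i* t)) (- (zeta (2^-1 +i* t) - zpoly M t)).
rewrite normc_opp opprB addrC subrK; lra.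
Qed.

Lemma absorb_constant (F G C : R) : 1 <= F -> 0 <= C -> 8 * (1 + C) <= G ->
  F + C <= F * G / 8.
Proof.
move=> F1 C0 h; have := ler_wpM2l (le_trans ler01 F1) h.
have := ler_wpM2l C0 F1; lra.
Qed.

(** The resonator yields the exponent 1 - 4e. Giving up one more e leaves a factor exp(e X), with X
    the ratio of square roots, which absorbs the O(1) error of the zeta polynomial and the numerical
    constants. *)
Lemma large_value e : 0 < e -> e <= 8^-1 ->
  \forall T \near +oo, exists t, T <= t <= 2 * T /\
   expR ((1 - 5 * e) * (Num.sqrt (ln T) / Num.sqrt (ln (ln T)))) <= normc (zeta (2^-1 +i* t)).
Proof.
move=> e0 e8.
have [C0 [C0p HC]] := zeta_near_zpoly R.
pose d := e ^+ 2 / 4.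
have d0 : 0 < d by rewrite divr_gt0 ?exprn_gt0.
pose J := (Num.truncn (4 / e)).+1.
have Je : 4 <= J%:R * e.
  have /truncn_itv/andP[_ h] : 0 <= 4 / e by rewrite divr_ge0// ltW.
  by rewrite -ler_pdivrMr// ltW.
have ce : 0 < 1 - e by lra.
pose Y := Num.max 1 (ln (8 * (1 + C0)) / e).
have Y1 : 1 <= Y by rewrite le_max lexx.
have nu_near Q : (\forall x \near +oo, Q x) -> \forall T \near +oo, Q ((1 - e) * ln T).
  by move=> h; apply: (@near_ln R (fun x => Q ((1 - e) * x))); exact: (near_mull ce h).
have ln_nu_near Q : (\forall x \near +oo, Q x) -> \forall T \near +oo, Q (ln ((1 - e) * ln T)).
  by move=> h; apply: (nu_near (fun x => Q (ln x))); exact: near_ln.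
near=> T.
have r1 : 40 / e <= ln ((1 - e) * ln T).
  by near: T; apply: (ln_nu_near (fun x => 40 / e <= x)); exact: near_ge.
have r2 : 8 / d <= ln ((1 - e) * ln T).
  by near: T; apply: (ln_nu_near (fun x => 8 / d <= x)); exact: near_ge.
have r3 : - ln (1 - e) <= ln (ln ((1 - e) * ln T)).
  near: T; apply: (ln_nu_near (fun x => - ln (1 - e) <= ln x)).
  by apply: (@near_ln R (fun x => - ln (1 - e) <= x)); exact: near_ge.
have r4 : ln (ln ((1 - e) * ln T)) ^+ 1 <= e * ln ((1 - e) * ln T).
  by near: T; apply: (ln_nu_near (fun x => ln x ^+ 1 <= e * x)); exact: near_ln_pow.
have r5 : ln ((1 - e) * ln T) ^+ 5 <= d ^+ 2 / 4 * ((1 - e) * ln T).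
  near: T; apply: (nu_near (fun x => ln x ^+ 5 <= d ^+ 2 / 4 * x)).
  by apply: near_ln_pow; rewrite divr_gt0// exprn_gt0.
have r6 : ln ((1 - e) * ln T) ^+ 3 <= 2 * d * ((1 - e) * ln T).
  near: T; apply: (nu_near (fun x => ln x ^+ 3 <= 2 * d * x)).
  by apply: near_ln_pow; rewrite mulr_gt0.
have r7 : ln (ln T) ^+ 1 <= (Y ^+ 2)^-1 * ln T.
  near: T; apply: (@near_ln R (fun x => ln x ^+ 1 <= (Y ^+ 2)^-1 * x)).
  by apply: near_ln_pow; rewrite invr_gt0 exprn_gt0// lt_max ltr01.
have r8 : (32 * J%:R) ^+ J.*2 * 512 / winc R J <= T by near: T; exact: near_ge.
have r9 : ln (64 * J%:R) / e <= ln T.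
  near: T; apply: (@near_ln R (fun x => ln (64 * J%:R) / e <= x)); exact: near_ge.
have r10 : 1 <= ln (ln T).
  near: T; apply: (@near_ln R (fun x => 1 <= ln x)); apply: (@near_ln R (fun x => 1 <= x)).
  exact: near_ge.
have LT0 : 0 < ln T.
  by rewrite ltNge; apply/negP => h; move: r10; rewrite (ln0 h) ler10.
have T1 : 1 <= T by rewrite leNgt; apply/negP => /ltW/ln_le0; rewrite leNgt LT0.
have T0 : 0 < T by exact: lt_le_trans T1.
rewrite expr1 in r4.
have main := resonator_exists e0 e8 LT0 r1 r2 r3 r4 r5 r6.
have [NleT JN err] := window_cond e0 Je T1 (erefl _) r9 r8.
rewrite /= in main; move: r1 r2 r3 r4 r5 r6 r8 r9 => _ _ _ _ _ _ _ _.
have [X XE] : {X | X = Num.sqrt (ln T) / Num.sqrt (ln (ln T))} by eexists.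
rewrite -XE in main *.
have XY : Y <= X.
  have X0 : 0 <= X by rewrite XE divr_ge0 ?sqrtr_ge0.
  have Y0 := lt_le_trans ltr01 Y1.
  rewrite -(@ler_pXn2r _ 2) ?nnegrE//; last exact: ltW.
  have l0 := lt_le_trans ltr01 r10.
  rewrite XE expr_div_n !sqr_sqrtr ?(ltW LT0) ?(ltW l0)//.
  rewrite expr1 in r7; rewrite ler_pdivlMr//.
  have Y20 : 0 < Y ^+ 2 by exact: exprn_gt0.
  by rewrite -ler_pdivlMl.
pose Mz := Num.truncn (128 * T).
have Mz3 := truncn128_bounds T1; rewrite -/Mz in Mz3.
have NM : expR ((1 - e) * ln T) <= Mz%:R.
  apply: le_trans NleT _; case/andP: Mz3 => h _; apply: le_trans h.
  by rewrite ler_peMl ?ler1n// ltW.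
have Mz1 : Mz%:R <= 128 * T by case/andP: Mz3.
apply: contrapT => no.
have [E EE] : {E | E = expR ((1 - 4 * e) * X)} by eexists.
rewrite -EE in main.
have E0 : 0 < E by rewrite EE expR_gt0.
have X1 : 1 <= X by exact: le_trans XY.
have F1 : 1 <= expR ((1 - 5 * e) * X).
  rewrite -[leLHS]expR0 ler_expR; apply: mulr_ge0; last exact: le_trans X1.
  by clear - e8; lra.
have EF5 : expR ((1 - 5 * e) * X) + C0 <= E / 8.
  have Ee : E = expR ((1 - 5 * e) * X) * expR (e * X).
    by rewrite EE -expRD; congr expR; ring.
  rewrite Ee; apply: absorb_constant => //; first exact: ltW.
  have c80 : 0 < 8 * (1 + C0) by apply: mulr_gt0 => //; exact: addr_gt0.
  rewrite -[leLHS]lnK ?posrE// ler_expR [leRHS]mulrC -ler_pdivrMr//.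
  by apply: le_trans XY; rewrite le_max lexx orbT.
have ub t : T <= t <= 2 * T -> Re (zpoly Mz t) <= E / 8.
  move=> tT; rewrite leNgt; apply/negP => lt; apply: no; exists t; split=> //.
  apply: le_trans (normc_zeta_ge (HC T t Mz T1 tT Mz3)).
  rewrite lerBrDr; apply: le_trans EF5 _; apply: le_trans (ltW lt) _.
  exact: le_trans (ler_norm _) (Re_le_normc _).
have E80 : 0 <= E / 8 by rewrite divr_ge0// ltW.
have N1 : 1 <= expR ((1 - e) * ln T) by rewrite -[leLHS]expR0 ler_expR mulr_ge0 ?ltW.
have {}err : offdiag J (expR ((1 - e) * ln T)) T * (expR ((1 - e) * ln T) * Mz%:R) <= winc R J * T.
  apply: le_trans (_ : winc R J <= _); last by rewrite ler_peMr// ltW// winc_gt0.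
  apply: le_trans (err _ Mz1); apply: ler_wpM2l.
    by rewrite mulr_ge0 ?exprn_ge0 ?divr_ge0 ?mulr_ge0 ?expR_ge0// ltW.
  by rewrite expr2 -mulrA ler_peMl// mulr_ge0 ?expR_ge0.
have := main (E / 8) T J Mz T0 JN NM E80 err ub.
by move: F1 EF5 C0p; clear; lra.
Unshelve. all: by end_near. Qed.
End LargeValueEps.

Section LargeValuesLimit.
Variable R : realType.

(** One function [delta] is extracted from the family of estimates by taking, for each T, the
    infimum of the admissible losses e. The infimum may not be attained; adding 1/T provides an
    admissible e below it and still tends to 0. *)
Lemma large_values_asymp : exists delta : R -> R,
     delta T @[T --> +oo] --> (0 : R) /\
     \forall T \near +oo, exists t : R,
       T <= t <= 2 * T /\
       (expR ((1 + delta T) * (Num.sqrt (ln T) / Num.sqrt (ln (ln T)))))%:C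
         <= `|zeta (2^-1 +i* t)|.
Proof.
pose A (T : R) : set R := [set e | 0 < e /\ exists t, T <= t <= 2 * T /\
  expR ((1 - 5 * e) * (Num.sqrt (ln T) / Num.sqrt (ln (ln T)))) <= normc (zeta (2^-1 +i* t))].
have Ae e : 0 < e -> e <= 8^-1 -> \forall T \near +oo, A T e.
  by move=> e0 e8; have := @large_value R e e0 e8; apply: filterS => T H; split.
have lbA T : lbound (A T) 0 by move=> e [/ltW].
exists (fun T => - 5 * (inf (A T) + T^-1)); split.
  apply/cvgrPdist_lt => eps eps0.
  pose e := Num.min 8^-1 (eps / 20).
  have e0 : 0 < e by rewrite lt_min invr_gt0 ltr0n divr_gt0.
  have e8 : e <= 8^-1 by rewrite ge_min lexx.
  have ee : e <= eps / 20 by rewrite ge_min lexx orbT.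
  near=> T.
  have AT : A T e by near: T; exact: Ae.
  have T1 : e^-1 <= T by near: T; apply: nbhs_pinfty_ge; exact: num_real.
  have T0 : 0 < T by apply: lt_le_trans T1; rewrite invr_gt0.
  have i0 : 0 <= inf (A T) by apply: lb_le_inf => //; exists e.
  have i1 : inf (A T) <= e by apply: ge_inf => //; exists 0.
  have t0 : 0 < T^-1 by rewrite invr_gt0.
  have t1 : T^-1 <= e by rewrite -[leRHS]invrK lef_pV2 ?posrE// invr_gt0.
  rewrite sub0r mulNr opprK ger0_norm; last by rewrite mulr_ge0// addr_ge0// ltW.
  lra.
near=> T.
have AT : A T 8^-1 by near: T; apply: Ae => //; rewrite invr_gt0.
have T0 : 0 < T by near: T; apply: nbhs_pinfty_gt; exact: num_real.
have hi : has_inf (A T) by split; [exists 8^-1|exists 0].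
have t0 : 0 < T^-1 by rewrite invr_gt0.
have [e [e0 [t [tT te]]] ei] := inf_adherent t0 hi.
exists t; split=> //; rewrite norm_normc lecR; apply: le_trans te.
rewrite ler_expR; apply: ler_wpM2r; first by rewrite divr_ge0 ?sqrtr_ge0.
lra.
Unshelve. all: by end_near. Qed.
End LargeValuesLimit.

(** * Powers of a prime polynomial *)

Section PrimeTuples.
Variable R : realType.
Variables (P : finType) (pr : P -> nat).
Hypothesis pr_prime : forall p, prime (pr p).
Hypothesis pr_inj : injective pr.
Implicit Types (m k : nat).

Definition nf m (f : {ffun 'I_m -> P}) : nat := \prod_i pr (f i).
Definition wf m (f : {ffun 'I_m -> P}) : R := \prod_i (Num.sqrt (pr (f i))%:R)^-1.
Let S : R := \sum_p ((pr p)%:R)^-1.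

Let pr0 p : 0 < (pr p)%:R :> R.
Proof. by rewrite ltr0n prime_gt0. Qed.

Lemma nf_gt0 m (f : {ffun 'I_m -> P}) : (0 < nf f)%N.
Proof. by rewrite prodn_gt0// => i; rewrite prime_gt0. Qed.

Lemma wfE m (f : {ffun 'I_m -> P}) : wf f = (Num.sqrt (nf f)%:R)^-1.
Proof.
rewrite /wf /nf natr_prod; elim/big_rec2 : _ => [|i x y _ ->]; first by rewrite sqrtr1 invr1.
by rewrite sqrtrM// invfM.
Qed.

Lemma wf_gt0 m (f : {ffun 'I_m -> P}) : 0 < wf f.
Proof. by rewrite wfE invr_gt0 sqrtr_gt0 ltr0n nf_gt0. Qed.

Lemma sum_wf m : \sum_(f : {ffun 'I_m -> P}) wf f = (\sum_p (Num.sqrt (pr p)%:R)^-1) ^+ m.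
Proof.
rewrite -[in RHS](card_ord m) -prodr_const bigA_distr_bigA/=; apply: eq_bigr => f _.
by [].
Qed.

Lemma sum_inv_nf m : \sum_(f : {ffun 'I_m -> P}) ((nf f)%:R)^-1 = S ^+ m.
Proof.
rewrite -[in RHS](card_ord m) -prodr_const bigA_distr_bigA/=; apply: eq_bigr => f _.
by rewrite /nf natr_prod prodfV.
Qed.

Lemma logn_prod_pr (s : seq P) p : logn (pr p) (\prod_(q <- s) pr q) = count_mem p s.
Proof.
elim: s => [|q s IH]; first by rewrite big_nil logn1.
rewrite big_cons lognM; first last.
- by rewrite prodn_gt0// => i; rewrite prime_gt0.
- exact: prime_gt0.
by rewrite IH/= logn_prime// (inj_eq pr_inj) eq_sym.
Qed.

Lemma nfE m (f : {ffun 'I_m -> P}) : nf f = \prod_(q <- [tuple f i | i < m]) pr q.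
Proof. by rewrite big_map big_enum. Qed.

Lemma nf_perm m l (f : {ffun 'I_m -> P}) (g : {ffun 'I_l -> P}) : nf f = nf g ->
  perm_eq [tuple f i | i < m] [tuple g i | i < l].
Proof. by move=> e; apply/allP => p _ /=; rewrite -!logn_prod_pr -!nfE e. Qed.

Lemma nf_size m l (f : {ffun 'I_m -> P}) (g : {ffun 'I_l -> P}) : nf f = nf g -> m = l.
Proof. by move=> /nf_perm/perm_size; rewrite !size_tuple. Qed.

(** Tuples with the same product are rearrangements of each other, by unique factorization. *)
Lemma card_nf_le m (f : {ffun 'I_m -> P}) :
  (#|[set g : {ffun 'I_m -> P} | nf f == nf g]%SET| <= m`!)%N.
Proof.
rewrite -card_Sn.
pose F (s : {perm 'I_m}) : {ffun 'I_m -> P} := [ffun i => f (s i)].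
apply: (@leq_trans #|[set F s | s in {perm 'I_m}]%SET|); last exact: leq_imset_card.
apply/subset_leq_card/fintype.subsetP => g; rewrite inE => /eqP/esym/nf_perm/tuple_permP[s sE].
apply/imsetP; exists s => //; apply/ffunP => i; rewrite ffunE.
by have := congr1 (fun t => tnth t i) (val_inj sE); rewrite !tnth_mktuple.
Qed.

Lemma diag_moment_le m :
  \sum_(f : {ffun 'I_m -> P}) \sum_(g : {ffun 'I_m -> P} | nf f == nf g) wf f * wf g
  <= m`!%:R * S ^+ m.
Proof.
rewrite -sum_inv_nf mulr_sumr; apply: ler_sum => f _.
rewrite (eq_bigr (fun=> ((nf f)%:R)^-1)).
  rewrite sumr_const -[leLHS]mulr_natl ler_wpM2r ?invr_ge0// ler_nat.
  by apply: leq_trans (card_nf_le f); rewrite cardsE.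
move=> g /eqP e; rewrite !wfE -e -invfM -expr2 sqr_sqrtr//.
Qed.

(* Dropping repeated primes makes each product nf g arise from exactly m!
   tuples, so counting representations becomes a factorial. *)
Definition injsum m : R := \sum_(g : {ffun 'I_m -> P} | injectiveb g) ((nf g)%:R)^-1.

Let ext m (pg : P * {ffun 'I_m -> P}) : {ffun 'I_m.+1 -> P} :=
  [ffun i => if unlift ord0 i is Some j then pg.2 j else pg.1].

Lemma ext0 m pg : @ext m pg ord0 = pg.1.
Proof. by rewrite ffunE unlift_none. Qed.
Lemma extS m pg (i : 'I_m) : @ext m pg (lift ord0 i) = pg.2 i.
Proof. by rewrite ffunE liftK. Qed.

Lemma ext_bij m : bijective (@ext m).
Proof.
exists (fun f : {ffun 'I_m.+1 -> P} => (f ord0, [ffun j : 'I_m => f (lift ord0 j)])) => [[p g]|f].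
  by rewrite ext0; congr (_, _); apply/ffunP => i; rewrite ffunE extS.
apply/ffunP => i; rewrite ffunE; case: unliftP => [j ->|->] /=; last by [].
by rewrite ffunE.
Qed.

Lemma nf_ext m pg : nf (@ext m pg) = (pr pg.1 * nf pg.2)%N.
Proof.
rewrite /nf big_ord_recl ext0; congr (_ * _)%N.
by apply: eq_bigr => j _; rewrite extS.
Qed.

Lemma injectiveb_ext m p (g : {ffun 'I_m -> P}) :
  injectiveb g -> p \notin codom g -> injectiveb (ext (p, g)).
Proof.
move=> /injectiveP gi pg; apply/injectiveP => i i'.
case: (unliftP ord0 i) => [j ->|->]; case: (unliftP ord0 i') => [j' ->|->];
  rewrite ?ext0 ?extS//=.
- by move=> /gi ->.
- by move=> e; case/negP: pg; rewrite -e codom_f.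
- by move=> e; case/negP: pg; rewrite e codom_f.
Qed.

Variable y : R.
Hypothesis y0 : 0 < y.
Hypothesis pry : forall p, y <= (pr p)%:R.

(** Induction on m: the new prime must avoid the at most K primes already used, each of reciprocal
    at most 1/y. *)
Lemma injsum_ge m K : (m <= K)%N -> K%:R / y <= S -> (S - K%:R / y) ^+ m <= injsum m.
Proof.
move=> + KS; elim: m => [|m IH] mK.
  rewrite /injsum (eq_bigl xpredT); first by rewrite sum_inv_nf !expr0.
  by move=> g; apply/injectiveP => -[].
have {}IH := IH (ltnW mK).
rewrite /injsum (reindex (@ext m)); last exact: onW_bij (ext_bij m).
apply: (@le_trans _ _ (\sum_(pg : P * {ffun 'I_m -> P} | injectiveb pg.2 && (pg.1 \notin codom pg.2))
   ((pr pg.1 * nf pg.2)%:R)^-1)); last first.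
  rewrite big_mkcond [leRHS]big_mkcond; apply: ler_sum => -[p g] _ /=.
  case: ifPn => [/andP[gi pg]|_]; first by rewrite injectiveb_ext// nf_ext.
  by case: ifP; rewrite ?invr_ge0.
rewrite -(pair_big_dep xpredT (fun p (g : {ffun 'I_m -> P}) => injectiveb g && (p \notin codom g))
  (fun p (g : {ffun 'I_m -> P}) => ((pr p * nf g)%:R)^-1 : R))/=.
rewrite (exchange_big_dep (fun g : {ffun 'I_m -> P} => injectiveb g))/=; last by move=> p g _ /andP[].
rewrite exprSr; apply: (@le_trans _ _ (injsum m * (S - K%:R / y))).
  by rewrite ler_wpM2r// subr_ge0.
rewrite /injsum mulr_suml; apply: ler_sum => g gi.
rewrite (eq_bigr (fun p => ((nf g)%:R)^-1 * ((pr p)%:R)^-1)); last first.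
  by move=> p _; rewrite natrM invfM mulrC.
rewrite -mulr_sumr ler_wpM2l ?invr_ge0// gi/=.
rewrite lerBlDr /S (bigID (fun p => p \notin codom g))/= lerD2l.
apply: (@le_trans _ _ (\sum_(p | ~~ (p \notin codom g)) y^-1)).
  by apply: ler_sum => p _; rewrite lef_pV2 ?posrE.
rewrite sumr_const -[leLHS]mulr_natl ler_wpM2r ?invr_ge0 ?(ltW y0)// ler_nat.
apply: leq_trans (ltnW mK); rewrite (eq_card (B := mem (codom g))); last first.
  by move=> p; rewrite unfold_in/= negbK.
by apply: leq_trans (card_size _) _; rewrite size_codom card_ord.
Qed.

(** For an injective tuple g, each injection of l indices into m selects a subtuple f, and zeta
    supplies the product of the remaining primes. The three weights multiply to exactly 1/[nf g],
    and there are [m ^_ l] injections. *)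
Lemma twisted_diag_injsum m l M N : (l <= m)%N -> (N <= M)%N ->
  (forall g : {ffun 'I_m -> P}, (nf g <= N)%N) ->
  (m ^_ l)%:R * injsum m <=
  \sum_(f : {ffun 'I_l -> P}) \sum_(g : {ffun 'I_m -> P})
    \sum_(i < M | (i.+1 * nf f)%N == nf g) (Num.sqrt i.+1%:R)^-1 * (wf f * wf g).
Proof.
move=> lm NM gN; rewrite exchange_big/= /injsum mulr_sumr big_mkcond/=; apply: ler_sum => g _.
have t0 f (i : 'I_M) : 0 <= (Num.sqrt i.+1%:R)^-1 * (@wf l f * wf g).
  by rewrite mulr_ge0 ?invr_ge0 ?sqrtr_ge0// mulr_ge0// ltW// wf_gt0.
case: ifPn => gi; last by apply: sumr_ge0 => f _; apply: sumr_ge0.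
have ginj : injective g by exact/injectiveP.
pose I := [set h : {ffun 'I_l -> 'I_m} | injectiveb h]%SET.
pose F (h : {ffun 'I_l -> 'I_m}) : {ffun 'I_l -> P} := [ffun i => g (h i)].
have Finj : injective F.
  move=> h h' e; apply/ffunP => i; apply: ginj.
  by have := congr1 (fun f : {ffun 'I_l -> P} => f i) e; rewrite /= !ffunE.
have -> : (m ^_ l)%N = #|I| by rewrite /I card_inj_ffuns !card_ord.
rewrite -[leLHS]mulrC mulr_natr -sumr_const.
apply: (@le_trans _ _ (\sum_(f in [set F h | h in I]%SET)
    \sum_(i < M | (i.+1 * nf f)%N == nf g) (Num.sqrt i.+1%:R)^-1 * (wf f * wf g))); last first.
  rewrite big_mkcond; apply: ler_sum => f _; case: ifP => // _; exact: sumr_ge0.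
rewrite big_imset/=; last by move=> h h' _ _; exact: Finj.
apply: ler_sum => h; rewrite inE => /injectiveP hi.
pose rest := (\prod_(j | j \notin codom h) pr (g j))%N.
have nE : nf g = (rest * nf (F h))%N.
  rewrite /nf /rest (bigID (fun j => j \in codom h))/= mulnC; congr (_ * _)%N.
  transitivity (\prod_(j in [set h i | i in 'I_l]%SET) pr (g j))%N.
    apply: eq_bigl => j; apply/codomP/imsetP => [[i ->]|[i _ ->]]; last by exists i.
    by exists i.
  rewrite big_imset/=; last by move=> i i' _ _; exact: hi.
  by apply: eq_bigr => i _; rewrite ffunE.
have r0 : (0 < rest)%N by rewrite prodn_gt0// => i; rewrite prime_gt0.
have rM : (rest.-1 < M)%N.
  rewrite prednK//; apply: (leq_trans _ NM); apply: (leq_trans _ (gN g)).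
  by rewrite nE; apply: leq_pmulr; exact: nf_gt0.
rewrite (bigD1 (Ordinal rM))/= ?prednK// -?nE//.
rewrite -[leLHS]addr0; apply: lerD; last by apply: sumr_ge0.
rewrite !wfE -!invfM -!sqrtrM// nE !natrM.
rewrite [X in Num.sqrt X](_ : _ = (rest%:R * (nf (F h))%:R) ^+ 2); last by ring.
by rewrite sqrtr_sqr ger0_norm.
Qed.
End PrimeTuples.

(** * Moments weighted by an even power of the real part of the prime polynomial *)

Section PowerResonator.
Variable R : realType.
Implicit Types (t T N : R) (z w : R[i]).

Lemma cconjM z w : cconj (z * w) = cconj z * cconj w.
Proof. by apply: complex_ext; rewrite /cconj ?(cReM, cImM)/= ?cReM ?cImM; ring. Qed.

Lemma cconjX z n : cconj (z ^+ n) = cconj z ^+ n.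
Proof.
elim: n => [|n IH]; first by rewrite !expr0 /cconj /= oppr0.
by rewrite !exprS cconjM IH.
Qed.

Lemma Re_scale (x : R) z : Re (x%:C * z) = x * Re z.
Proof. by rewrite cReM/= mul0r subr0. Qed.

Lemma Re_pow_expand z (k : nat) : (Re z ^+ k)%:C =
  \sum_(i < k.+1) ('C(k, i)%:R / 2 ^+ k)%:C * (z ^+ (k - i) * cconj (z ^+ i)).
Proof.
have -> : (Re z ^+ k)%:C = ((2^-1)%:C * (z + cconj z)) ^+ k.
  have -> : (2^-1)%:C * (z + cconj z) = (Re z)%:C.
    by apply: complex_ext; rewrite /cconj ?(cReM, cImM, cReD, cImD)/=; [field|ring].
  by elim: k => [|k IH]; rewrite ?expr0// !exprS rcM IH.
rewrite exprMn exprDn mulr_sumr; apply: eq_bigr => i _.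
have -> : ('C(k, i)%:R / 2 ^+ k : R)%:C = (2^-1)%:C ^+ k * 'C(k, i)%:R.
  rewrite rcM mulrC; congr (_ * _).
    rewrite -exprVn; elim: k {i} => [|k IH]; rewrite ?expr0// !exprS rcM IH//.
  by elim: 'C(k, i) => [|n IH]; rewrite ?mulr0n// !mulrS rcD IH.
by rewrite -mulrA mulr_natl cconjX.
Qed.

Variables (P : finType) (pr : P -> nat).
Hypothesis pr_prime : forall p, prime (pr p).
Hypothesis pr_inj : injective pr.

Definition ppoly t : R[i] := dpoly (fun p => (Num.sqrt ((pr p)%:R : R))^-1) pr t.

Lemma ppolyX m t : ppoly t ^+ m = dpoly (wf R pr (m := m)) (nf pr (m := m)) t.
Proof.
rewrite /ppoly /dpoly csumX; apply: eq_bigr => f _; congr (_ * cis (_ * _)).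
rewrite /nf sumrN; congr (- _).
have [] : (0 < \prod_i pr (f i))%N /\ \sum_j ln ((pr (f j))%:R : R) =
      ln ((\prod_i pr (f i))%N%:R : R); last by [].
apply: (big_ind2 (fun (x : R) (n : nat) => (0 < n)%N /\ x = ln n%:R)).
- by rewrite ln1.
- move=> x1 x2 y1 y2 [x20 ->] [y20 ->]; rewrite muln_gt0 x20 y20; split => //.
  by rewrite natrM lnM ?posrE ?ltr0n.
- by move=> p _; rewrite prime_gt0.
Qed.

Let A : R := \sum_p (Num.sqrt (pr p)%:R)^-1.
Let S : R := \sum_p ((pr p)%:R)^-1.

Variables (k J : nat) (N T : R).
Hypothesis T0 : 0 < T.
Hypothesis N0 : 0 < N.
Hypothesis JN : 32 * J%:R * N < T.
Hypothesis fN : forall m (f : {ffun 'I_m -> P}), (m <= 4 * k)%N -> (nf pr f)%:R <= N.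

Let E := offdiag J N T.
Let w := winc R J.
Let E0 : 0 <= E.
Proof. by rewrite mulr_ge0 ?exprn_ge0 ?mulr_ge0 ?divr_ge0 ?invr_ge0 ?(ltW N0) ?(ltW T0). Qed.

Let cf i : R := 'C(2 * k, i)%:R / 2 ^+ (2 * k).
Let cf0 i : 0 <= cf i. Proof. by rewrite divr_ge0// exprn_ge0. Qed.
Let sum_cf : \sum_(i < (2 * k).+1) cf i = 1.
Proof.
rewrite -mulr_suml -natr_sum (_ : \sum_(i < (2 * k).+1) 'C(2 * k, i) = 2 ^ (2 * k))%N.
  by rewrite natrX mulfV// expf_neq0// pnatr_eq0.
rewrite -[2%N in RHS]/(1 + 1)%N expnDn; apply: eq_bigr => i _.
by rewrite !exp1n !muln1.
Qed.

Definition pweight t : R := Re (ppoly t) ^+ (2 * k).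

Lemma pweight_ge0 t : 0 <= pweight t.
Proof. by rewrite /pweight exprM exprn_ge0// sqr_ge0. Qed.

Lemma pweightE z t : Re z * pweight t =
  \sum_(i < (2 * k).+1) cf i * Re (z * (dpoly (wf R pr (m := 2 * k - i)) (nf pr (m := 2 * k - i)) t *
     cconj (dpoly (wf R pr (m := i)) (nf pr (m := i)) t))).
Proof.
have -> : Re z * pweight t = Re (z * (pweight t)%:C) by rewrite cReM/= mulr0 subr0.
rewrite /pweight Re_pow_expand mulr_sumr Re_sum; apply: eq_bigr => i _.
by rewrite mulrCA Re_scale !ppolyX.
Qed.

Let dN m : (m <= 4 * k)%N -> forall f : {ffun 'I_m -> P}, wf R pr f != 0 ->
  (0 < nf pr f)%N /\ (nf pr f)%:R <= N.
Proof. by move=> mk f _; rewrite nf_gt0//; split=> //; exact: fN. Qed.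

Let wf0 m (f : {ffun 'I_m -> P}) : 0 <= wf R pr f.
Proof. by rewrite ltW// wf_gt0. Qed.

(** The i-th binomial term pairs products of 2k-i primes with products of i primes, so unique
    factorization leaves a diagonal only for i = k. The coefficients [cf i] sum to 1, which combines
    all errors into one. *)
Lemma isint_pweight : exists v, isint T (fun t => win T J t * pweight t) v /\
  v <= w * T * (cf k * (k`!%:R * S ^+ k)) + E * A ^+ (2 * k).
Proof.
have H (i : 'I_(2 * k).+1) : exists v, isint T (fun t => cf i * (win T J t *
    Re (dpoly (wf R pr (m := 2 * k - i)) (nf pr (m := 2 * k - i)) t *
     cconj (dpoly (wf R pr (m := i)) (nf pr (m := i)) t)))) v /\
    v <= (if i == k :> nat then w * T * (cf k * (k`!%:R * S ^+ k)) else 0) + cf i * (E * A ^+ (2 * k)).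
  have ik : (i <= 2 * k)%N by rewrite -ltnS ltn_ord.
  have i4 : (i <= 4 * k)%N by lia.
  have i4' : (2 * k - i <= 4 * k)%N by lia.
  have [v [hv v1]] := isint_pair T0 N0 JN (wf0 (m := 2 * k - i)) (wf0 (m := i)) (dN i4') (dN i4).
  exists (cf i * v); split; first exact: isintZ.
  move: v1; rewrite !sum_wf// -exprD subnK// -/A -/E -/w ler_norml => /andP[_ v1].
  have [e|ne] := eqVneq (i : nat) k.
    have D : \sum_(f : {ffun 'I_(2 * k - i) -> P}) \sum_(g : {ffun 'I_i -> P} | nf pr f == nf pr g)
        wf R pr f * wf R pr g <= k`!%:R * S ^+ k.
      rewrite e (_ : (2 * k - k = k)%N); last by lia.
      exact: diag_moment_le.
    rewrite e in v1 D *.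
    have wT : 0 <= w * T by rewrite mulr_ge0 ?(ltW T0)// ltW// winc_gt0.
    have := ler_wpM2l wT D => D'.
    have v2 : v <= w * T * (k`!%:R * S ^+ k) + E * A ^+ (2 * k) by lra.
    by have := ler_wpM2l (cf0 k) v2; lra.
  have D : \sum_(f : {ffun 'I_(2 * k - i) -> P}) \sum_(g : {ffun 'I_i -> P} | nf pr f == nf pr g)
        wf R pr f * wf R pr g = 0.
    rewrite big1// => f _; rewrite big1// => g /eqP/(nf_size pr_prime pr_inj); lia.
  rewrite D mulr0 subr0 in v1; rewrite add0r; exact: ler_wpM2l.
have /choice[v hv] := H.
exists (\sum_i v i); split.
  apply: isint_ext (isint_sum (index_enum _) (P := predT) (fun i _ => (hv i).1)) => t.
  rewrite -[pweight t]mul1r -[1]/(Re 1) pweightE mulr_sumr; apply: eq_bigr => i _.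
  by rewrite mul1r; ring.
apply: le_trans (ler_sum _ (fun i _ => (hv i).2)) _.
rewrite big_split/= -mulr_suml sum_cf mul1r lerD2r.
have kk : (k < (2 * k).+1)%N by lia.
rewrite (bigD1 (Ordinal kk))//= eqxx big1 ?addr0// => i ik.
by rewrite ifN//; apply: contra ik => /eqP e; apply/eqP/val_inj.
Qed.

(** Only the diagonal of i = k+j is kept, where k-j primes times an integer from zeta match k+j
    primes; the other diagonals are nonnegative. *)
Lemma isint_zeta_pweight M j : (j <= k)%N -> N <= M%:R ->
  exists v, isint T (fun t => win T J t * (Re (zpoly M t) * pweight t)) v /\
  w * T * (cf (k + j) * (((k + j) ^_ (k - j))%:R * injsum R pr (k + j))) - E * (M%:R * A ^+ (2 * k)) <= v.
Proof.
move=> jk NM.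
have H (i : 'I_(2 * k).+1) : exists v, isint T (fun t => cf i * (win T J t *
    Re (zpoly M t * (dpoly (wf R pr (m := 2 * k - i)) (nf pr (m := 2 * k - i)) t *
     cconj (dpoly (wf R pr (m := i)) (nf pr (m := i)) t))))) v /\
    (if i == k + j :> nat then w * T * (cf (k + j) * (((k + j) ^_ (k - j))%:R * injsum R pr (k + j))) else 0)
      - cf i * (E * (M%:R * A ^+ (2 * k))) <= v.
  have ik : (i <= 2 * k)%N by rewrite -ltnS ltn_ord.
  have i4 : (i <= 4 * k)%N by lia.
  have i4' : (2 * k - i <= 4 * k)%N by lia.
  have [v [hv v1]] := isint_triple M T0 N0 JN (wf0 (m := 2 * k - i)) (wf0 (m := i))
     (fun f h => (dN i4' h).1) (dN i4).
  exists (cf i * v); split; first exact: isintZ.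
  move: v1; rewrite !sum_wf// -exprD subnK// -/A -/E -/w => v1.
  have wT : 0 <= w * T by rewrite mulr_ge0 ?(ltW T0)// ltW// winc_gt0.
  move: v1; set D := \sum_f _ => v1.
  have D0 : 0 <= D.
    apply: sumr_ge0 => f _; apply: sumr_ge0 => g _; apply: sumr_ge0 => l _.
    by rewrite mulr_ge0 ?invr_ge0 ?sqrtr_ge0// mulr_ge0.
  have [e|ne] := eqVneq (i : nat) (k + j)%N.
    have DD : ((k + j) ^_ (k - j))%:R * injsum R pr (k + j) <= D.
      have N1 : 0 <= N by exact: ltW.
      rewrite /D e (_ : (2 * k - (k + j) = k - j)%N); last by clear; lia.
      apply: (@twisted_diag_injsum R P pr pr_prime (k + j) (k - j) M (Num.truncn N)); first by clear; lia.
        by rewrite -(ler_nat R); apply: le_trans NM; have /andP[] := truncn_itv N1.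
      by move=> g; rewrite truncn_ge_nat//; apply: fN; clear - jk; lia.
    rewrite e in v1 *.
    have := ler_wpM2l wT DD => DD'.
    have v2 : w * T * (((k + j) ^_ (k - j))%:R * injsum R pr (k + j)) - E * (M%:R * A ^+ (2 * k)) <= v by lra.
    by have := ler_wpM2l (cf0 (k + j)) v2; lra.
  have := mulr_ge0 wT D0 => wD.
  have v2 : 0 - E * (M%:R * A ^+ (2 * k)) <= v by lra.
  by have := ler_wpM2l (cf0 i) v2; lra.
have /choice[v hv] := H.
exists (\sum_i v i); split.
  apply: isint_ext (isint_sum (index_enum _) (P := predT) (fun i _ => (hv i).1)) => t.
  rewrite pweightE mulr_sumr; apply: eq_bigr => i _; ring.
apply: le_trans (ler_sum _ (fun i _ => (hv i).2)).
rewrite sumrB -mulr_suml sum_cf mul1r lerD2r.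
have kk : (k + j < (2 * k).+1)%N by lia.
by rewrite (bigD1 (Ordinal kk))//= eqxx lerDl; apply: sumr_ge0 => i ik; rewrite ifN//;
  apply: contra ik => /eqP e; apply/eqP/val_inj.
Qed.

(** The moment of order 8k is the plain second moment of the polynomial's power 4k; this is why
    products of up to 4k primes must stay below N. *)
Lemma isint_ppoly4 : exists v, isint T (fun t => win T J t * normc (ppoly t ^+ (4 * k)) ^+ 2) v /\
  v <= w * T * ((4 * k)`!%:R * S ^+ (4 * k)) + E * A ^+ (8 * k).
Proof.
have [v [hv v1]] := isint_pair T0 N0 JN (wf0 (m := 4 * k)) (wf0 (m := 4 * k)) (dN (leqnn _)) (dN (leqnn _)).
exists v; split.
  by apply: isint_ext hv => t; rewrite -ppolyX mul_cconj.
move: v1; rewrite !sum_wf// -exprD -/A -/E -/w -mulnDl ler_norml => /andP[_ v1].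
have wT : 0 <= w * T by rewrite mulr_ge0 ?(ltW T0)// ltW// winc_gt0.
have := ler_wpM2l wT (@diag_moment_le R P pr pr_prime pr_inj (4 * k)); rewrite -/S.
have <- : ((4 + 4) * k = 8 * k)%N by [].
lra.
Qed.

Lemma pweight4_le t : pweight t ^+ 4 <= normc (ppoly t ^+ (4 * k)) ^+ 2.
Proof.
have nX n : normc (ppoly t ^+ n) = normc (ppoly t) ^+ n.
  by elim: n => [|n IH]; rewrite ?expr0 ?ComplexField.Normc.normc1// !exprS normc_mul IH.
rewrite nX /pweight -!exprM.
have -> : (2 * k * 4 = 2 * (4 * k))%N by lia.
have -> : (4 * k * 2 = 2 * (4 * k))%N by lia.
rewrite !(exprM _ 2); apply: lerXn2r; rewrite ?nnegrE ?sqr_ge0//.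
rewrite -(real_normK (num_real _)).
by rewrite lerXn2r ?nnegrE ?normc_ge0//; exact: Re_le_normc.
Qed.
End PowerResonator.

(** * From weighted means to the measure of large values *)

Section MeasureLower.
Variable R : realType.
Implicit Types (t T N B : R).

Definition zpoly_large M T B : set R := [set t | T <= t <= 2 * T /\ B <= normc (zpoly M t)].

Lemma zpoly_large_measurable M T B : 0 < T -> (0 < M)%N -> 0 <= B -> measurable (zpoly_large M T B).
Proof.
move=> T0 M0 B0; have [v [[cf _] _]] := isint_zpoly_sq T0 M0.
have -> : zpoly_large M T B = `[T, 2 * T] `&`
   ((fun t => normc (zpoly M t) ^+ 2) @^-1` `[B ^+ 2, +oo[).
  apply/seteqP; split => t /=; rewrite !in_itv/= andbT ler_pXn2r ?nnegrE ?normc_ge0//.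
apply: measurableI; first exact: measurable_itv.
rewrite -[X in measurable X]setTI.
have mf : measurable_fun setT (fun t => normc (zpoly M t) ^+ 2).
  by apply: continuous_measurable_fun => x; exact: cf.
by apply: mf => //; exact: measurable_itv.
Qed.

Lemma young4 (x y a b : R) : 0 < a -> 0 < b -> 0 <= x -> 0 <= y ->
  x * y <= x ^+ 2 / (2 * a) + a * y ^+ 4 / (4 * b) + a * b / 4.
Proof.
move=> a0 b0 x0 y0.
have h1 : x * y <= x ^+ 2 / (2 * a) + a * y ^+ 2 / 2.
  rewrite -subr_ge0 (_ : _ - _ = (x - a * y) ^+ 2 / (2 * a)); last by field; rewrite gt_eqF.
  by rewrite divr_ge0 ?sqr_ge0// mulr_ge0// ltW.
have h2 : y ^+ 2 / 2 <= y ^+ 4 / (4 * b) + b / 4.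
  rewrite -subr_ge0 (_ : _ - _ = (y ^+ 2 - b) ^+ 2 / (4 * b)); last by field; rewrite gt_eqF.
  by rewrite divr_ge0 ?sqr_ge0// mulr_ge0// ltW.
have := ler_wpM2l (ltW a0) h2.
have -> : a * (y ^+ 4 / (4 * b) + b / 4) = a * y ^+ 4 / (4 * b) + a * b / 4 by ring.
have -> : a * (y ^+ 2 / 2) = a * y ^+ 2 / 2 by ring.
lra.
Qed.

(** The function integrated is the windowed (Re Z - B) W minus multiples of |Z|^2 and of the
    windowed H, where Z is the zeta polynomial. Outside the set of large values it is nonpositive;
    on it [young4] bounds it by ab/4. Its integral is at least p/2. Since the window is at most 1,
    its fourth power is bounded by the window itself. *)
Lemma young_measure M J T B (W H : R -> R) v1 v2 q2 q8 p Q2 Q8 :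
  0 < T -> (0 < M)%N -> 0 <= B ->
  isint T (fun t => win T J t * W t) v1 ->
  isint T (fun t => win T J t * (Re (zpoly M t) * W t)) v2 ->
  isint T (fun t => normc (zpoly M t) ^+ 2) q2 ->
  isint T (fun t => win T J t * H t) q8 ->
  (forall t, 0 <= W t) -> (forall t, W t ^+ 4 <= H t) ->
  0 < p -> p <= v2 - B * v1 -> 0 < Q2 -> q2 <= Q2 -> 0 < Q8 -> q8 <= Q8 ->
  ((p ^+ 4 / (2 * Q2 ^+ 2 * Q8))%:E <= lebesgue_measure (zpoly_large M T B))%E.
Proof.
move=> T0 M0 B0 h1 h2 hq2 hq8 W0 WH p0 pv Q20 q2Q Q80 q8Q.
(* With this a and the next b, each of the two subtracted moments costs at most p/4. *)
pose a := 2 * Q2 / p.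
pose b := a * Q8 / p.
have a0 : 0 < a by rewrite divr_gt0// mulr_gt0.
have b0 : 0 < b by rewrite divr_gt0// mulr_gt0.
have L0 : 0 < a * b / 4 by rewrite divr_gt0// mulr_gt0.
have hI := isintB (isintB (isintB h2 (isintZ B h1)) (isintZ (2 * a)^-1 hq2)) (isintZ (a / (4 * b)) hq8).
have mS := zpoly_large_measurable T0 M0 B0.
have H0 t : 0 <= H t by apply: le_trans (WH t); rewrite exprn_ge0.
have sub : zpoly_large M T B `<=` `[T, 2 * T] by move=> t [tT _]; rewrite /= in_itv.
have key := isint_le_measure T0 hI (ltW L0) mS sub.
have {}key : ((p / 2)%:E <= (a * b / 4)%:E * lebesgue_measure (zpoly_large M T B))%E.
  apply: le_trans (key _).
    rewrite lee_fin.
    have e1 : (2 * a)^-1 * q2 <= p / 4.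
      apply: (@le_trans _ _ ((2 * a)^-1 * Q2)).
        by rewrite ler_wpM2l// invr_ge0 mulr_ge0// ltW.
      by rewrite /a le_eqVlt; apply/orP; left; apply/eqP; field; rewrite !gt_eqF.
    have e2 : a / (4 * b) * q8 <= p / 4.
      apply: (@le_trans _ _ (a / (4 * b) * Q8)).
        by rewrite ler_wpM2l// divr_ge0 ?(ltW a0)// mulr_ge0// ltW.
      by rewrite /b le_eqVlt; apply/orP; left; apply/eqP; field; rewrite !gt_eqF.
    lra.
  move=> t tT.
  set z := zpoly M t; set om := win T J t.
  have om0 : 0 <= om := win_ge0 T J t; have om1 : om <= 1 := win_le1 T J t.
  have z0 : 0 <= normc z := normc_ge0 z.
  have Rz : Re z <= normc z by apply: le_trans (ler_norm _) (Re_le_normc _).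
  have i0 : 0 <= (2 * a)^-1 * normc z ^+ 2 by rewrite mulr_ge0 ?sqr_ge0// invr_ge0 mulr_ge0// ltW.
  have j0 : 0 <= a / (4 * b) * (om * H t).
    apply: mulr_ge0; last exact: mulr_ge0.
    by rewrite divr_ge0 ?(ltW a0)// mulr_ge0// ltW.
  have Wt0 : 0 <= W t by exact: W0.
  have wW : 0 <= om * W t by exact: mulr_ge0.
  rewrite indicE; have [tS|tS] := boolP (t \in zpoly_large M T B).
    rewrite mulr1.
    have y := young4 a0 b0 z0 wW.
    have w4 : (om * W t) ^+ 4 <= om * H t.
      rewrite exprMn; apply: ler_pM; [exact: exprn_ge0|exact: exprn_ge0| |exact: WH].
      by rewrite (exprS om 3) ler_piMr// exprn_ile1.
    have g1 : a * (om * W t) ^+ 4 / (4 * b) <= a / (4 * b) * (om * H t).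
      rewrite mulrAC ler_wpM2l// divr_ge0 ?(ltW a0)// mulr_ge0// ltW//.
    have g2 : normc z ^+ 2 / (2 * a) = (2 * a)^-1 * normc z ^+ 2 by rewrite mulrC.
    have g3 : om * (Re z * W t) <= normc z * (om * W t).
      by rewrite mulrCA; apply: ler_wpM2r.
    have g4 : 0 <= B * (om * W t) by exact: mulr_ge0.
    rewrite g2 in y.
    lra.
  rewrite mulr0.
  have zB : normc z < B.
    rewrite ltNge; apply: contra tS => h; rewrite inE; split => //.
  have g3 : om * (Re z * W t) <= B * (om * W t).
    by rewrite mulrCA; apply: ler_wpM2r => //; apply: le_trans Rz (ltW zB).
  lra.
have [r rE] : exists r, p ^+ 4 / (2 * Q2 ^+ 2 * Q8) = r by eexists.
have re : (a * b / 4) * r = p / 2.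
  by rewrite -rE /b /a; field; rewrite !gt_eqF.
rewrite rE -(@lee_pmul2l _ (a * b / 4)%:E) ?lte_fin//.
by rewrite -EFinM re.
Qed.

(** Since v1 <= 2x, the subtraction uses 2B of the factor 2B + 2; of the remaining 2x, one x covers
    e2 and the other is the margin. *)
Lemma resonance_margin (B x z v1 v2 e1 e2 : R) : 0 <= B ->
  v1 <= x + e1 -> e1 <= x -> z - e2 <= v2 -> e2 <= x -> (2 * B + 2) * x <= z ->
  x <= v2 - B * v1.
Proof.
move=> B0 h1 h2 h3 h4 h5; have b1 : v1 <= 2 * x by lra.
have := ler_wpM2l B0 b1; lra.
Qed.

Lemma young_ratio (w T X Q Y : R) : 0 < w -> 0 < T -> 0 < Q -> 0 < Y ->
  (w * T * X) ^+ 4 / (2 * (T * Q) ^+ 2 * (2 * (w * T * Y))) =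
  w ^+ 3 * T * X ^+ 4 / (4 * Q ^+ 2 * Y).
Proof. by move=> w0 T0 Q0 Y0; field; rewrite !gt_eqF. Qed.

Lemma ge1_scale (c x : R) : 1 <= x -> 1 <= c -> 1 <= c * x.
Proof. by move=> x1 c1; rewrite -[leLHS]mulr1; apply: ler_pM. Qed.

Lemma zpoly_sq_bound (T m : R) : 1 <= T -> 0 < m -> m <= 128 * T -> 0 <= 1 + ln m ->
  (T + 6 * m) * (1 + ln m) <= T * (769 * (1 + ln (128 * T))).
Proof.
move=> T1 m0 mT l0.
have lM : ln m <= ln (128 * T) by rewrite ler_ln ?posrE//; lra.
rewrite mulrA; apply: ler_pM; lra.
Qed.

Variables (P : finType) (pr : P -> nat).
Hypothesis pr_prime : forall p, prime (pr p).
Hypothesis pr_inj : injective pr.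

Lemma measure_lower (k j J M : nat) (N T B : R) :
  let A := \sum_p (Num.sqrt (pr p)%:R)^-1 in
  let S := \sum_p ((pr p)%:R)^-1 in
  let w := winc R J in
  let X := 'C(2 * k, k)%:R / 2 ^+ (2 * k) * (k`!%:R * S ^+ k) in
  let Q := 769 * (1 + ln (128 * T)) in
  1 <= T -> 1 <= N -> 32 * J%:R * N < T ->
  (forall m (f : {ffun 'I_m -> P}), (m <= 4 * k)%N -> (nf pr f)%:R <= N) ->
  (j <= k)%N -> N <= M%:R -> M%:R <= 128 * T -> 1 <= S -> 0 <= B ->
  A ^+ (2 * k) <= N ^+ 2 -> A ^+ (8 * k) <= N ^+ 2 ->
  offdiag J N T * (N ^+ 2 * M%:R) <= w * T * X ->
  offdiag J N T * (N ^+ 2 * M%:R) <= w * T ->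
  (2 * B + 2) * X <=
    'C(2 * k, k + j)%:R / 2 ^+ (2 * k) * (((k + j) ^_ (k - j))%:R * injsum R pr (k + j)) ->
  ((w ^+ 3 * T * X ^+ 4 / (4 * Q ^+ 2 * ((4 * k)`!%:R * S ^+ (4 * k))))%:E <=
     lebesgue_measure (zpoly_large M T B))%E.
Proof.
move=> A S w X Q T1 N1 JN fN jk NM M128 S1 B0 A2 A8 err1 err2 main.
have T0 : 0 < T by exact: lt_le_trans ltr01 T1.
have N0 : 0 < N by exact: lt_le_trans ltr01 N1.
have M1 : 1 <= M%:R :> R by exact: le_trans NM.
have M0 : (0 < M)%N by rewrite -(ler_nat R).
have w0 : 0 < w by exact: winc_gt0.
have E0 : 0 <= offdiag J N T.
  by rewrite mulr_ge0 ?exprn_ge0 ?mulr_ge0 ?divr_ge0 ?invr_ge0 ?(ltW N0) ?(ltW T0).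
have S0 : 0 < S by exact: lt_le_trans ltr01 S1.
have X0 : 0 < X.
  rewrite mulr_gt0 ?divr_gt0 ?exprn_gt0 ?mulr_gt0 ?ltr0n ?fact_gt0 ?exprn_gt0//.
  by rewrite bin_gt0 leq_pmull.
have wT : 0 < w * T by exact: mulr_gt0.
have wTX : 0 < w * T * X by exact: mulr_gt0.
have [v1 [h1 l1]] := isint_pweight pr_prime pr_inj T0 N0 JN fN.
have [v2 [h2 l2]] := isint_zeta_pweight pr_prime T0 N0 JN fN jk NM.
have [q8 [h8 l8]] := isint_ppoly4 pr_prime pr_inj T0 N0 JN fN.
have [q2 [hq2 l2']] := isint_zpoly_sq T0 M0.
rewrite -/A -/S -/w -/X in l1 l2 l8.
have N2 : 0 <= N ^+ 2 by exact: sqr_ge0.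
have a1 : offdiag J N T * A ^+ (2 * k) <= w * T * X.
  apply: le_trans err1; apply: ler_wpM2l => //; apply: le_trans A2 _.
  by rewrite ler_peMr.
have a2 : offdiag J N T * (M%:R * A ^+ (2 * k)) <= w * T * X.
  apply: le_trans err1; apply: ler_wpM2l => //; rewrite mulrC; exact: ler_wpM2r.
have a8 : offdiag J N T * A ^+ (8 * k) <= w * T.
  apply: le_trans err2; apply: ler_wpM2l => //; apply: le_trans A8 _.
  by rewrite ler_peMr.
set Y := (4 * k)`!%:R * S ^+ (4 * k) in l8 *.
have Y1 : 1 <= Y.
  rewrite /Y -[leLHS]mulr1; apply: ler_pM => //; last exact: exprn_ege1.
  by rewrite ler1n fact_gt0.
have Y0 : 0 < Y by exact: lt_le_trans Y1.
have lT : 0 <= ln (128 * T) by rewrite ln_ge0// ge1_scale// ler1n.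
have Q0 : 0 < Q by apply: mulr_gt0; [rewrite ltr0n|exact: ltr_wpDr].
have qQ : q2 <= T * Q.
  apply: le_trans l2' _; apply: zpoly_sq_bound => //; first by rewrite ltr0n.
  by rewrite addr_ge0// lnn_ge0.
have q8Q : q8 <= 2 * (w * T * Y).
  apply: le_trans l8 _; rewrite mulr_natl mulr2n lerD2l; apply: le_trans a8 _.
  by rewrite ler_peMr// ltW.
have pv : w * T * X <= v2 - B * v1.
  apply: (resonance_margin B0 l1 a1 l2 a2).
  by rewrite mulrCA; apply: ler_wpM2l main; exact: ltW.
have TQ0 : 0 < T * Q by exact: mulr_gt0.
have wTY : 0 < 2 * (w * T * Y) by apply: mulr_gt0; [rewrite ltr0n|exact: mulr_gt0].
have := young_measure T0 M0 B0 h1 h2 hq2 h8 (pweight_ge0 pr k) (pweight4_le pr k T0 N0 JN) wTX pv TQ0 qQ wTY q8Q.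
by rewrite young_ratio.
Qed.
End MeasureLower.

(** * The choice of parameters *)

Section Numerics.
Variable R : realType.
Implicit Types (x y B S U : R) (n k j : nat).

(** One step of repeated squaring, with the value rounded down to a convenient b. *)
Lemma expR_sqr_ge x (a b : R) : 0 <= a -> a <= expR x -> b <= a ^+ 2 -> b <= expR (2 * x).
Proof.
move=> a0 ax ba; apply: le_trans ba _.
by rewrite mulrC expRM_natr lerXn2r ?nnegrE ?expR_ge0.
Qed.

(** Six squarings of 1 + x <= exp x at x = 141/12800. The precision is dictated by 256^k = exp(8k ln
    2) <= exp((282/50) k) in [moment_ratio_ge]. *)
Lemma ln2_le : ln (2 : R) <= 141 / 200.
Proof.
rewrite -[leRHS]expRK ler_ln ?posrE ?expR_gt0//.
pose x : R := 141 / (128 * 100).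
have n2 : 5223 / 5000 <= ((1 + x) ^+ 2) ^+ 2 by rewrite /x !expr2; clear; lra.
have n3 : 5455 / 5000 <= (5223 / 5000 : R) ^+ 2 by clear; rewrite expr2; lra.
have n4 : 5951 / 5000 <= (5455 / 5000 : R) ^+ 2 by clear; rewrite expr2; lra.
have n5 : 7082 / 5000 <= (5951 / 5000 : R) ^+ 2 by clear; rewrite expr2; lra.
have n6 : 2 <= (7082 / 5000 : R) ^+ 2 by clear; rewrite expr2; lra.
have x0 : 0 <= 1 + x by rewrite /x; clear; lra.
have p n m : 0 <= (n%:R / m%:R : R) by exact: divr_ge0.
have h1 := expR_sqr_ge x0 (expR_ge1Dx x) (lexx _).
have h2 := expR_sqr_ge (sqr_ge0 _) h1 n2.
have h3 := expR_sqr_ge (p _ _) h2 n3.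
have h4 := expR_sqr_ge (p _ _) h3 n4.
have h5 := expR_sqr_ge (p _ _) h4 n5.
have h6 := expR_sqr_ge (p _ _) h5 n6.
rewrite (_ : 141 / 200 = 2 * (2 * (2 * (2 * (2 * (2 * x))))))// /x.
by clear; field.
Qed.

(** Five squarings from the argument -7/128 give exp(-7/4) >= 4/25. The number 25/4 is the minimum
    of u over the range of V. *)
Lemma ln_25_4_ge : 7 / 4 <= ln (25 / 4 : R).
Proof.
rewrite -[leLHS]expRK ler_ln ?posrE ?expR_gt0//.
pose x : R := - (7 / 128).
have n1 : 893 / 1000 <= (1 + x) ^+ 2 by rewrite /x expr2; clear; lra.
have n2 : 797 / 1000 <= (893 / 1000 : R) ^+ 2 by clear; rewrite expr2; lra.
have n3 : 635 / 1000 <= (797 / 1000 : R) ^+ 2 by clear; rewrite expr2; lra.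
have n4 : 403 / 1000 <= (635 / 1000 : R) ^+ 2 by clear; rewrite expr2; lra.
have n5 : 16 / 100 <= (403 / 1000 : R) ^+ 2 by clear; rewrite expr2; lra.
have x0 : 0 <= 1 + x by rewrite /x; clear; lra.
have p n m : 0 <= (n%:R / m%:R : R) by exact: divr_ge0.
have h1 := expR_sqr_ge x0 (expR_ge1Dx x) n1.
have h2 := expR_sqr_ge (p _ _) h1 n2.
have h3 := expR_sqr_ge (p _ _) h2 n3.
have h4 := expR_sqr_ge (p _ _) h3 n4.
have h5 := expR_sqr_ge (p _ _) h4 n5.
have e : 2 * (2 * (2 * (2 * (2 * x)))) = - (7 / 4) by rewrite /x; clear; field.
clear - e h5.
rewrite e expRN in h5; rewrite -[leLHS]invrK -[leRHS]invrK lef_pV2 ?posrE ?invr_gt0 ?expR_gt0//; last lra.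
Qed.

(** The upper Stirling bound n! <= e n (n/e)^n; the induction step is (1 + 1/n)^(n+1) >= e. *)
Lemma fact_exp_le n : n.+1`!%:R * expR n.+1%:R <= expR 1 * n.+1%:R * n.+1%:R ^+ n.+1 :> R.
Proof.
elim: n => [|n IH]; first by rewrite mul1r expr1n mulr1 mulr1.
have n0 : 0 < n.+1%:R :> R by rewrite ltr0n.
have m0 : 0 < n.+2%:R :> R by rewrite ltr0n.
have h : expR 1 * n.+1%:R * n.+1%:R ^+ n.+1 <= n.+2%:R ^+ n.+2 :> R.
  rewrite -mulrA -exprS.
  have E (x : R) m : 0 < x -> x ^+ m = expR (ln x * m%:R).
    by move=> x0; rewrite expRM_natr lnK.
  rewrite !E// -expRD ler_expR.
  have := @ln_succ_ge R n.+1 isT; rewrite -(ler_pM2r m0) mulVf ?gt_eqF//; lra.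
have e2 : expR n.+2%:R = expR 1 * expR n.+1%:R :> R.
  by rewrite -expRD -[n.+2]add1n natrD.
rewrite factS natrM e2.
rewrite (_ : _ * _ * _ = (n.+2%:R * expR 1) * ((n.+1)`!%:R * expR n.+1%:R)); last by ring.
apply: le_trans (ler_wpM2l _ IH) _; first by rewrite mulr_ge0 ?expR_ge0.
apply: le_trans (ler_wpM2l _ h) _; first by rewrite mulr_ge0 ?expR_ge0.
by rewrite (mulrC (expR 1)).
Qed.

Lemma central_bin_ge k : (4 ^ k <= (2 * k + 1) * 'C(2 * k, k))%N.
Proof.
elim: k => [|k IH]; first by rewrite bin0.
have e : (k.+1 * 'C(2 * k.+1, k.+1) = 2 * (2 * k + 1) * 'C(2 * k, k))%N.
  have h1 := mul_bin_diag (2 * k).+2 k; have h2 := mul_bin_down (2 * k).+1 k.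
  have h3 : ((2 * k).+1 - k = k.+1)%N by lia.
  have -> : (2 * k.+1 = (2 * k).+2)%N by lia.
  rewrite /= h3 in h1 h2; rewrite -h1; lia.
rewrite -(leq_pmul2l (ltn0Sn k)) mulnCA e expnS.
move: IH; move: (4 ^ k)%N ('C(2 * k, k))%N => p b IH.
apply: (@leq_trans (k.+1 * (4 * ((2 * k + 1) * b)))); last by nia.
by rewrite !leq_mul2l IH !orbT.
Qed.

(** (4k)!/k!^4 is the product of one binomial coefficient of 4k and the square of one of 2k, hence
    at most 2^(4k) 2^(4k). *)
Lemma fact4_le k : ((4 * k)`! <= 256 ^ k * k`! ^ 4)%N.
Proof.
have b1 := @bin_fact (4 * k) (2 * k); have b2 := @bin_fact (2 * k) k.
have e1 : (4 * k - 2 * k = 2 * k)%N by lia.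
have e2 : (2 * k - k = k)%N by lia.
rewrite e1 e2 in b1 b2.
have {}b1 := b1 (ltac:(lia)); have {}b2 := b2 (ltac:(lia)).
have c1 := bin_le_exp (4 * k) (2 * k); have c2 := bin_le_exp (2 * k) k.
have e3 : (256 ^ k = 2 ^ (4 * k) * (2 ^ (2 * k)) ^ 2)%N.
  by rewrite -!expnM -expnD (_ : 4 * k + 2 * k * 2 = 8 * k)%N ?expnM//; lia.
rewrite -b1 -b2 e3.
have -> : ('C(2 * k, k) * (k`! * k`!) * ('C(2 * k, k) * (k`! * k`!)) = 'C(2 * k, k) ^ 2 * k`! ^ 4)%N.
  by ring.
by rewrite mulnA leq_mul// leq_mul// leq_exp2r.
Qed.

Lemma bin_split k j : (j <= k)%N ->
  [/\ ('C(2 * k, k) * (k`! * k`!) = (2 * k)`!)%N,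
      ('C(2 * k, k + j) * ((k + j)`! * (k - j)`!) = (2 * k)`!)%N,
      ((k + j) ^_ (k - j) * (2 * j)`! = (k + j)`!)%N &
      ((k - j) ^ j * (k - j)`! <= k`!)%N].
Proof.
move=> jk; split.
- have := @bin_fact (2 * k) k; rewrite (_ : 2 * k - k = k)%N; last by lia.
  by apply; lia.
- have := @bin_fact (2 * k) (k + j); rewrite (_ : 2 * k - (k + j) = k - j)%N; last by lia.
  by apply; lia.
- have := @ffact_fact (k + j) (k - j); rewrite (_ : k + j - (k - j) = 2 * j)%N; last by lia.
  by apply; lia.
- rewrite -(@ffact_fact k j)// leq_mul2r; apply/orP; right.
  suff H i : (i <= j)%N -> ((k - j) ^ i <= k ^_ i)%N by exact: H.
  elim: i => // i IH ij; rewrite ffactnSr expnSr leq_mul ?IH ?(ltnW ij)//; lia.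
Qed.

Lemma expR_le_1B k (d : R) : 0 <= d -> d <= 2^-1 -> expR (- (4 * k%:R * d)) <= (1 - d) ^+ (2 * k).
Proof.
move=> d0 d2; have h : expR (- (2 * d)) <= 1 - d.
  rewrite -[leRHS]invrK expRN lef_pV2 ?posrE ?expR_gt0 ?invr_gt0//; last lra.
  apply: le_trans (expR_ge1Dx _); rewrite -[leLHS]mul1r ler_pdivrMr; last lra.
  nra.
rewrite (_ : - (4 * k%:R * d) = - (2 * d) * (2 * k)%:R); last by rewrite natrM; ring.
by rewrite expRM_natr lerXn2r ?nnegrE ?expR_ge0//; lra.
Qed.

(* The ratio of the two moments is S^j k!/((k-j)! (2j)!) up to the loss d from
   repeated primes, and it is at least e^(2j)/(2ej) as soon as 4j^2 <= (k-j)S. *)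
Lemma power_gain k j (S d B U : R) : (0 < j <= k)%N -> 1 <= S ->
  4 * j%:R ^+ 2 <= (k - j)%:R * S -> 0 <= d -> d <= 2^-1 ->
  (S * (1 - d)) ^+ (k + j) <= U -> 0 <= B ->
  (2 * B + 2) * (expR 1 * (2 * j)%:R) * expR (4 * k%:R * d) <= expR (2 * j)%:R ->
  (2 * B + 2) * ('C(2 * k, k)%:R / 2 ^+ (2 * k) * (k`!%:R * S ^+ k)) <=
  'C(2 * k, k + j)%:R / 2 ^+ (2 * k) * (((k + j) ^_ (k - j))%:R * U).
Proof.
move=> /andP[j0 jk] S1 jS d0 d2 dU B0 gain.
have S0 : 0 < S by exact: lt_le_trans S1.
have d1 : 0 <= 1 - d by lra.
have d1' : 1 - d <= 1 by lra.
have kj2 : (k + j <= 2 * k)%N by rewrite mul2n -addnn leq_add2l.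
have [b1 b2 b3 b4] := bin_split jk.
have [F FE] : {F | F = (2 * k)`!} by eexists.
rewrite -FE in b1 b2.
have f0 n : 0 < n`!%:R :> R by rewrite ltr0n fact_gt0.
have p2 : 0 < 2 ^+ (2 * k) :> R by rewrite exprn_gt0.
have -> : 'C(2 * k, k)%:R / 2 ^+ (2 * k) * (k`!%:R * S ^+ k) = F%:R / 2 ^+ (2 * k) * (S ^+ k / k`!%:R).
  by rewrite -b1 !natrM; field; rewrite !gt_eqF.
have -> : 'C(2 * k, k + j)%:R / 2 ^+ (2 * k) * (((k + j) ^_ (k - j))%:R * U) =
   F%:R / 2 ^+ (2 * k) * (U / ((k - j)`!%:R * (2 * j)`!%:R)).
  by rewrite -b2 -b3 !natrM; field; rewrite !gt_eqF.
rewrite mulrCA ler_wpM2l ?divr_ge0 ?(ltW p2)//.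
rewrite mulrA ler_pdivrMr// mulrAC ler_pdivlMr ?mulr_gt0//.
have U1 : ((k - j)%:R * S) ^+ j * (1 - d) ^+ (2 * k) * ((k - j)`!%:R * S ^+ k) <= U * k`!%:R.
  have db : (1 - d) ^+ (2 * k) <= (1 - d) ^+ (k + j).
    by apply: ler_wiXn2l.
  have b4' : (k - j)%:R ^+ j * (k - j)`!%:R <= k`!%:R :> R by rewrite -natrX -natrM ler_nat.
  apply: (@le_trans _ _ ((S * (1 - d)) ^+ (k + j) * k`!%:R)); last by rewrite ler_wpM2r.
  rewrite !exprMn exprD.
  rewrite (_ : _ * _ * _ * _ = S ^+ k * S ^+ j * ((1 - d) ^+ (2 * k) * ((k - j)%:R ^+ j * (k - j)`!%:R))); last by ring.
  rewrite -[leRHS]mulrA; apply: ler_wpM2l.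
    by apply: mulr_ge0; apply: exprn_ge0; exact: ltW.
  apply: ler_pM; [exact: exprn_ge0| |exact: db|exact: b4'].
  by apply: mulr_ge0; [exact: exprn_ge0|exact: ler0n].
apply: le_trans U1.
(* The assumption (2j)^2 <= (k-j) S, raised to the power j, is set against the (2j)^(2j) of
   Stirling's bound; what is left is exp(2j). *)
have j4 : (2 * j)%:R ^+ (2 * j) <= ((k - j)%:R * S) ^+ j.
  rewrite exprM lerXn2r ?nnegrE ?sqr_ge0 ?mulr_ge0 ?(ltW S0)//.
  by rewrite (_ : (2 * j)%:R ^+ 2 = 4 * j%:R ^+ 2 :> R)//; rewrite natrM; ring.
have E4 := expR_le_1B k d0 d2.
have F2 : (2 * j)`!%:R * expR (2 * j)%:R <= expR 1 * (2 * j)%:R * (2 * j)%:R ^+ (2 * j) :> R.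
  have := fact_exp_le (2 * j).-1; rewrite prednK// muln_gt0//.
have X0 : 0 < (k - j)`!%:R * S ^+ k by rewrite mulr_gt0// exprn_gt0.
rewrite [leLHS](_ : _ = (2 * B + 2) * (2 * j)`!%:R * ((k - j)`!%:R * S ^+ k)); last by move: (2 * j)`! (k - j)`! => a b; ring.
rewrite ler_pM2r//.
apply: (@le_trans _ _ ((2 * j)%:R ^+ (2 * j) * expR (- (4 * k%:R * d)))); last first.
  by apply: ler_pM; rewrite ?exprn_ge0 ?expR_ge0.
have B2 : 0 <= 2 * B + 2 by lra.
have e0 : 0 < expR (2 * j)%:R :> R := expR_gt0 _.
rewrite -(ler_pM2r e0) -[leLHS]mulrA; apply: le_trans (ler_wpM2l B2 F2) _.
have Z0 : 0 <= (2 * j)%:R ^+ (2 * j) :> R by exact: exprn_ge0.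
have := ler_wpM2r Z0 gain.
have := expR_gt0 (4 * k%:R * d); rewrite expRN.
move: (expR (4 * k%:R * d)) (expR (2 * j)%:R) (expR 1) ((2 * j)%:R ^+ (2 * j)) => G H e1 Z G0 h.
rewrite [leRHS]mulrAC ler_pdivlMr//; lra.
Qed.
End Numerics.

(** * Size of the degree, of the prime sum and of the final exponent *)

Section PrimeSum.
Variable R : realType.
Implicit Types (V L k v u x c X : R) (n : nat).

(** Multiplying by x turns the quadratic term into 6 (0.51 V + c)^2, and 6 * 0.51^2 = 1.5606 <
    63/40. The other terms are O(V) when x <= X and fit in the gap for V large. *)
Lemma degree_le V c X x k : 1 <= V -> 0 <= c -> 0 < x -> x <= X ->
  125 * (5 * c + 4 * c ^+ 2 + X * (c + 2)) <= V ->
  k <= 51 / 100 * V + c + 1 + 4 * (51 / 100 * V + c) ^+ 2 / (2 / 3 * x) ->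
  k * x <= 63 / 40 * V ^+ 2.
Proof.
move=> V1 c0 x0 xX hV hk.
have X0 : 0 <= X by lra.
have h1 : k * x <= (51 / 100 * V + c + 1) * x + 6 * (51 / 100 * V + c) ^+ 2.
  have := ler_wpM2r (ltW x0) hk; congr (_ <= _).
  by field; rewrite gt_eqF.
have h2 : (51 / 100 * V + c + 1) * x <= V * (X * (c + 2)).
  apply: (@le_trans _ _ ((V * (c + 2)) * X)); last by rewrite mulrA [leRHS]mulrAC.
  apply: ler_pM => //; [lra|exact: ltW|].
  have := mulr_ge0 c0 (_ : 0 <= V - 1); rewrite subr_ge0 => /(_ V1); lra.
have h3 : V * (125 * (5 * c + 4 * c ^+ 2 + X * (c + 2))) <= V * V.
  by rewrite ler_wpM2l//; lra.
have h4 : c ^+ 2 <= V * c ^+ 2 by rewrite ler_peMl// sqr_ge0.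
have h5 : 0 <= V * c by apply: mulr_ge0 => //; lra.
have h6 : 0 <= V * (X * (c + 2)) by rewrite !mulr_ge0//; lra.
have h7 : 0 <= V * c ^+ 2 by rewrite mulr_ge0 ?sqr_ge0//; lra.
clear - h1 h2 h3 h4 h5 h6 h7; rewrite !mulrDr in h3; rewrite !expr2 in h1 h3 h4 h7 *; lra.
Qed.

(** The case of large V, tightest at x = 7/4. With p = exp(2x/3), the right side is at least
    (704/630) v u x - 1, where u x >= (35/12) p, so about 3.26 v p; the left side is at most
    (301/96) v p, about 3.14 v p. The bound v p >= 100 pays for the 1. *)
Lemma ratio_small V L k v u x c5 : 0 < V -> 0 < k -> L = 8 * V ^+ 2 * v * u ->
  u = expR x -> 7 / 4 <= x -> k * x <= 63 / 40 * V ^+ 2 -> 100 <= v -> 0 <= c5 ->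
  100 * c5 <= v -> expR (2 / 3 * x + 4 / v) * (3 * v + c5) <= 22 / 100 * L / k - 1.
Proof.
move=> V0 k0 LE uE x74 hk v100 c50 hc5.
have v0 : 0 < v by clear - v100; lra.
have x0 : 0 < x by clear - x74; lra.
have e1 : expR (4 / v) <= 25 / 24.
  have iv : 4 / v <= 1 / 25 by rewrite ler_pdivrMr//; clear - v100; lra.
  have := expR_ge1Dx (- (4 / v)); rewrite expRN => h.
  rewrite -[leLHS]invrK -[leRHS]invrK lef_pV2 ?posrE ?invr_gt0 ?expR_gt0//.
  by move: h iv; clear; lra.
have e3 : 5 / 3 <= expR (x / 3).
  have h : 1 + x / 6 <= expR (x / 6) := expR_ge1Dx _.
  have h0 : 0 <= 1 + x / 6 by clear - x0; lra.
  rewrite (_ : x / 3 = 2 * (x / 6)); last by field.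
  apply: (expR_sqr_ge h0 h).
  have : (1 + 7 / 24) ^+ 2 <= (1 + x / 6) ^+ 2 by rewrite lerXn2r ?nnegrE//; clear - x74; lra.
  by rewrite !expr2; clear; lra.
have uE2 : u = expR (2 / 3 * x) * expR (x / 3) by rewrite uE -expRD; congr expR; field.
have p0 : 1 <= expR (2 / 3 * x) by rewrite -[leLHS]expR0 ler_expR; clear - x0; lra.
rewrite expRD; set p := expR (2 / 3 * x) in uE2 p0 *.
have k1 : 40 / 63 * x / V ^+ 2 <= k^-1.
  rewrite -[leRHS]div1r ler_pdivlMr// mulrAC ler_pdivrMr ?exprn_gt0//.
  clear - hk; lra.
have u0 : 0 < u by rewrite uE expR_gt0.
have L0 : 0 <= 22 / 100 * L.
  by rewrite LE mulr_ge0// mulr_ge0 ?(ltW u0)// mulr_ge0 ?(ltW v0)// mulr_ge0// sqr_ge0.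
have h1 : 22 / 100 * (8 * v * u) * (40 / 63 * x) <= 22 / 100 * L / k.
  apply: le_trans (ler_wpM2l L0 k1); rewrite LE le_eqVlt; apply/orP; left; apply/eqP.
  by field; rewrite gt_eqF.
have h2 : p * (5 / 3 * (7 / 4)) <= u * x.
  rewrite uE2 -[leRHS]mulrA ler_wpM2l ?(le_trans ler01 p0)//.
  by apply: ler_pM => //; rewrite ?divr_ge0.
have h3 : v * (p * (5 / 3 * (7 / 4))) <= v * (u * x) by rewrite ler_wpM2l// ltW.
have h4 : p * expR (4 / v) * (3 * v + c5) <= p * (25 / 24) * (301 / 100 * v).
  apply: ler_pM.
  - by rewrite mulr_ge0 ?expR_ge0// (le_trans ler01 p0).
  - by clear - v0 c50; lra.
  - by rewrite ler_wpM2l// (le_trans ler01 p0).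
  - by clear - hc5; lra.
have h5 : 100 * 1 <= v * p by apply: ler_pM.
clear - h1 h3 h4 h5.
rewrite (_ : 22 / 100 * (8 * v * u) * (40 / 63 * x) = 704 / 630 * (v * (u * x))) in h1; last by field.
rewrite (_ : p * (25 / 24) * (301 / 100 * v) = 301 / 96 * (v * p)) in h4; last by field.
rewrite (_ : v * (p * (5 / 3 * (7 / 4))) = 35 / 12 * (v * p)) in h3; last by field.
lra.
Qed.

(** The case of large x: u = e^x exceeds exp(2x/3) by a factor exp(x/3), which outgrows the
    constants as soon as k = O(V^2). *)
Lemma ratio_large V L k v u x c5 c3 : 0 < V -> 0 < k -> L = 8 * V ^+ 2 * v * u ->
  u = expR x -> k <= c3 * V ^+ 2 -> 1 <= v -> 1 <= c3 -> 0 <= c5 ->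
  3 * (4 + ln (c3 * (3 + c5))) <= x ->
  expR (2 / 3 * x + 4 / v) * (3 * v + c5) <= 22 / 100 * L / k - 1.
Proof.
move=> V0 k0 LE uE hk v1 c31 c50 hx.
have v0 : 0 < v := lt_le_trans ltr01 v1.
have c30 : 0 < c3 := lt_le_trans ltr01 c31.
have u0 : 0 < u by rewrite uE expR_gt0.
have cc : 0 < c3 * (3 + c5) by rewrite mulr_gt0// ltr_wpDr.
have k1 : (c3 * V ^+ 2)^-1 <= k^-1 by rewrite lef_pV2 ?posrE ?mulr_gt0 ?exprn_gt0.
have L0 : 0 <= 22 / 100 * L.
  by rewrite LE mulr_ge0// mulr_ge0 ?(ltW u0)// mulr_ge0 ?(ltW v0)// mulr_ge0// sqr_ge0.
have h1 : 176 / 100 * (v * u) / c3 <= 22 / 100 * L / k.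
  apply: le_trans (ler_wpM2l L0 k1); rewrite LE le_eqVlt; apply/orP; left; apply/eqP.
  by field; rewrite !gt_eqF.
have e4 : expR (2 / 3 * x + 4 / v) * (c3 * (3 + c5)) <= u.
  rewrite -[c3 * _]lnK ?posrE// -expRD uE ler_expR.
  have : 4 / v <= 4 by rewrite ler_pdivrMr//; clear - v1; lra.
  by clear - hx; lra.
have h2 : expR (2 / 3 * x + 4 / v) * (3 * v + c5) <= v * u / c3.
  rewrite ler_pdivlMr//; apply: le_trans (ler_wpM2l (ltW v0) e4).
  rewrite -[leLHS]mulrA [leRHS]mulrCA ler_wpM2l ?expR_ge0//.
  rewrite [leLHS]mulrC [leRHS]mulrCA ler_wpM2l ?(ltW c30)// mulrDr.
  have : c5 <= v * c5 by rewrite ler_peMl.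
  by clear; lra.
have x0 : 0 <= 2 / 3 * x + 4 / v.
  have l0 : 0 <= ln (c3 * (3 + c5)).
    apply: ln_ge0; rewrite -[leLHS]mulr1; apply: ler_pM => //; clear - c50; lra.
  have : 0 <= 4 / v by rewrite divr_ge0// ltW.
  by clear - l0 hx; lra.
have h3 : 3 <= expR (2 / 3 * x + 4 / v) * (3 * v + c5).
  rewrite -[leLHS]mul1r; apply: ler_pM => //; last by clear - v1 c50; lra.
  by rewrite -[leLHS]expR0 ler_expR.
clear - h1 h2 h3; rewrite -mulrA in h1; lra.
Qed.

(** The hypothesis makes ln N at least exp(2x/3 + 4/v) times ln(M+1). Hence ln ln N exceeds ln
    ln(M+1) by 2x/3 plus 4/v, and the latter pays for Mertens' error 12/ln(M+1). *)
Lemma recip_primes_ge v x c Z : 1 <= v -> 0 <= x -> 0 <= c ->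
  expR (2 / 3 * x + 4 / v) * (3 * v + (c + 1)) <= Z - 1 ->
  let M := Num.truncn (expR (c + 3 * v)) in let N := Num.truncn (expR Z) in
  (1 < M <= N)%N /\
  2 / 3 * x <= \sum_(M <= n < N) (if prime n.+1 then (n.+1%:R)^-1 else 0).
Proof.
move=> v1 x0 c0 hZ M N.
have y0 : 0 <= c + 3 * v by lra.
have e0 : 0 <= 2 / 3 * x + 4 / v.
  have : 0 <= 4 / v by rewrite divr_ge0//; lra.
  lra.
have hZ2 : 3 * v + (c + 1) <= Z - 1.
  apply: le_trans hZ; rewrite -[leLHS]mul1r ler_wpM2r//; first lra.
  by rewrite -[leLHS]expR0 ler_expR.
have MN : (1 < M <= N)%N.
  apply/andP; split; last by apply: le_truncn; rewrite ler_expR; lra.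
  rewrite truncn_gt_nat; have := expR_ge1Dx (c + 3 * v); lra.
split=> //; apply: le_trans (sum_recip_prime_ge R MN).
have /andP[a1 a2] := ln_truncS_bounds y0.
have b1 : Z - 1 <= ln (N%:R : R) by apply: ln_trunc_ge; lra.
rewrite -/M in a1 a2.
have i1 : 12 / ln (M.+1%:R : R) <= 4 / v.
  rewrite (_ : 4 / v = 12 / (3 * v)); last by field; rewrite gt_eqF//; lra.
  by rewrite ler_wpM2l// lef_pV2 ?posrE//; lra.
have i2 : 2 / 3 * x + 4 / v + ln (ln (M.+1%:R : R)) <= ln (ln (N%:R : R)).
  have l0 : 0 < ln (M.+1%:R : R) by lra.
  rewrite -[X in X + _ <= _]expRK -lnM ?posrE ?expR_gt0// ler_ln ?posrE ?mulr_gt0 ?expR_gt0//; last lra.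
  apply: le_trans b1; apply: le_trans hZ.
  by rewrite ler_wpM2l ?expR_ge0//; lra.
lra.
Qed.

(** With t = V/x, the quadratic part of k costs about 8.83 t^2 x and its linear part about 2.89 t x.
    The latter is at most 1.057 t^2 x + 2x, and 2x <= 2l is where two powers of ln T are lost. What
    remains of 10 t^2 x, using x >= 7/4, absorbs the cross term c t. *)
Lemma cost_le (V c x l k : R) : 0 <= V -> 0 <= c -> 7 / 4 <= x -> x <= l ->
  k <= 51 / 100 * V + c + 1 + 4 * (51 / 100 * V + c) ^+ 2 / (2 / 3 * x) ->
  283 / 50 * k <= 10 * (V ^+ 2 / x) + 2 * l + 6 * (c + 1) + 60 * (60 * c ^+ 2).
Proof.
move=> V0 c0 x74 xl hk.
have x0 : 0 < x by lra.
pose t := V / x.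
have Vt : V = t * x by rewrite /t divfK ?gt_eqF.
have t0 : 0 <= t by rewrite divr_ge0// ltW.
have E1 : V ^+ 2 / x = t ^+ 2 * x by rewrite Vt; field; rewrite gt_eqF.
have E2 : 4 * (51 / 100 * V + c) ^+ 2 / (2 / 3 * x) =
    6 * (51 / 100) ^+ 2 * (t ^+ 2 * x) + 6 * (51 / 50) * (c * t) + 6 * (c ^+ 2 / x).
  by rewrite Vt; field; rewrite gt_eqF.
have E3 : c ^+ 2 / x <= c ^+ 2 by rewrite ler_pdivrMr// ler_peMr ?sqr_ge0//; lra.
rewrite E1; rewrite E2 in hk.
have q1 : 0 <= x * (1057 / 1000 * t ^+ 2 - 2887 / 1000 * t + 2).
  apply: mulr_ge0; first lra.
  have := sqr_ge0 (1057 / 1000 * t - 2887 / 2000); rewrite !expr2; lra.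
have q2 : 0 <= (2 / 5 * t - 50 * c) ^+ 2 by exact: sqr_ge0.
have q3 : t ^+ 2 * (7 / 4) <= t ^+ 2 * x by rewrite ler_wpM2l ?sqr_ge0.
rewrite Vt in hk.
rewrite (expr2 (51 / 100)) in hk.
rewrite !expr2 in hk q1 q2 q3 E3 *.
move: (c * c / x) E3 hk => c2 E3 hk.
have ct := mulr_ge0 c0 t0.
have tx := mulr_ge0 t0 (ltW x0); have t2 := mulr_ge0 t0 t0; have c20 := mulr_ge0 c0 c0.
clear Vt E1 E2; lra.
Qed.
End PrimeSum.

(** * Size of the moments of the prime polynomial *)

Section MomentBounds.
Variable R : realType.
Implicit Types (V L T N v u x c X B : R).

Lemma central_bin_ratio_ge k :
  (2 * k%:R + 1)^-1 <= 'C(2 * k, k)%:R / 2 ^+ (2 * k) :> R.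
Proof.
have k0 : 0 < 2 * k%:R + 1 :> R by rewrite ltr_wpDl ?mulr_ge0.
have b : 2 ^+ (2 * k) <= (2 * k%:R + 1) * 'C(2 * k, k)%:R :> R.
  have := central_bin_ge k; rewrite -(ler_nat R) natrM natrD natrM natrX.
  by rewrite exprM (_ : 2 ^+ 2 = 4%:R :> R)// expr2 -natrM.
by rewrite ler_pdivlMr ?exprn_gt0// mulrC ler_pdivrMr// mulrC.
Qed.

Lemma moment_ge k (S : R) : 1 <= S ->
  (2 * k%:R + 1)^-1 <= 'C(2 * k, k)%:R / 2 ^+ (2 * k) * (k`!%:R * S ^+ k).
Proof.
move=> S1; apply: le_trans (central_bin_ratio_ge k) _.
rewrite ler_peMr ?divr_ge0 ?exprn_ge0//.
rewrite -[leLHS]mulr1; apply: ler_pM => //; last exact: exprn_ege1.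
by rewrite ler1n fact_gt0.
Qed.

(** The powers of S cancel, leaving the central binomial ratio and k!^4/(4k)!. Trading 2k+1 <= 401
    exp(k/200) for a polynomial loss costs exp(-k/50), which with 282/50 from [fact4_le] gives
    283/50. *)
Lemma moment_ratio_ge k (q S : R) : 401 <= q -> 1 <= S ->
  q ^- 4 * expR (- (283 / 50 * k%:R)) <=
  ('C(2 * k, k)%:R / 2 ^+ (2 * k) * (k`!%:R * S ^+ k)) ^+ 4 / ((4 * k)`!%:R * S ^+ (4 * k)).
Proof.
move=> q401 S1.
have q0 : 0 < q by apply: lt_le_trans q401; rewrite ltr0n.
have S0 : 0 < S ^+ k by rewrite exprn_gt0//; lra.
have f0 n : 0 < n`!%:R :> R by rewrite ltr0n fact_gt0.
have [b bE] : {b : R | b = 'C(2 * k, k)%:R / 2 ^+ (2 * k)} by eexists.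
have f1 : (k`!%:R : R) != 0 by rewrite gt_eqF.
rewrite -bE.
have k1 : 2 * k%:R + 1 <= q * expR (k%:R / 200) :> R.
  have e0 := expR_ge0 (k%:R / 200 : R).
  apply: (@le_trans _ _ (401 * expR (k%:R / 200))); last by rewrite ler_wpM2r.
  have := expR_ge1Dx (k%:R / 200 : R); have : 0 <= k%:R :> R by []; lra.
have k0 : 0 < 2 * k%:R + 1 :> R by rewrite ltr_wpDl ?mulr_ge0.
have hb : (2 * k%:R + 1)^-1 <= b by rewrite bE; exact: central_bin_ratio_ge.
have hb4 : (q * expR (k%:R / 200))^-1 <= b.
  by apply: le_trans hb; rewrite lef_pV2 ?posrE ?mulr_gt0 ?expR_gt0.
have b0 : 0 <= b by apply: le_trans hb4; rewrite invr_ge0 mulr_ge0 ?expR_ge0 ?(ltW q0).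
have e1 : q ^- 4 * expR (- (k%:R / 50)) <= b ^+ 4.
  have := @lerXn2r R 4 (q * expR (k%:R / 200))^-1 b.
  rewrite !nnegrE b0 invr_ge0 mulr_ge0 ?expR_ge0 ?(ltW q0)// => /(_ isT isT hb4); apply: le_trans.
  rewrite [leRHS]exprVn exprMn [leRHS]invfM ler_wpM2l ?invr_ge0 ?exprn_ge0 ?(ltW q0)//.
  rewrite -expRM_natr -expRN ler_expR; lra.
have F : expR (- (282 / 50 * k%:R)) <= k`!%:R ^+ 4 / (4 * k)`!%:R :> R.
  have h := fact4_le k; rewrite -(ler_nat R) natrM !natrX in h.
  rewrite ler_pdivlMr// mulrC expRN ler_pdivrMr ?expR_gt0//.
  apply: le_trans h _; rewrite mulrC ler_wpM2l ?exprn_ge0//.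
  rewrite (_ : 256 = 2 ^+ 8 :> R); last by rewrite -natrX.
  rewrite -exprM -[X in X ^+ _]lnK ?posrE// -expRM_natr ler_expR natrM.
  have := ler_wpM2r (ler0n R k) (ln2_le R); lra.
have -> : (b * (k`!%:R * S ^+ k)) ^+ 4 / ((4 * k)`!%:R * S ^+ (4 * k)) =
    b ^+ 4 * (k`!%:R ^+ 4 / (4 * k)`!%:R).
  rewrite (mulnC 4 k) exprM; have := f0 (k * 4)%N; move: S0 (k * 4)`! => S0 F4 F40.
  by field; rewrite !gt_eqF.
apply: le_trans (ler_pM _ _ e1 F).
- by rewrite -[leRHS]mulrA -expRD ler_wpM2l ?invr_ge0 ?exprn_ge0 ?(ltW q0)// ler_expR; lra.
- by rewrite mulr_ge0 ?expR_ge0// invr_ge0 exprn_ge0// ltW.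
- exact: expR_ge0.
Qed.
End MomentBounds.

(** * The measure bound for given degree and range of primes *)

Section PrimeMeasure.
Variable R : realType.
Implicit Types (V L T N v u x c X B : R).

Section ShortPrimes.
Variables (My : nat) (Z : R).
Hypothesis Z0 : 0 <= Z.
Let Np := Num.truncn (expR Z).
Let pr := @prime_val My Np.

Lemma prime_val_le p : (pr p)%:R <= expR Z.
Proof.
have /andP[_ h] := prime_val_bounds p.
have /andP[h2 _] := truncn_itv (expR_ge0 Z).
by apply: le_trans h2; rewrite ler_nat.
Qed.

Lemma nf_prime_val_le m (f : {ffun 'I_m -> prime_ind My Np}) K N :
  (m <= K)%N -> expR (Z * K%:R) = N -> (nf pr f)%:R <= N.
Proof.
move=> mK <-; rewrite expRM_natr.
apply: (@le_trans _ _ (expR Z ^+ m)).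
  rewrite -[in leRHS](card_ord m) -prodr_const /nf natr_prod; apply: ler_prod => i _.
  by rewrite ler0n prime_val_le.
by apply: ler_weXn2l => //; rewrite -[leLHS]expR0 ler_expR.
Qed.

Lemma sum_rsqrt_prime_le : (My <= Np)%N -> \sum_p (Num.sqrt (pr p)%:R)^-1 <= expR Z.
Proof.
move=> MN; rewrite (@sum_prime_ind R My Np (fun n => (Num.sqrt n%:R)^-1) MN).
apply: (@le_trans _ _ (\sum_(My <= n < Np) 1)).
  apply: ler_sum => n _; case: ifP => // _; rewrite invf_le1 ?sqrtr_gt0 ?ltr0n//.
  by rewrite -[leLHS]sqrtr1 ler_wsqrtr// ler1n.
rewrite big_const_nat iter_addr_0.
have /andP[h2 _] := truncn_itv (expR_ge0 Z).
by apply: le_trans h2; rewrite ler_nat leq_subr.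
Qed.
End ShortPrimes.

Lemma prime_measure_lower (k j J M : nat) (T x v c B q : R) :
  let N := expR ((1 - 3 / 25) * ln T) in
  let y := expR (c + 3 * v) in
  let w := winc R J in
  let Q := 769 * (1 + ln (128 * T)) in
  401 <= q -> 1 <= T -> 32 * J%:R * N < T -> N <= M%:R -> M%:R <= 128 * T ->
  offdiag J N T * (N ^+ 2 * M%:R) <= w -> 2 * k%:R + 1 <= T ->
  (0 < j <= k)%N -> 7 / 4 <= x -> 1 <= v -> 0 <= c ->
  expR (2 / 3 * x + 4 / v) * (3 * v + (c + 1)) <= 22 / 100 * ln T / k%:R - 1 ->
  4 * j%:R ^+ 2 <= (k - j)%:R * (2 / 3 * x) ->
  2 * k%:R / y <= 2^-1 -> 0 <= B ->
  (2 * B + 2) * (expR 1 * (2 * j)%:R) * expR (4 * k%:R * (2 * k%:R / y)) <= expR (2 * j)%:R ->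
  ((w ^+ 3 * T * (q ^- 4 * expR (- (283 / 50 * k%:R))) / (4 * Q ^+ 2))%:E <=
     lebesgue_measure (zpoly_large M T B))%E.
Proof.
move=> N y w Q q401 T1 JN NM M128 err kT jk x74 v1 c0 ratio jS d2 B0 gain.
have T0 : 0 < T by exact: lt_le_trans ltr01 T1.
have k0 : (0 < k)%N by case/andP: jk => a b; exact: leq_trans b.
have kR : 0 < k%:R :> R by rewrite ltr0n.
have x0 : 0 <= x by apply: le_trans x74; rewrite divr_ge0.
(* Primes up to exp Z have 4k-fold products up to exp(4kZ) = T^(22/25), which is N. *)
have [Z ZE] : {Z | Z = 22 / 100 * ln T / k%:R} by eexists.
rewrite -ZE in ratio.
have Zk : Z * k%:R = 22 / 100 * ln T by rewrite ZE divfK ?gt_eqF.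
have Z0 : 0 <= Z by rewrite ZE divr_ge0// mulr_ge0 ?ln_ge0.
have /= [MN S23] := recip_primes_ge v1 x0 c0 ratio.
have MN' : (Num.truncn y <= Num.truncn (expR Z))%N by case/andP: MN.
rewrite -/y in S23 MN.
pose pr := @prime_val (Num.truncn y) (Num.truncn (expR Z)).
have y0 : 0 < y := expR_gt0 _.
have pry p : y <= (pr p)%:R.
  have /andP[h _] := prime_val_bounds p.
  have /andP[_ h2] := truncn_itv (ltW y0).
  by apply: le_trans (ltW h2) _; rewrite ler_nat.
have N1 : 1 <= N.
  by rewrite -[leLHS]expR0 ler_expR mulr_ge0 ?ln_ge0// subr_ge0 ler_pdivrMr// mul1r ler_nat.
have ZN : expR (Z * (4 * k)%:R) = N.
  by rewrite /N; congr expR; rewrite natrM mulrCA Zk; clear; lra.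
have ZN8 : expR Z ^+ (8 * k) = N ^+ 2.
  by rewrite -ZN -expRM_natr -expRM_natr; congr expR; rewrite !natrM; clear; ring.
have Ez1 : 1 <= expR Z by rewrite -[leLHS]expR0 ler_expR.
have fN m (f : {ffun 'I_m -> _}) : (m <= 4 * k)%N -> (nf pr f)%:R <= N.
  by move=> mk; exact: (nf_prime_val_le Z0 f mk ZN).
have SE : \sum_p ((pr p)%:R)^-1 = \sum_(Num.truncn y <= n < Num.truncn (expR Z))
    (if prime n.+1 then (n.+1%:R)^-1 else 0) :> R.
  exact: (@sum_prime_ind R _ _ (fun n => (n%:R)^-1) MN').
have [S SS] : {S : R | S = \sum_p ((pr p)%:R)^-1} by eexists.
rewrite -SE -SS in S23.
have S1 : 1 <= S by apply: le_trans S23; clear - x74; lra.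
have [A AA] : {A : R | A = \sum_p (Num.sqrt (pr p)%:R)^-1} by eexists.
have A0 : 0 <= A by rewrite AA sumr_ge0// => p _; rewrite invr_ge0 sqrtr_ge0.
have AZ : A <= expR Z by rewrite AA; exact: sum_rsqrt_prime_le.
have A8 : A ^+ (8 * k) <= N ^+ 2 by rewrite -ZN8 lerXn2r ?nnegrE ?expR_ge0.
have A2 : A ^+ (2 * k) <= N ^+ 2.
  apply: (@le_trans _ _ (expR Z ^+ (2 * k))); first by rewrite lerXn2r ?nnegrE ?expR_ge0.
  by rewrite -ZN8 ler_weXn2l// leq_mul2r orbT.
have jk2 : (k + j <= 2 * k)%N by case/andP: jk => _ ?; rewrite mul2n -addnn leq_add2l.
have d0 : 0 <= 2 * k%:R / y by rewrite divr_ge0 ?mulr_ge0// ltW.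
have dS : (2 * k)%:R / y <= S.
  by rewrite natrM; apply: le_trans d2 _; apply: le_trans S1; clear; lra.
have U : (S * (1 - 2 * k%:R / y)) ^+ (k + j) <= injsum R pr (k + j).
  have := injsum_ge (@prime_val_prime _ _) y0 pry jk2.
  rewrite -SS => /(_ dS); apply: le_trans.
  have dd : 2 * k%:R / y <= S * (2 * k%:R / y) by rewrite ler_peMl.
  rewrite lerXn2r ?nnegrE; rewrite ?natrM in dS *.
  - by [].
  - by apply: mulr_ge0; [exact: le_trans ler01 S1|clear - d2; lra].
  - by rewrite subr_ge0.
  - by rewrite mulrBr mulr1 lerD2l lerN2.
have S0 : 0 < S by exact: lt_le_trans ltr01 S1.
have jS' : 4 * j%:R ^+ 2 <= (k - j)%:R * S.
  by apply: le_trans jS _; rewrite ler_wpM2l.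
have main := power_gain jk S1 jS' d0 d2 U B0 gain.
have X1 := moment_ge k S1.
have XR := moment_ratio_ge k q401 S1.
have w0 : 0 < w := winc_gt0 _ _.
have jk' : (j <= k)%N by case/andP: jk.
have := @measure_lower R _ pr (@prime_val_prime _ _) (@prime_val_inj _ _) k j J M N T B.
rewrite /= -SS -AA; move: ('C(2 * k, k)%:R / _ * _) main X1 XR => X main X1 XR.
have wT : w <= w * T by rewrite ler_peMr// ltW.
have wTX : w <= w * T * X.
  rewrite -[w * T * X]mulrA ler_peMr ?(ltW w0)//.
  have k20 : 0 < 2 * k%:R + 1 :> R by rewrite ltr_wpDl ?mulr_ge0.
  apply: (@le_trans _ _ ((2 * k%:R + 1) * (2 * k%:R + 1)^-1)); first by rewrite mulfV ?gt_eqF.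
  by apply: ler_pM => //; rewrite ?invr_ge0 ?ltW.
move=> /(_ T1 N1 JN fN jk' NM M128 S1 B0 A2 A8 (le_trans err wTX) (le_trans err wT) main).
apply: le_trans; rewrite lee_fin -/Q -/w.
have Q0 : 0 < Q.
  have l0 : 0 <= ln (128 * T) by rewrite ln_ge0// -[leLHS]mulr1; apply: ler_pM; rewrite ?ler1n.
  by apply: mulr_gt0; [rewrite ltr0n|exact: (ltr_wpDr l0 ltr01)].
have F0 : 0 < (4 * k)`!%:R * S ^+ (4 * k) by rewrite mulr_gt0 ?exprn_gt0// ltr0n fact_gt0.
move: ((4 * k)`!%:R * _) F0 XR => F F0 XR.
clearbody Q w.
have -> : w ^+ 3 * T * X ^+ 4 / (4 * Q ^+ 2 * F) = w ^+ 3 * T * (X ^+ 4 / F) / (4 * Q ^+ 2).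
  by clear - Q0 F0; field; rewrite !gt_eqF.
have Q2 : 0 <= 4 * Q ^+ 2 by apply: mulr_ge0 => //; exact: sqr_ge0.
rewrite ler_wpM2r ?invr_ge0// ler_wpM2l//.
by apply: mulr_ge0; [apply: exprn_ge0; exact: ltW|exact: ltW].
Qed.
End PrimeMeasure.

(** * Choice of the degree and admissibility of the range of primes *)

Section DegreeAndLength.
Variable R : realType.
Implicit Types (V L T N v u x c X B : R).

Lemma ln3_ge1 : 1 <= ln (3 : R).
Proof.
rewrite -[leLHS]expRK ler_ln ?posrE ?expR_gt0//.
have p : 0 <= 7 / 8 :> R by rewrite divr_ge0.
have h1 := expR_sqr_ge p (_ : 7 / 8 <= expR (- 8^-1 : R)) (lexx _).
have {}h1 := h1 (ltac:(apply: le_trans (expR_ge1Dx _); lra)).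
have h2 := expR_sqr_ge (sqr_ge0 _) h1 (lexx _).
have h3 := expR_sqr_ge (sqr_ge0 _) h2 (lexx _).
rewrite (_ : 2 * (2 * (2 * _)) = - 1 :> R) in h3; last by clear; field.
rewrite expRN in h3.
rewrite -[leLHS]invrK -[leRHS]invrK lef_pV2 ?posrE ?invr_gt0 ?expR_gt0//.
by apply: le_trans h3; rewrite !expr2; lra.
Qed.

(** Squaring the upper bound on V gives L >= 25 V^2 ln L >= 50 V^2 ln V, because V^2 <= L; hence u
    >= 50/8 = 25/4 and x >= 7/4. *)
Lemma range_facts L V : 0 < L -> 1 <= ln L -> 3 <= V ->
  V <= 5^-1 * Num.sqrt (L / ln L) ->
  let v := ln V in let u := L / (8 * V ^+ 2 * v) in let x := ln u in
  [/\ 1 <= v, L = 8 * V ^+ 2 * v * u, u = expR x, 7 / 4 <= x <= ln L & V ^+ 2 <= L].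
Proof.
move=> L0 l1 V3 VL v u x.
have V0 : 0 < V by lra.
have v1 : 1 <= v.
  by apply: le_trans ln3_ge1 _; rewrite ler_ln ?posrE.
have v0 : 0 < v by lra.
have l0 : 0 < ln L by lra.
have V2 : 25 * V ^+ 2 * ln L <= L.
  have h : V ^+ 2 <= (5^-1 * Num.sqrt (L / ln L)) ^+ 2.
    by rewrite lerXn2r ?nnegrE ?mulr_ge0 ?sqrtr_ge0//; lra.
  rewrite exprMn sqr_sqrtr ?divr_ge0 ?(ltW L0) ?(ltW l0)// mulrA ler_pdivlMr// in h.
  rewrite exprVn (_ : 5 ^+ 2 = 25 :> R) in h; last by rewrite -natrX.
  lra.
have V20 : 0 < V ^+ 2 by exact: exprn_gt0.
have V2L : V ^+ 2 <= L.
  apply: le_trans V2; rewrite mulrAC ler_peMl ?(ltW V20)//; lra.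
have v2 : 2 * v <= ln L.
  by rewrite /v mulr_natl -lnXn// ler_ln ?posrE.
have den : 0 < 8 * V ^+ 2 * v by apply: mulr_gt0 => //; apply: mulr_gt0.
have LE : L = 8 * V ^+ 2 * v * u by rewrite /u mulrC divfK// gt_eqF.
have u254 : 25 / 4 <= u.
  rewrite /u ler_pdivlMr//; apply: le_trans V2.
  have := ler_wpM2l (ltW V20) v2; lra.
have u0 : 0 < u by apply: lt_le_trans u254; rewrite divr_gt0.
have uL : u <= L.
  rewrite [leRHS]LE ler_peMl ?(ltW u0)//.
  have V21 : 1 <= V ^+ 2 by apply: exprn_ege1; lra.
  rewrite -[leLHS]mulr1; apply: ler_pM => //; lra.
split=> //; first by rewrite /x lnK.
apply/andP; split; last by rewrite ler_ln ?posrE.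
by apply: le_trans (ln_25_4_ge R) _; rewrite ler_ln ?posrE// divr_gt0.
Qed.

(** Here a stands for 2j. Its excess V/50 over V pays V/100 for the factor a of Stirling's bound and
    V/200 for repeated primes; its excess 2c pays for the constants, since c = 2D gives D (2+c) <=
    (1+c)^2 <= exp(2c). *)
Lemma gain_const C0 : 0 <= C0 -> exists c, 0 <= c /\
  forall V a e, 3 <= V -> 51 / 50 * V + 2 * c <= a -> a <= 51 / 50 * V + 2 * c + 2 ->
  e <= V / 200 -> (2 * (expR V + C0) + 2) * (expR 1 * a) * expR e <= expR a.
Proof.
move=> C00; have [D DE] : {D : R | D = (4 + 2 * C0) * expR 1 * 100} by eexists.
have D0 : 0 <= D by rewrite DE; apply: mulr_ge0 => //; apply: mulr_ge0; [clear - C00; lra|exact: expR_ge0].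
have c0 : 0 <= 2 * D by exact: mulr_ge0.
exists (2 * D); split=> // V a e V3 a1 a2 eV.
have [c cE] : {c | c = 2 * D} by eexists.
rewrite -cE in c0 a1 a2.
have V1 : 1 <= expR V by rewrite -[leLHS]expR0 ler_expR; clear - V3; lra.
have B2 : 2 * (expR V + C0) + 2 <= (4 + 2 * C0) * expR V.
  by have := ler_wpM2l C00 V1; clear - V1; lra.
have a3 : a <= V * (2 + c).
  by have := ler_wpM2r c0 V3; clear - a2 V3 c0; lra.
have a0 : 0 <= a by clear - a1 c0 V3; lra.
have V100 : V <= 100 * expR (V / 100).
  by have := expR_ge1Dx (V / 100); clear; lra.
have e1 : 0 < expR 1 :> R := expR_gt0 _.
have h1 : expR 1 * a <= expR 1 * (100 * expR (V / 100) * (2 + c)).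
  rewrite ler_wpM2l ?(ltW e1)//; apply: le_trans a3 _; by rewrite ler_wpM2r// addr_ge0.
have h2 : expR e <= expR (V / 200) by rewrite ler_expR.
have h3 : D * (2 + c) <= expR (2 * c).
  apply: (expR_sqr_ge (a := 1 + c)); [exact: addr_ge0|exact: expR_ge1Dx|].
  rewrite expr2; have := mulr_ge0 c0 c0; have := mulr_ge0 D0 c0; by rewrite cE; clear - D0; lra.
apply: (@le_trans _ _ ((4 + 2 * C0) * expR V * (expR 1 * (100 * expR (V / 100) * (2 + c))) * expR (V / 200))).
  apply: ler_pM => //; rewrite ?expR_ge0//.
    apply: mulr_ge0; last by rewrite mulr_ge0// ltW.
    by have := expR_ge0 V; clear - C00; lra.
  by apply: ler_pM => //; [have := expR_ge0 V; clear - C00; lra|rewrite mulr_ge0// ltW].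
rewrite [leLHS](_ : _ = (D * (2 + c)) * (expR V * expR (V / 100) * expR (V / 200))); last by rewrite DE; ring.
rewrite -!expRD; apply: (@le_trans _ _ (expR (2 * c) * expR (V + V / 100 + V / 200))).
  by rewrite ler_wpM2r ?expR_ge0.
by rewrite -expRD ler_expR; clear - a1 V3; lra.
Qed.

(** j is the least integer above 0.51 V + c, so that 2j exceeds V by the margin [gain_const] needs,
    and k - j is the least integer above 4j^2/((2/3)x), as [power_gain] requires. *)
Lemma degree_choice V c x : 3 <= V -> 0 <= c -> 7 / 4 <= x ->
  let g := 2 + c in
  exists j k : nat, [/\ (0 < j <= k)%N, 51 / 100 * V + c <= j%:R <= 51 / 100 * V + (c + 1),
    k%:R <= 51 / 100 * V + (c + 1) + 1 + 4 * (51 / 100 * V + (c + 1)) ^+ 2 / (2 / 3 * x),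
    4 * j%:R ^+ 2 <= (k - j)%:R * (2 / 3 * x) &
    k%:R <= (g + 1 + 4 * g ^+ 2) * V ^+ 2].
Proof.
move=> V3 c0 x74 g.
have y0 : 0 <= 51 / 100 * V + c by lra.
have /andP[t1 t2] := truncn_itv y0.
have [n nE] : {n | n = Num.truncn (51 / 100 * V + c)} by eexists.
rewrite -nE -natr1 in t1 t2.
pose j := n.+1.
have jE : j%:R = n%:R + 1 :> R by rewrite /j -natr1.
have s0 : 0 < 2 / 3 * x by lra.
have j0 : 0 <= j%:R :> R by [].
have z0 : 0 <= 4 * j%:R ^+ 2 / (2 / 3 * x) by rewrite divr_ge0 ?(ltW s0)// mulr_ge0// sqr_ge0.
have /andP[r1 r2] := truncn_itv z0.
move: (Num.truncn (4 * _ / _)) r1 r2 => m r1 r2.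
have jl : j%:R <= 51 / 100 * V + (c + 1) by rewrite jE; lra.
have kE : (j + m.+1)%:R = j%:R + m%:R + 1 :> R by rewrite natrD -natr1 addrA.
have m1 : m%:R <= 4 * (51 / 100 * V + (c + 1)) ^+ 2 / (2 / 3 * x).
  apply: le_trans r1 _; rewrite ler_wpM2r ?invr_ge0 ?(ltW s0)// ler_wpM2l//.
  by rewrite lerXn2r ?nnegrE//; lra.
have k1 : (j + m.+1)%:R <= 51 / 100 * V + (c + 1) + 1 + 4 * (51 / 100 * V + (c + 1)) ^+ 2 / (2 / 3 * x).
  by rewrite kE; lra.
exists j, (j + m.+1)%N; split => //.
- by rewrite /j/= -[X in (X <= _)%N]addn0 leq_add2l.
- by rewrite jl andbT jE; lra.
- by rewrite addKn -ler_pdivrMr// ltW.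
have V1 : 1 <= V by apply: le_trans V3; rewrite ler1n.
have V0 : 0 <= V := le_trans ler01 V1.
have gV : 51 / 100 * V + (c + 1) <= g * V.
  have h : c * 1 <= c * V by rewrite ler_wpM2l.
  by rewrite /g; clear - h V3; lra.
have g0 : 0 <= g by rewrite /g addr_ge0.
have sx : 4 * (51 / 100 * V + (c + 1)) ^+ 2 / (2 / 3 * x) <= 4 * (g * V) ^+ 2.
  have p0 : 0 <= 51 / 100 * V + (c + 1) by clear - V0 c0; lra.
  rewrite ler_pdivrMr//; apply: (@le_trans _ _ (4 * (g * V) ^+ 2)).
    by rewrite ler_wpM2l// lerXn2r ?nnegrE// mulr_ge0.
  by apply: ler_peMr; [apply: mulr_ge0 => //; exact: sqr_ge0|clear - x74; lra].
have VV : 1 <= V ^+ 2 by exact: exprn_ege1.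
have V1V : g * V <= g * V ^+ 2 by rewrite ler_wpM2l// expr2 ler_peMl.
apply: le_trans k1 _.
have -> : (g + 1 + 4 * g ^+ 2) * V ^+ 2 = g * V ^+ 2 + V ^+ 2 + 4 * (g * V) ^+ 2 by ring.
by apply: lerD => //; apply: lerD => //; exact: le_trans gV V1V.
Qed.

(** If x < X and V < W then L = 8 V^2 v u < 8 W^3 exp X, because ln V <= V. So for L beyond this
    threshold one of [ratio_large] and [ratio_small] applies. *)
Lemma ratio_cond c c1 c3 : 0 <= c -> 0 <= c1 -> 1 <= c3 ->
  exists K, forall L V v u x k, K <= L -> 3 <= V -> v = ln V -> 1 <= v ->
    L = 8 * V ^+ 2 * v * u -> u = expR x -> 7 / 4 <= x -> 0 < k ->
    k <= 51 / 100 * V + c1 + 1 + 4 * (51 / 100 * V + c1) ^+ 2 / (2 / 3 * x) ->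
    k <= c3 * V ^+ 2 ->
    expR (2 / 3 * x + 4 / v) * (3 * v + (c + 1)) <= 22 / 100 * L / k - 1.
Proof.
move=> c0 c10 c31.
have c50 : 0 <= c + 1 by lra.
pose X := 3 * (4 + ln (c3 * (3 + (c + 1)))).
pose W := Num.max (125 * (5 * c1 + 4 * c1 ^+ 2 + X * (c1 + 2))) (expR (100 * (c + 1))).
have W1 : 125 * (5 * c1 + 4 * c1 ^+ 2 + X * (c1 + 2)) <= W by rewrite le_max lexx.
have W2 : expR (100 * (c + 1)) <= W by rewrite le_max lexx orbT.
exists (8 * W ^+ 3 * expR X) => L V v u x k KL V3 vE v1 LE uE x74 k0 k1 k2.
have V0 : 0 < V by lra.
have [Xx|xX] := leP X x; first exact: (ratio_large V0 k0 LE uE k2 v1 c31 c50 Xx).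
have WV : W <= V.
  have W0 : 0 < W by apply: lt_le_trans W2; exact: expR_gt0.
  rewrite leNgt; apply/negP => VW.
  have vV : v <= V by rewrite vE; have := @ln_sublinear R V V0; exact: ltW.
  have : L < 8 * W ^+ 3 * expR X; last by rewrite ltNge KL.
  rewrite LE; have -> : 8 * V ^+ 2 * v * u = (8 * (V ^+ 2 * v)) * u by ring.
  have h0 : V ^+ 2 * v <= V ^+ 3 by rewrite [leRHS]exprSr ler_wpM2l ?sqr_ge0.
  have h1 : V ^+ 3 < W ^+ 3 by rewrite ltrXn2r ?nnegrE// ltW.
  have h2 : 0 <= V ^+ 2 * v by rewrite mulr_ge0 ?sqr_ge0//; lra.
  have h3 : 8 * (V ^+ 2 * v) < 8 * W ^+ 3 by rewrite ltr_pM2l// (le_lt_trans h0).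
  have h4 : 0 <= 8 * (V ^+ 2 * v) by exact: mulr_ge0.
  by rewrite uE; apply: (ltr_pM h4 (expR_ge0 _) h3); rewrite ltr_expR.
have V1 : 1 <= V by lra.
have x0 : 0 < x by lra.
have hk := degree_le V1 c10 x0 (ltW xX) (le_trans W1 WV) k1.
have v100 : 100 * (c + 1) <= v.
  by rewrite vE -[leLHS]expRK ler_ln ?posrE ?expR_gt0// (le_trans W2 WV).
by apply: (ratio_small V0 k0 LE uE x74 hk) => //; lra.
Qed.
End DegreeAndLength.

(** * Assembly of the measure bound, uniformly in V *)

Section MeasureBound.
Variable R : realType.
Implicit Types (V L T N v u x c X B : R).

(** Since k <= c3 V^2, the loss 8 k^2/y from repeated primes is at most 8 V/G, which is at most
    V/200 for G >= 1600; this is why y is of order V^3. *)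
Lemma shift_bounds (c3 V y k G : R) : 1600 <= G -> 1 <= c3 -> 3 <= V -> 0 <= k ->
  k <= c3 * V ^+ 2 -> y = G * c3 ^+ 2 * V ^+ 3 ->
  2 * k / y <= 2^-1 /\ 4 * k * (2 * k / y) <= V / 200.
Proof.
move=> G16 c31 V3 k0 kc yE.
have G0 : 0 < G by lra.
have c30 : 0 < c3 by lra.
have V0 : 0 < V by lra.
have cV : 0 < c3 * V by exact: mulr_gt0.
have y0 : 0 < y.
  by rewrite yE; apply: mulr_gt0; [apply: mulr_gt0|]; rewrite ?exprn_gt0.
have h : 2 * k / y <= 2 * (G * (c3 * V))^-1.
  apply: (@le_trans _ _ (2 * (c3 * V ^+ 2) / y)).
    by rewrite ler_wpM2r ?ler_wpM2l// invr_ge0 ltW.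
  rewrite yE le_eqVlt; apply/orP; left; apply/eqP.
  by field; rewrite !gt_eqF.
have GV0 : 0 < G * (c3 * V) by exact: mulr_gt0.
have cV1 : 1 <= c3 * V by rewrite -[leLHS]mul1r; apply: ler_pM => //; lra.
split.
  apply: le_trans h _; rewrite ler_pdivrMr// -ler_pdivrMl ?invr_gt0// invrK.
  have : G <= G * (c3 * V) by rewrite ler_peMr// ltW.
  lra.
apply: (@le_trans _ _ (4 * (c3 * V ^+ 2) * (2 * (G * (c3 * V))^-1))).
  apply: ler_pM => //; [exact: mulr_ge0|by rewrite divr_ge0 ?mulr_ge0// ltW|].
  by rewrite ler_wpM2l.
rewrite [leLHS](_ : _ = V * (8 / G)); last by field; rewrite !gt_eqF.
rewrite ler_wpM2l ?(ltW V0)// ler_pdivrMr//; lra.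
Qed.

(** The fourth power of L is made of Q^2 <= (D L)^2, from the second moment of zeta, and of exp(-2
    ln L), from the cost of k. *)
Lemma final_bound (w T q Q L V x k C D : R) : 0 < w -> 0 < T -> 0 < q -> 0 < Q ->
  Q <= D * L -> 0 < D -> 0 < L ->
  283 / 50 * k <= 10 * (V ^+ 2 / x) + 2 * ln L + C ->
  w ^+ 3 * q ^- 4 * expR (- C) / (4 * D ^+ 2) * (T / L ^+ 4 * expR (- 10 * (V ^+ 2 / x))) <=
  w ^+ 3 * T * (q ^- 4 * expR (- (283 / 50 * k))) / (4 * Q ^+ 2).
Proof.
move=> w0 T0 q0 Q0 QD D0 L0 hk.
have e1 : expR (- C) * expR (- 10 * (V ^+ 2 / x)) / L ^+ 2 <= expR (- (283 / 50 * k)).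
  have -> : (L ^+ 2)^-1 = expR (- (2 * ln L)).
    by rewrite expRN mulrC expRM_natr lnK.
  by rewrite -!expRD ler_expR; lra.
have i2 : (4 * (D * L) ^+ 2)^-1 <= (4 * Q ^+ 2)^-1.
  have DL : 0 < D * L by exact: mulr_gt0.
  have p1 : 0 < 4 * Q ^+ 2 by apply: mulr_gt0 => //; exact: exprn_gt0.
  have p2 : 0 < 4 * (D * L) ^+ 2 by apply: mulr_gt0 => //; exact: exprn_gt0.
  by rewrite lef_pV2 ?posrE// ler_wpM2l// lerXn2r ?nnegrE// ltW.
have p0 : 0 <= w ^+ 3 * T * q ^- 4.
  by apply: mulr_ge0; [apply: mulr_ge0; [apply: exprn_ge0|]|rewrite invr_ge0; apply: exprn_ge0]; exact: ltW.
have -> : w ^+ 3 * T * (q ^- 4 * expR (- (283 / 50 * k))) / (4 * Q ^+ 2) =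
  w ^+ 3 * T * q ^- 4 * (expR (- (283 / 50 * k)) * (4 * Q ^+ 2)^-1) by rewrite !mulrA.
have -> : w ^+ 3 * q ^- 4 * expR (- C) / (4 * D ^+ 2) * (T / L ^+ 4 * expR (- 10 * (V ^+ 2 / x))) =
  w ^+ 3 * T * q ^- 4 * (expR (- C) * expR (- 10 * (V ^+ 2 / x)) / L ^+ 2 * (4 * (D * L) ^+ 2)^-1).
  by move: (expR _) (expR (- 10 * _)) => a b; clear - w0 T0 q0 D0 L0; field; rewrite !gt_eqF.
apply: ler_wpM2l => //; apply: ler_pM => //.
  by apply: divr_ge0; [apply: mulr_ge0; exact: expR_ge0|exact: sqr_ge0].
by rewrite invr_ge0; apply: mulr_ge0 => //; exact: sqr_ge0.
Qed.

(** The threshold e^V + C0 leaves e^V for zeta itself after an approximation error C0. All constants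
    are fixed before T and V; only j, k and the range of primes depend on them. *)
Lemma measure_zpoly_large C0 : 0 <= C0 -> exists c, 0 < c /\
  \forall T \near +oo, forall V, 3 <= V -> V <= 5^-1 * Num.sqrt (ln T / ln (ln T)) ->
  ((c * (T / ln T ^+ 4 * expR (- 10 * (V ^+ 2 / ln (ln T / (8 * V ^+ 2 * ln V))))))%:E
     <= lebesgue_measure (zpoly_large (Num.truncn (128 * T)) T (expR V + C0)))%E.
Proof.
move=> C00; have [c [c0 gain]] := gain_const C00.
have c10 : 0 <= c + 1 by lra.
have [g gE] : {g : R | g = 2 + c} by eexists.
have [c3 c3E] : {c3 : R | c3 = g + 1 + 4 * g ^+ 2} by eexists.
have c31 : 1 <= c3 by rewrite c3E; have := sqr_ge0 g; lra.
have [G G16] : {G : R | 1600 <= G} by exists 1600.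
have G0 : 0 < G by apply: lt_le_trans G16; rewrite ltr0n.
pose cy := ln (G * c3 ^+ 2).
have c320 : 1 <= c3 ^+ 2 by apply: exprn_ege1.
have cy0 : 0 <= cy by rewrite /cy ln_ge0// -[leLHS]mul1r; apply: ler_pM => //; apply: le_trans G16; rewrite ler1n.
have [K ratio] := ratio_cond cy0 c10 c31.
(* The loss 3/25 matches N = T^(22/25), and J = 50 gives J e = 6, above the 4 required by
   [window_cond]. *)
have [J [e [e0 eE Je]]] : exists (J : nat) (e : R), [/\ 0 < e, e = 3 / 25 & 4 <= J%:R * e].
  by exists 50%N, (3 / 25); split=> //; lra.
have w0 := winc_gt0 R J.
have [q q401] : {q : R | 401 <= q} by exists 401.
have q0 : 0 < q by apply: lt_le_trans q401; rewrite ltr0n.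
have [C CE] : {C : R | C = 6 * (c + 1 + 1) + 60 * (60 * (c + 1) ^+ 2)} by eexists.
have [D DE] : {D : R | D = 769 * 2} by eexists.
have D0 : 0 < D by rewrite DE -natrM ltr0n.
exists (winc R J ^+ 3 * q ^- 4 * expR (- C) / (4 * D ^+ 2)); split.
  apply: divr_gt0; last by apply: mulr_gt0 => //; exact: exprn_gt0.
  apply: mulr_gt0; last exact: expR_gt0.
  by apply: mulr_gt0; [exact: exprn_gt0|rewrite invr_gt0; exact: exprn_gt0].
near=> T => V V3 VT.
have r1 : K <= ln T by near: T; apply: (@near_ln R (fun x => K <= x)); exact: near_ge.
have r2 : 1 <= ln (ln T).
  near: T; apply: (@near_ln R (fun x => 1 <= ln x)); apply: (@near_ln R (fun x => 1 <= x)).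
  exact: near_ge.
have r3 : ln T ^+ 1 <= (4 * c3)^-1 * T.
  near: T; apply: near_ln_pow; rewrite invr_gt0; lra.
have r4 : 2 <= T by near: T; exact: near_ge.
have r5 : ln (64 * J%:R) / e <= ln T.
  near: T; apply: (@near_ln R (fun x => ln (64 * J%:R) / e <= x)); exact: near_ge.
have r6 : (32 * J%:R) ^+ J.*2 * 512 / winc R J <= T by near: T; exact: near_ge.
have r7 : 1 + ln 128 <= ln T.
  near: T; apply: (@near_ln R (fun x => 1 + ln 128 <= x)); exact: near_ge.
have r0 : 1 <= ln T by near: T; apply: (@near_ln R (fun x => 1 <= x)); exact: near_ge.
have LT0 : 0 < ln T := lt_le_trans ltr01 r0.
have T1 : 1 <= T by apply: le_trans r4; rewrite ler1n.
have T0 : 0 < T := lt_le_trans ltr01 T1.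
have := range_facts LT0 r2 V3 VT.
have [v vE] : {v : R | v = ln V} by eexists.
rewrite /= -vE; have [u uu] : {u : R | u = ln T / (8 * V ^+ 2 * v)} by eexists.
rewrite -uu; move: (ln u) => x [v1 LE uE /andP[x74 xl] V2L].
have [j [k [jk /andP[j1 j2] k1 jS k2]]] := degree_choice V3 c0 x74.
rewrite -gE -c3E in k2.
have k0 : 0 < k%:R :> R by rewrite ltr0n; case/andP: jk => a b; exact: leq_trans b.
have rat := ratio _ _ _ _ _ _ r1 V3 vE v1 LE uE x74 k0 k1 k2.
have V0 : 0 < V by apply: lt_le_trans V3.
have yE : expR (cy + 3 * v) = G * c3 ^+ 2 * V ^+ 3.
  rewrite expRD lnK ?posrE; last by rewrite mulr_gt0// (lt_le_trans _ c320).
  by rewrite (mulrC 3) expRM_natr vE lnK.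
have [d2 d4] := shift_bounds G16 c31 V3 (ltW k0) k2 yE.
have [NT JN err] := window_cond e0 Je T1 (erefl _) r5 r6.
have := truncn128_bounds T1.
move: (Num.truncn (128 * T)) => Mz /andP[Mz1' Mz1].
have NM : expR ((1 - e) * ln T) <= Mz%:R.
  by apply: le_trans NT _; apply: le_trans Mz1'; rewrite ler_peMl ?ler1n// ltW.
have kT : 2 * k%:R + 1 <= T.
  rewrite expr1 ler_pdivlMl in r3; last by apply: mulr_gt0 => //; exact: (lt_le_trans ltr01 c31).
  have h : c3 * V ^+ 2 <= c3 * ln T by rewrite ler_wpM2l// (le_trans ler01 c31).
  clear - k2 r3 r4 h; lra.
have B0 : 0 <= expR V + C0 by rewrite addr_ge0 ?expR_ge0.
have a1 : 51 / 50 * V + 2 * c <= (2 * j)%:R by rewrite natrM; clear - j1; lra.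
have a2 : (2 * j)%:R <= 51 / 50 * V + 2 * c + 2 by rewrite natrM; clear - j2; lra.
have gn := gain V _ _ V3 a1 a2 d4.
rewrite eE in JN NT NM err.
have := prime_measure_lower q401 T1 JN NM Mz1 (err _ Mz1) kT jk x74 v1 cy0 rat jS d2 B0 gn.
apply: le_trans; rewrite lee_fin.
have cost := cost_le (ltW V0) c10 x74 xl k1; rewrite -addrA -CE in cost.
have QE : 769 * (1 + ln (128 * T)) <= D * ln T.
  rewrite lnM ?posrE// DE; clear - r7; lra.
have Q0 : 0 < 769 * (1 + ln (128 * T)).
  have l0 : 0 <= ln (128 * T) by apply: ln_ge0; clear - T1; lra.
  by apply: mulr_gt0; [rewrite ltr0n|exact: (ltr_wpDr l0 ltr01)].
exact: final_bound.
Unshelve. all: by end_near. Qed.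
End MeasureBound.

Section LebesgueMono.
Variable R : realType.

(** The measure is given by an outer measure, so monotonicity holds for arbitrary sets and the level
    set of zeta can be compared without discussing its measurability. *)
Lemma le_lebesgue_measure (A B : set R) : A `<=` B ->
  (lebesgue_measure A <= lebesgue_measure B)%E.
Proof.
move=> AB; rewrite /lebesgue_measure /lebesgue_stieltjes_measure /measure_extension/=.
exact: le_mu_ext.
Qed.
End LebesgueMono.

Theorem theorem1 (R : realType) :
  (exists delta : R -> R,
     delta T @[T --> +oo] --> (0 : R) /\
     \forall T \near +oo, exists t : R,
       T <= t <= 2 * T /\
       (expR ((1 + delta T) * (Num.sqrt (ln T) / Num.sqrt (ln (ln T)))))%:C
         <= `|zeta (2^-1 +i* t)|)
  /\
  (exists c : R, 0 < c /\
     \forall T \near +oo, forall V : R,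
       3 <= V <= 5^-1 * Num.sqrt (ln T / ln (ln T)) ->
       ((c * (T / ln T ^+ 4 *
              expR (- 10 * (V ^+ 2 / ln (ln T / (8 * V ^+ 2 * ln V))))))%:E
        <= lebesgue_measure
             [set t : R | T <= t <= 2 * T /\
                (expR V)%:C <= `|zeta (2^-1 +i* t)| ]%R)%E).
Proof.
split; first exact: large_values_asymp.
have [C0 [C00 HC]] := @zeta_near_zpoly R.
have [c [c0 H]] := measure_zpoly_large (ltW C00).
exists c; split=> //; have := near_ge (1 : R); apply: filterS2 H => T hT T1 V /andP[V3 VT].
apply: le_trans (hT V V3 VT) _; apply: le_lebesgue_measure => t [tT ht]; split=> //.
rewrite norm_normc lecR.
apply: le_trans (normc_zeta_ge (HC T t _ T1 tT (truncn128_bounds T1))).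
by rewrite lerBrDr.
Qed.
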